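(* Let $d\geq 2$, let $O^c$ be locally $2$-fat away from $N$ and let $O$ be locally uniform near $N$. Let $A,A_0\in L^\infty(O;\mathbb{C}^{d\times d})$ be uniformly strongly elliptic such that $A_0$ has ellipticity constant $\lambda>0$ and $L_0:=-\mathrm{div}(A_0\nabla\cdot)$ has property $\mathrm{D}(\mu)$, with constant $c_{\mathrm{D}(\mu)}$. Then for all $\nu\in(0,\mu)$ there is some $\varepsilon=\varepsilon(c_{\mathrm{D}(\mu)},\lambda,d,\mu,\nu)>0$ such that if $\|A-A_0\|_\infty<\varepsilon$, then $L=-\mathrm{div}(A\nabla\cdot)$ has property $\mathrm{D}(\nu)$.
   Context: Setting. $O\subseteq\mathbb{R}^d$ is open, $D\subseteq\partial O$ is closed, $N:=\partial O\setminus D$. $B(x,r)$ is the open ball; for a set $E$ write $E(x,r):=E\cap B(x,r)$, $\partial O(x,r):=\partial(O(x,r))$, $\mathrm{d}_E(x)$ for the Euclidean distance of $x$ to $E$ ($+\infty$ if $E=\varnothing$), and $E_\delta:=\{x\in\mathbb{R}^d:\mathrm{d}_E(x)<\delta\}$. $O^c=\mathbb{R}^d\setminus O$. Functions are complex-valued. Spaces. For an open set $U$ and closed $F\subseteq\partial U$, $H^1_F(U)$ is the closure in $H^1(U)$ of $\{\varphi|_U:\varphi\in C_c^\infty(\mathbb{R}^d\setminus F)\}$. Operators. $A$ is uniformly strongly elliptic with ellipticity constant $\lambda>0$ if $\mathrm{Re}(A(x)\xi\cdot\overline\xi)\ge\lambda|\xi|^2$ for a.e. $x\in O$ and all $\xi\in\mathbb{C}^d$.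 $L=-\mathrm{div}(A\nabla\cdot)$ is the m-accretive operator in $L^2(O)$ associated with the form $a(u,v)=\int_O A\nabla u\cdot\overline{\nabla v}$ on $H_D^1(O)\times H_D^1(O)$; $L_0$ likewise with $A_0$. For $x\in\overline O$, $r>0$ and $u\in H^1(O(x,r))$, ''$L_Du=0$ in $O(x,r)$'' means $\int_{O(x,r)}A\nabla u\cdot\overline{\nabla\varphi}=0$ for all $\varphi\in H^1_{\partial O(x,r)\setminus N(x,r)}(O(x,r))$. Property $\mathrm{D}(\mu)$, $\mu\in(0,1]$, of $L$: there is $c_{\mathrm{D}(\mu)}>0$ such that for all $0<r\le R\le1$, $x\in\overline O$ and $u\in H^1_D(O)$ with $L_Du=0$ in $O(x,R)$: $\int_{O(x,r)}|\nabla u|^2\le c_{\mathrm{D}(\mu)}(r/R)^{d-2+2\mu}\int_{O(x,R)}|\nabla u|^2$. For $L_0$ use $A_0$ in place of $A$. Geometry. For $U$ open, $K\subseteq U$ compact, $p\in(1,d]$: $\mathrm{cap}_p(K;U):=\inf\{\|\nabla u\|_{L^p(U)}^p:u\in C_c^\infty(U;\mathbb{R}),\,u\ge1\text{ on }K\}$. A closed set $C$ is locally $p$-fat in $\widehat C\subseteq C$ if there is $c>0$ with $\mathrm{cap}_p(\overline{B(x,r)}\cap C;B(x,2r))\ge c\,r^{d-p}$ for all $x\in\widehat C$, $r\in(0,1]$. ''$O^c$ is locally $2$-fat away from $N$'' means: there is $\delta>0$ such that $D$ is locally $2$-fat in $D\cap N_\delta$ and $O^c$ is locally $2$-fat in $D$.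 ''$O$ is locally uniform near $N$'' means: there are $\varepsilon\in(0,1]$, $\delta\in(0,\infty]$, $C>0$ such that (i) all $x,y\in O\cap N_\delta$ with $0<|x-y|<\delta$ can be joined by a rectifiable curve $\gamma\subseteq O$ of length at most $|x-y|/\varepsilon$ with $\mathrm{d}(z,\partial O\cap N_\delta)\ge\varepsilon|z-x||z-y|/|x-y|$ for all $z$ on $\gamma$; (ii) every connected component $O'$ of $O$ with $\partial O'\cap N\ne\varnothing$ satisfies $\mathrm{diam}(O')\ge C\delta$. *)

(* Defs.v *)
From HB Require Import structures.
From mathcomp Require Import all_boot all_order all_algebra.
From mathcomp Require Import complex lra.
From mathcomp Require Import all_classical all_reals all_analysis ess_sup_inf.

Set Implicit Arguments.
Unset Strict Implicit.
Unset Printing Implicit Defensive.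

Import Order.TTheory GRing.Theory Num.Theory.
Import numFieldNormedType.Exports.
Import ComplexField.Normc.

Local Open Scope classical_set_scope.
Local Open Scope ring_scope.

Definition borel_rV_display : measure_display. Proof. exact: default_measure_display. Qed.

Section borel.
Context (R : realType) (n : nat).
Let B : set (set 'rV[R]_n) := <<s open >>.
Let B0 : B set0. Proof. exact: sigma_algebra0. Qed.
Let BC A : B A -> B (~` A). Proof. exact: sigma_algebraC. Qed.
Let BU (F : (set 'rV[R]_n)^nat) : (forall i, B (F i)) -> B (\bigcup_i F i).
Proof. exact: sigma_algebra_bigcup. Qed.
HB.instance Definition _ := @isMeasurable.Build borel_rV_display 'rV[R]_n B B0 BC BU.
End borel.

Section cons.
Context (R : realType) (n : nat).
Definition cons_rV (p : measurableTypeR R * 'rV[R]_n) : 'rV[R]_n.+1 :=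
  row_mx (p.1 : R)%:M p.2.

Lemma cons_rV0 p : cons_rV p ord0 ord0 = p.1.
Proof.
rewrite /cons_rV; have -> : (ord0 : 'I_n.+1) = lshift n (ord0 : 'I_1) by exact/val_inj.
by rewrite (@row_mxEl _ 1 1 n) mxE eqxx mulr1n.
Qed.

Lemma cons_rVS p (j : 'I_n) : cons_rV p ord0 (lift ord0 j) = p.2 ord0 j.
Proof.
rewrite /cons_rV; have -> : lift ord0 j = rshift 1 j by exact/val_inj.
by rewrite (@row_mxEr _ 1 1 n).
Qed.

(* the open sup-norm balls are boxes; those with rational data form a base *)
Lemma open_rV_bigcup (U : set 'rV[R]_n) : open U ->
  U = \bigcup_(p in [set p : 'rV[rat]_n * nat |
        ball (map_mx ratr p.1 : 'rV[R]_n) p.2.+1%:R^-1 `<=` U])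
      ball (map_mx ratr p.1 : 'rV[R]_n) p.2.+1%:R^-1.
Proof.
move=> oU; apply/seteqP; split => [x Ux|x [p Up]]; last exact: Up.
have /nbhs_ballP[e /= e0 eU] := open_nbhs_nbhs (conj oU Ux).
have [k _ /(_ k (leqnn k)) ke] := near_infty_natSinv_lt (PosNum (divr_gt0 e0 (ltr0n R 2))).
set c := k.+1%:R^-1 in ke *; have c0 : 0 < c by rewrite invr_gt0.
have : forall j, exists q : rat, `|x ord0 j - ratr q| < c.
  move=> j; have : x ord0 j - c < x ord0 j + c by lra.
  move=> /rat_in_itvoo[q]; rewrite in_itv/= => /andP[q1 q2]; exists q.
  by rewrite ltr_norml; apply/andP; split; lra.
move=> /choice[q qx].
exists (\row_j q j, k) => /=; last first.
  split=> // i j; rewrite !ord1 !mxE; rewrite /ball/= distrC.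
  exact: qx.
apply: subset_trans eU => y [_ yq]; split=> // i j.
rewrite /ball/= !ord1.
have := yq ord0 j; rewrite /ball/= !mxE => yqj.
have {}qx := qx j.
rewrite -(subrK (ratr (q j)) (x ord0 j)) -addrA (le_lt_trans (ler_normD _ _))//.
by have {}ke : c < e / 2 := ke; rewrite [e]splitr ltrD// (lt_trans _ ke).
Qed.
End cons.

Lemma measurable_cons_rV (R : realType) (n : nat) : measurable_fun setT (@cons_rV R n).
Proof.
apply: (measurability (@open 'rV[R]_n.+1)) => // _ [U oU <-]; rewrite setTI.
rewrite (open_rV_bigcup oU) preimage_bigcup.
rewrite bigcup_mkcond; apply: countable_bigcupT_measurable => [|[q k]].
  exact: countableP.
case: ifP => // _.
set e : R := k.+1%:R^-1.
pose q0 : R := ratr (q ord0 ord0).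
pose q' : 'rV[R]_n := \row_j ratr (q ord0 (lift ord0 j)).
rewrite [X in measurable X](_ : _ = (ball q0 e : set (measurableTypeR R)) `*` ball q' e).
  apply: measurableX; first exact: measurable_realfun.measurable_ball.
  by apply: sub_sigma_algebra; exact: ball_open.
apply/seteqP; split => [p [e0 pB]|p [p1 [e0 p2]]].
  split; first by have := pB ord0 ord0; rewrite cons_rV0 !mxE.
  by split=> // i j; rewrite !ord1; have := pB ord0 (lift ord0 j); rewrite cons_rVS !mxE.
split=> // i j; rewrite ord1 mxE.
case: (unliftP ord0 j) => [j'|] ->; last by rewrite cons_rV0.
by have := p2 ord0 j'; rewrite cons_rVS mxE.
Qed.

(* one step of the n-fold product of the Lebesgue measure on R, transported
   along R * R^n ~ R^(n+1) *)
Section lebesgue_cons.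
Context (R : realType) (n : nat).
Variable m : {sigma_finite_measure set 'rV[R]_n -> \bar R}.

Let prodm : {measure set (measurableTypeR R * 'rV[R]_n)%type -> \bar R} :=
  (lebesgue_measure \x m)%E.

Definition lebesgue_cons : set 'rV[R]_n.+1 -> \bar R :=
  pushforward prodm (@cons_rV R n).

HB.instance Definition _ := Measure.copy lebesgue_cons
  (measure_function_pushforward__canonical__measure_function_Measure
    prodm (@measurable_cons_rV R n)).

Let lebesgue_cons_sigma_finite : sigma_finite setT lebesgue_cons.
Proof.
have /sigma_finiteP[F [FT ndF Ff]] := sigma_finiteT (@lebesgue_measure R).
have /sigma_finiteP[G [GT ndG Gf]] := sigma_finiteT m.
pose H k : set (measurableTypeR R * 'rV[R]_n) := F k `*` G k.
have HT : setT = \bigcup_k H k.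
  rewrite -setXTT FT GT predeqE => -[x y]; split; last first.
    by move=> [k _ []/= ? ?]; split; exists k.
  move=> [/= [i _ Fix] [j _ Gjy]]; exists (maxn i j) => //; split.
  - by move: x Fix; exact/subsetPset/ndF/leq_maxl.
  - by move: y Gjy; exact/subsetPset/ndG/leq_maxr.
have Hf k : measurable (H k) /\ (prodm (H k) < +oo)%E.
  have [mF Foo] := Ff k; have [mG Goo] := Gf k.
  split; first exact: measurableX.
  by rewrite /prodm /= product_measure1E// lte_mul_pinfty// ge0_fin_numE.
pose un (v : 'rV[R]_n.+1) : measurableTypeR R * 'rV[R]_n :=
  (v ord0 ord0, \row_j v ord0 (lift ord0 j)).
have Kun p : un (cons_rV p) = p.
  case: p => a b; rewrite /un cons_rV0; congr pair.
  by apply/rowP => j; rewrite mxE cons_rVS.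
have mun : measurable_fun setT un.
  apply/measurable_fun_pair.
    apply: (measurability (@measurable_realfun.RGenOpens.G R)) => [|_ [_ [x [y ->]] <-]].
      exact: measurable_realfun.RGenOpens.measurableE.
    rewrite setTI; apply: sub_sigma_algebra.
    apply: open_comp; last exact: interval_open.
by move=> v _; exact: coord_continuous.
  apply: (measurability (@open 'rV[R]_n)) => // _ [U oU <-]; rewrite setTI.
  apply: sub_sigma_algebra; rewrite openE => v Uv.
  have /nbhs_ballP[e /= e0 eU] := open_nbhs_nbhs (conj oU Uv).
  apply/nbhs_ballP; exists e => //= w [_ vw]; apply: eU; split=> // i j.
  by rewrite !mxE; exact: vw.
exists (fun k => un @^-1` H k).
  by rewrite -preimage_bigcup -HT preimage_setT.
move=> k; have [mH Hoo] := Hf k; split.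
  by rewrite -[X in measurable X]setTI; exact: mun.
rewrite /lebesgue_cons /pushforward (_ : _ @^-1` _ = H k)//.
by apply/seteqP; split => p /=; rewrite Kun.
Qed.

HB.instance Definition _ :=
  Measure_isSigmaFinite.Build _ _ _ lebesgue_cons lebesgue_cons_sigma_finite.

End lebesgue_cons.

Fixpoint lebesgue_rV (R : realType) (n : nat) :
    {sigma_finite_measure set 'rV[R]_n -> \bar R} :=
  match n with
  | 0 => @dirac _ _ (0 : 'rV[R]_0) R
  | n'.+1 => lebesgue_cons (lebesgue_rV R n')
  end.

Lemma measurable_rV_box (R : realType) (n : nat) (A : 'I_n -> set (measurableTypeR R)) :
  (forall j, measurable (A j)) ->
  measurable [set v : 'rV[R]_n | forall j, A j (v ord0 j)].
Proof.
move=> mA.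
rewrite [X in measurable X](_ : _ =
    \bigcap_(j in [set: 'I_n]) ((fun v : 'rV[R]_n => v ord0 j) @^-1` A j)); last first.
  by apply/seteqP; split => v vA j; [move=> _|]; exact: vA.
apply: fin_bigcap_measurable => // j _; rewrite -[X in measurable X]setTI.
suff : measurable_fun setT (fun v : 'rV[R]_n => v ord0 j : measurableTypeR R).
  by apply.
apply: (measurability (@measurable_realfun.RGenOpens.G R)) => [|_ [_ [x [y ->]] <-]].
  exact: measurable_realfun.RGenOpens.measurableE.
rewrite setTI; apply: sub_sigma_algebra.
apply: open_comp; last exact: interval_open.
by move=> v _; exact: coord_continuous.
Qed.

Lemma lebesgue_rV_box (R : realType) (n : nat) (A : 'I_n -> set (measurableTypeR R)) :
  (forall j, measurable (A j)) ->
  lebesgue_rV R n [set v | forall j, A j (v ord0 j)] =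
  (\prod_(j < n) lebesgue_measure (A j))%E.
Proof.
elim: n A => [|n IHn] A mA.
  by rewrite big_ord0 /= diracE mem_set// => -[].
rewrite big_ord_recl -IHn; last by move=> j; exact: mA.
rewrite /= /lebesgue_cons /pushforward -product_measure1E//; last first.
  by apply: (@measurable_rV_box R n (fun j => A (lift ord0 j))) => j; exact: mA.
congr product_measure1; apply/seteqP; split => [p pA|p [pA0 pA] j] /=.
  split; first by have := pA ord0; rewrite cons_rV0.
  by move=> j; have := pA (lift ord0 j); rewrite cons_rVS.
case: (unliftP ord0 j) => [j'|] ->; last by rewrite cons_rV0.
by rewrite cons_rVS; exact: pA.
Qed.

Section euclidean.
Context (R : realType) (d : nat).
Local Notation E := 'rV[R]_d.
Implicit Types (x y : E) (A B : set E) (r : R).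

(* the norm of the normed module structure on 'rV is the sup norm *)
Definition enorm x : R := Num.sqrt (\sum_(i < d) x ord0 i ^+ 2).

Definition eball x r : set E := [set y | enorm (y - x) < r].

(* the infimum of the empty set is +oo *)
Definition edist A x : \bar R := ereal_inf [set (enorm (x - y))%:E | y in A].

(* A_delta; delta may be infinite *)
Definition ethick A (delta : \bar R) : set E := [set x | (edist A x < delta)%E].

Definition ediam A : \bar R :=
  ereal_sup [set (enorm (x - y))%:E | x in A & y in A].

Definition bd A : set E := closure A `\` A°.

(* A(x, r) *)
Definition loc A x r : set E := A `&` eball x r.

Definition curve_length (gamma : R -> E) (a b : R) : \bar R :=
  ereal_sup [set (let F := gamma \o nth b (a :: s) in
                  \sum_(0 <= n < size s) enorm (F n.+1 - F n))%:E
            | s in itv_partition a b].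

End euclidean.

Section smooth.
Context (R : realType) (d : nat).
Local Notation E := 'rV[R]_d.
Implicit Types (f : E -> R) (U : set E).

Definition partial f (i : 'I_d) : E -> R := 'D_(delta_mx ord0 i) f.

Fixpoint Ck (k : nat) f : Prop :=
  match k with
  | 0 => continuous f
  | k'.+1 => continuous f /\ forall i : 'I_d,
      (forall x, derivable f x (delta_mx ord0 i)) /\ Ck k' (partial f i)
  end.

Definition smooth f : Prop := forall k, Ck k f.

(* C_c^oo(U; R), its members being extended by zero to the whole space *)
Definition test_fun U f : Prop :=
  [/\ smooth f, compact (closure [set x | f x != 0])
    & closure [set x | f x != 0] `<=` U].

Definition grad f (x : E) : E := \row_i partial f i x.

Definition capacity (p : R) (K U : set E) : \bar R :=
  ereal_inf [set (\int[lebesgue_rV R d]_(x in U) ((enorm (grad f x)) `^ p)%:E)%E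
            | f in [set f | test_fun U f /\ forall x, K x -> 1 <= f x]].

Definition locally_fat (p : R) (C C' : set E) : Prop :=
  exists2 c : R, 0 < c & forall x r, C' x -> 0 < r -> r <= 1 ->
    ((c * r `^ (d%:R - p))%:E <=
     capacity p (closure (eball x r) `&` C) (eball x (2 * r)))%E.

End smooth.

Section geometry.
Context (R : realType) (d : nat).
Local Notation E := 'rV[R]_d.
Implicit Types (O D : set E).

(* N, the complement of the Dirichlet part D in the boundary of O *)
Definition neumann O D : set E := bd O `\` D.

Definition fat_away_from_neumann O D : Prop :=
  exists2 delta : R, 0 < delta &
    locally_fat 2 D (D `&` ethick (neumann O D) delta%:E) /\
    locally_fat 2 (~` O) D.

Definition joined_by_cigar O (B : set E) (eps : R) (x y : E) : Prop :=
  exists gamma : R -> E,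
    [/\ {within `[0, 1], continuous gamma}, gamma 0 = x, gamma 1 = y,
        (curve_length gamma 0 1 <= (enorm (x - y) / eps)%:E)%E
      & forall t, t \in `[0, 1] ->
          O (gamma t) /\
          ((eps * enorm (gamma t - x) * enorm (gamma t - y)
             / enorm (x - y))%:E <= edist B (gamma t))%E].

Definition uniform_near_neumann O D : Prop :=
  let N := neumann O D in
  exists (eps : R) (delta : \bar R) (C : R),
    [/\ 0 < eps <= 1, (0 < delta)%E, 0 < C,
        (forall x y, (O `&` ethick N delta) x -> (O `&` ethick N delta) y ->
           0 < enorm (x - y) -> ((enorm (x - y))%:E < delta)%E ->
           joined_by_cigar O (bd O `&` ethick N delta) eps x y)
      & (forall z, O z -> bd (connected_component O z) `&` N !=set0 ->
           (C%:E * delta <= ediam (connected_component O z))%E)].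

End geometry.

Section sobolev.
Context (R : realType) (d : nat).
Local Notation E := 'rV[R]_d.
Local Notation mu := (lebesgue_rV R d).
Implicit Types (u phi : E -> R[i]) (g : E -> 'cV[R[i]]_d) (U F : set E).

(* the Hermitian product, conjugate-linear on the right *)
Definition cdot (xi zeta : 'cV[R[i]]_d) : R[i] :=
  \sum_(i < d) xi i ord0 * conjc (zeta i ord0).

Definition cnorm (xi : 'cV[R[i]]_d) : R :=
  Num.sqrt (\sum_(i < d) normc (xi i ord0) ^+ 2).

Definition cmeasurable U u : Prop :=
  measurable_fun U (fun x => complex.Re (u x)) /\
  measurable_fun U (fun x => complex.Im (u x)).

Definition cintegral U u : R[i] :=
  Complex (\int[mu]_(x in U) complex.Re (u x)) (\int[mu]_(x in U) complex.Im (u x)).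

Definition L2 U u : Prop :=
  cmeasurable U u /\ (\int[mu]_(x in U) (normc (u x) ^+ 2)%:E < +oo)%E.

Definition ctest_fun U phi : Prop :=
  test_fun U (fun x => complex.Re (phi x)) /\
  test_fun U (fun x => complex.Im (phi x)).

Definition cgrad phi (x : E) : 'cV[R[i]]_d :=
  \col_i Complex (partial (fun y => complex.Re (phi y)) i x)
                 (partial (fun y => complex.Im (phi y)) i x).

Definition weak_grad U u g : Prop :=
  forall f (i : 'I_d), test_fun U f ->
    cintegral U (fun x => u x * (partial f i x)%:C%C) =
    - cintegral U (fun x => g x i ord0 * (f x)%:C%C).

(* An element of H^1(U) is represented by a Borel function together with its
   weak gradient, which is unique up to null sets. *)
Definition H1 U u g : Prop :=
  [/\ L2 U u, (forall i, L2 U (fun x => g x i ord0)) & weak_grad U u g].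

Definition H1_dist2 U u g u' g' : \bar R :=
  (\int[mu]_(x in U) (normc (u x - u' x) ^+ 2 + cnorm (g x - g' x) ^+ 2)%:E)%E.

(* H^1_F(U): the closure in H^1(U) of the restrictions to U of the members of
   C_c^oo(R^d \ F) *)
Definition H1_vanishing U F u g : Prop :=
  H1 U u g /\ exists phi_ : nat -> E -> R[i],
    (forall n, ctest_fun (~` F) (phi_ n)) /\
    H1_dist2 U u g (phi_ n) (cgrad (phi_ n)) @[n --> \oo] --> 0%E.

End sobolev.

Section operator.
Context (R : realType) (d : nat).
Local Notation E := 'rV[R]_d.
Local Notation mu := (lebesgue_rV R d).
Implicit Types (A : E -> 'M[R[i]]_d) (O D U : set E).

Definition opnorm (M : 'M[R[i]]_d) : R :=
  sup [set cnorm (M *m xi) | xi in [set xi : 'cV[R[i]]_d | cnorm xi <= 1]].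

(* the values of A outside O are irrelevant *)
Definition Linf_norm O A : \bar R :=
  ess_sup mu (fun x => (\1_O x * opnorm (A x))%:E).

Definition Linf O A : Prop :=
  (forall i j, cmeasurable O (fun x => A x i j)) /\ (Linf_norm O A < +oo)%E.

Definition elliptic O A (lambda : R) : Prop :=
  \forall x \ae mu, O x -> forall xi : 'cV[R[i]]_d,
    lambda * cnorm xi ^+ 2 <= complex.Re (cdot (A x *m xi) xi).

(* the form of -div(A grad) over U, in terms of the gradients of its arguments *)
Definition form U A (gu gv : E -> 'cV[R[i]]_d) : R[i] :=
  cintegral U (fun y => cdot (A y *m gu y) (gv y)).

(* L_D u = 0 in O(x, r), for u in H^1(O(x, r)) with gradient gu: the condition
   involves u only through its gradient. The test functions vanish on the part
   of the boundary of O(x, r) outside N(x, r). *)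
Definition weak_solution O D A (x : E) (r : R) (gu : E -> 'cV[R[i]]_d) : Prop :=
  let U := loc O x r in
  forall phi gphi, H1_vanishing U (bd U `\` loc (neumann O D) x r) phi gphi ->
    form U A gu gphi = 0.

Definition energy U (g : E -> 'cV[R[i]]_d) : \bar R :=
  (\int[mu]_(y in U) (cnorm (g y) ^+ 2)%:E)%E.

(* property D(nu) of -div(A grad), with constant c *)
Definition property_D O D A (nu c : R) : Prop :=
  forall (r s : R) (x : E) (u : E -> R[i]) (gu : E -> 'cV[R[i]]_d),
    0 < r -> r <= s -> s <= 1 -> closure O x ->
    H1_vanishing O D u gu -> weak_solution O D A x s gu ->
    (energy (loc O x r) gu <=
     (c * (r / s) `^ (d%:R - 2 + 2 * nu))%:E * energy (loc O x s) gu)%E.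

End operator.

(* Main.v *)
Require Import Defs.
From HB Require Import structures.
From mathcomp Require Import all_boot all_order all_algebra.
From mathcomp Require Import complex ring lra.
From mathcomp Require Import all_classical all_reals all_analysis measurable_realfun ess_sup_inf.

Set Implicit Arguments.
Unset Strict Implicit.
Unset Printing Implicit Defensive.

Import Order.TTheory GRing.Theory Num.Theory.
Import numFieldNormedType.Exports.

Local Open Scope classical_set_scope.
Local Open Scope ring_scope.

(* Let u be a solution for A in O(x,R) and let Phi(r) be the energy of u on O(x,r). Subtract from u a
   correction w, in the H^1-closure of the test functions supported in B(x,R) \ D, to obtain a solution
   v = u - w for A0. By ellipticity the gradient of w is bounded by |A - A0| / lambda times that of u, so
   D(mu) for v gives Phi(r) <= (8 c (r/R)^(d-2+2mu) + small) Phi(R), and iterating this along a geometric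
   sequence of radii gives D(nu).

   The correction w is a limit of approximate Galerkin solutions; their convergence in L^2 requires the
   Poincaré inequality for test functions f supported in B(x,R) \ D, R small. Let y be a point of O in the
   ball. If the boundary of its component lies in D within the ball, then f vanishes at the end of a
   segment of O starting at y. Otherwise the component is large compared to the ball, and cigars provide a
   chain of cubes in O, with sizes comparable to their distances to y, leading from y out of the ball;
   f is compared on consecutive cubes by means of its gradient. *)

(** The number [eps] may depend on [c], [lambda], [d], [mu] and [nu] only, whereas the radius and
    the constant of the Poincaré inequality depend on [O] and [D]. That inequality is therefore used
    qualitatively: it makes w a function in L^2, so that D(mu) applies to u - w, but its constant
    enters no estimate. All estimates concern gradients, and the size of w comes from testing its
    equation with w itself. The restriction to small radii is absorbed in the constant of D(nu). The
    ratio [tau] of consecutive radii is fixed first, so small that the gap 2 (mu - nu) between the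
    exponents beats the factor 8 c; then [eps] is taken so small that the perturbation term fits
    into what is left. Test functions are not complete for the energy, hence almost solutions with
    small residual in place of exact ones, and separate L^2 limits for functions and gradients. *)

Lemma discriminant_le (R : realType) (a b x : R) : 0 <= b ->
  (forall t, 0 <= a - 2 * t * x + t ^+ 2 * b) -> x ^+ 2 <= a * b.
Proof.
move=> b0 H; have [bz|bn] := eqVneq b 0.
  have [->|x0] := eqVneq x 0; first by rewrite expr0n bz mulr0.
  have := H ((a + 1) / (2 * x)); rewrite bz mulr0 addr0.
  have -> : a - 2 * ((a + 1) / (2 * x)) * x = -1 by field.
  by rewrite ler0N1.
have bp : 0 < b by rewrite lt_neqAle eq_sym bn.
have := H (x / b).
have -> : a - 2 * (x / b) * x + (x / b) ^+ 2 * b = a - x ^+ 2 / b by field.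
by rewrite subr_ge0 ler_pdivrMr.
Qed.

Lemma continuous_fun_add (K : numFieldType) (V : normedModType K) (T : topologicalType)
  (f g : T -> V) : continuous f -> continuous g -> continuous (fun x => f x + g x).
Proof. by move=> cf cg x; apply: cvgD; [exact: cf|exact: cg]. Qed.

Lemma continuous_fun_mul (K : numFieldType) (T : topologicalType) (f g : T -> K) :
  continuous f -> continuous g -> continuous (fun x => f x * g x).
Proof. by move=> cf cg x; apply: cvgM; [exact: cf|exact: cg]. Qed.

(** * Lebesgue measure on row vectors *)

Lemma lebesgue_segment (R : realType) (T : R) : 0 < T -> lebesgue_measure `[0, T]%classic = T%:E.
Proof. by move=> T0; rewrite lebesgue_measure_itv/= lte_fin T0/= oppr0 adde0. Qed.

Section borel_rV.
Context (R : realType) (n : nat).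
Local Notation E := 'rV[R]_n.

Lemma open_measurable_rV (U : set E) : open U -> measurable U.
Proof. by move=> oU; exact: sub_sigma_algebra. Qed.

Lemma continuous_measurable_rV (f : E -> R) : continuous f ->
  measurable_fun setT (f : E -> measurableTypeR R).
Proof.
move=> cf; apply: (measurability (@measurable_realfun.RGenOpens.G R)) => [|_ [_ [x [y ->]] <-]].
  exact: measurable_realfun.RGenOpens.measurableE.
rewrite setTI; apply: open_measurable_rV.
by apply: open_comp; [move=> v _; exact: cf | exact: interval_open].
Qed.

Lemma measurable_coord (j : 'I_n) :
  measurable_fun setT (fun v : E => v ord0 j : measurableTypeR R).
Proof. by apply: continuous_measurable_rV; exact: coord_continuous. Qed.

(** An open set is a countable union of sup-norm balls with rational data, and membership in such a
    ball is a finite conjunction of conditions on the coordinates. *)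
Lemma measurable_fun_rV d (T : measurableType d) (f : T -> E) :
  (forall j, measurable_fun setT (fun x => f x ord0 j : measurableTypeR R)) ->
  measurable_fun setT f.
Proof.
move=> mf; apply: (measurability (@open E)) => // _ [U oU <-]; rewrite setTI.
rewrite (open_rV_bigcup oU) preimage_bigcup.
rewrite bigcup_mkcond; apply: countable_bigcupT_measurable => [|[q k]].
  exact: countableP.
case: ifP => // _; set e : R := k.+1%:R^-1 => /=.
rewrite [X in measurable X](_ : _ = \bigcap_(j in [set: 'I_n])
  ((fun x => f x ord0 j : measurableTypeR R) @^-1` ball (ratr (q ord0 j) : R) e)); last first.
  apply/seteqP; split => [x [e0 xB] j _|x xB]; first by have := xB ord0 j; rewrite !mxE.
  split; first by rewrite invr_gt0.
  by move=> i j; rewrite ord1 mxE; exact: xB.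
apply: fin_bigcap_measurable => // j _; rewrite -[X in measurable X]setTI.
by apply: mf => //; exact: measurable_realfun.measurable_ball.
Qed.

Definition obox (a b : 'I_n -> R) : set E :=
  [set v | forall j, v ord0 j \in `]a j, b j[].

Lemma measurable_obox a b : measurable (obox a b).
Proof.
by apply: (@measurable_rV_box R n (fun j => [set` `]a j, b j[])) => j; exact: measurable_itv.
Qed.

Lemma lebesgue_obox (a b : 'I_n -> R) :
  lebesgue_rV R n (obox a b) = (\prod_(j < n) Num.max 0 (b j - a j))%:E.
Proof.
rewrite /obox (lebesgue_rV_box (A := fun j => [set` `]a j, b j[])); last first.
  by move=> j; exact: measurable_itv.
rewrite -prodEFin; apply: eq_bigr => j _; rewrite lebesgue_measure_itv/= lte_fin.
case: ltP => ab; first by rewrite -EFinB max_r// subr_ge0 ltW.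
by rewrite max_l// subr_le0.
Qed.

(** Boxes are stable under intersection and have explicit volume: this makes them the class on which
    two measures are compared in [lebesgue_affine]. *)
Lemma measurable_obox_gen : @measurable _ E = <<s [set A | exists a b, A = obox a b] >>.
Proof.
apply/seteqP; split; last first.
  apply: smallest_sub; first exact: sigma_algebra_measurable.
  by move=> _ [a [b ->]]; exact: measurable_obox.
apply: smallest_sub; first exact: smallest_sigma_algebra.
move=> U oU; rewrite (open_rV_bigcup oU) bigcup_mkcond.
pose S : sigmaRingType _ := g_sigma_algebraType [set A : set E | exists a b, A = obox a b].
suff : @measurable _ S (\bigcup_p (if p \in [set p : 'rV[rat]_n * nat |
    ball (map_mx ratr p.1 : E) p.2.+1%:R^-1 `<=` U] then ball (map_mx ratr p.1 : E) p.2.+1%:R^-1 else set0)).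
  by [].
apply: countable_bigcupT_measurable => [|[q k]]; first exact: countableP.
case: ifP => // _; set e : R := k.+1%:R^-1 => /=.
apply: sub_sigma_algebra.
exists (fun j => ratr (q ord0 j) - e), (fun j => ratr (q ord0 j) + e).
apply/seteqP; split => [v [e0 vB] j|v vB] /=.
  have := vB ord0 j; rewrite mxE /ball/= ltr_norml in_itv/= => /andP[? ?].
  by apply/andP; split; lra.
split; first by rewrite invr_gt0.
move=> i j; rewrite ord1 mxE /ball/= ltr_norml.
by have := vB j; rewrite /= in_itv/= => /andP[? ?]; apply/andP; split; lra.
Qed.

Lemma measurable_affine (p : E) (h : R) : measurable_fun setT (fun q : E => p + h *: q).
Proof.
apply: measurable_fun_rV => j; under eq_fun do rewrite !mxE.
apply: measurable_realfun.measurable_funD => //.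
by apply: measurable_realfun.measurable_funM => //; exact: measurable_coord.
Qed.

Lemma measurable_line (y v : E) :
  measurable_fun [set: measurableTypeR R] (fun t : measurableTypeR R => y + t *: v).
Proof.
apply: measurable_fun_rV => j; under eq_fun do rewrite !mxE.
by apply: measurable_realfun.measurable_funD => //; apply: measurable_realfun.measurable_funM.
Qed.

(** Uniqueness of measures: both sides agree on open boxes, and the boxes [g k] exhaust the space
    with finite measure. *)
Lemma lebesgue_affine (p : E) (h : R) (h0 : 0 < h) (A : set E) : measurable A ->
  pushforward (lebesgue_rV R n) (fun q : E => p + h *: q) A =
  mscale (NngNum (ltW (exprn_gt0 n (divr_gt0 ltr01 h0)))) (lebesgue_rV R n) A.
Proof.
pose m1 : {measure set E -> \bar R} :=
  measure_function_pushforward__canonical__measure_function_Measure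
    (lebesgue_rV R n) (@measurable_affine p h).
pose m2 : {measure set E -> \bar R} :=
  mscale (NngNum (ltW (exprn_gt0 n (divr_gt0 ltr01 h0)))) (lebesgue_rV R n).
move=> mA; have : m1 A = m2 A; last by [].
have m1obox a b : m1 (obox a b) = (\prod_(j < n) Num.max 0 ((b j - a j) / h))%:E.
  rewrite /m1 /= /pushforward (_ : _ @^-1` _ =
     obox (fun j => (a j - p ord0 j) / h) (fun j => (b j - p ord0 j) / h)).
    rewrite lebesgue_obox; congr EFin; apply: eq_bigr => j _.
    by congr (Num.max 0 _); rewrite -mulrBl; congr (_ * _); lra.
  by apply/seteqP; split => v vB j; have := vB j; rewrite /= !in_itv/= !mxE
    ltr_pdivrMr// ltr_pdivlMr// => /andP[? ?]; apply/andP; split; lra.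
pose g (k : nat) : set E := obox (fun _ => - k%:R) (fun _ => k%:R).
apply: (@measure_unique _ _ _ [set A | exists a b, A = obox a b] g) => //.
- exact: measurable_obox_gen.
- move=> _ _ [a [b ->]] [a' [b' ->]].
  exists (fun j => Num.max (a j) (a' j)), (fun j => Num.min (b j) (b' j)).
  apply/seteqP; split => [v [v1 v2] j|v vB] /=.
    have /= := v1 j; have /= := v2 j; rewrite !in_itv/= gt_max lt_min.
    by move=> /andP[a2 b2] /andP[a1 b1]; rewrite a1 a2 b1 b2.
  by split => j; have /= := vB j; rewrite !in_itv/= gt_max lt_min => /andP[/andP[a1 a2] /andP[b1 b2]];
    rewrite ?a1 ?a2 ?b1 ?b2.
- by move=> k; eexists; eexists.
- rewrite -subTset => v _.
  pose M := \sum_(j < n) `|v ord0 j|.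
  exists (Num.trunc M).+1 => // j /=; rewrite in_itv/= -ltr_norml.
  apply: le_lt_trans (truncnS_gt M).
  by rewrite /M (bigD1 j)//= lerDl sumr_ge0.
- move=> _ [a [b ->]]; rewrite m1obox.
  have -> : m2 (obox a b) = (((1 / h) ^+ n)%:E * lebesgue_rV R n (obox a b))%E by [].
  rewrite lebesgue_obox -EFinM; congr EFin.
  rewrite /= -[X in _ ^+ X](card_ord n) -prodr_const -big_split/=.
  apply: eq_bigr => j _; rewrite mulrC div1r; have h'0 : 0 < h^-1 by rewrite invr_gt0.
  by rewrite maxr_pMr ?mulr0 1?mulrC// ltW.
- by move=> k; rewrite m1obox ltry.
Qed.

Lemma integral_affine (p : E) (h : R) (f : E -> \bar R) : 0 < h ->
  measurable_fun [set: E] f -> (forall x, 0 <= f x)%E ->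
  (\int[lebesgue_rV R n]_q f (p + h *: q)%R =
   (h ^- n)%:E * \int[lebesgue_rV R n]_x f x)%E.
Proof.
move=> h0 mf f0.
have := @ge0_integral_pushforward _ _ E E R _ (@measurable_affine p h) (lebesgue_rV R n) setT f
  measurableT mf (fun y _ => f0 y).
rewrite preimage_setT => <-.
transitivity (\int[mscale (NngNum (ltW (exprn_gt0 n (divr_gt0 ltr01 h0)))) (lebesgue_rV R n)]_x f x)%E.
  by apply: eq_measure_integral => [|mA0 A mA _]; [exact: measurable_affine|exact: lebesgue_affine].
rewrite ge0_integral_mscale//=; congr (_ * _)%E; congr EFin.
by rewrite div1r exprVn.
Qed.

Lemma integral_translate (p : E) (f : E -> \bar R) :
  measurable_fun [set: E] f -> (forall x, 0 <= f x)%E ->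
  (\int[lebesgue_rV R n]_q f (p + q)%R = \int[lebesgue_rV R n]_x f x)%E.
Proof.
move=> mf f0; rewrite -[RHS]mul1e; have := integral_affine p ltr01 mf f0.
by under eq_integral do rewrite scale1r; rewrite expr1n invr1.
Qed.

End borel_rV.

(** * Square-integrable functions *)

(** Cauchy-Schwarz with geometric weights: the constant is independent of [n], at the price of the
    factors [2 ^+ k]. Splitting off the first term doubles the square of the rest, which shifts the
    weights by one. *)
Lemma sum_sqr_geometric (R : realType) (n : nat) (a : nat -> R) :
  (\sum_(k < n) a k) ^+ 2 <= 2 * \sum_(k < n) 2 ^+ k * a k ^+ 2.
Proof.
elim: n a => [|n IH] a; first by rewrite !big_ord0 expr0n mulr0.
rewrite !big_ord_recl /=; set S := \sum_(i < n) a _.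
have := IH (fun k => a k.+1); rewrite -/S => H.
have -> : \sum_(i < n) 2 ^+ bump 0 i * a (bump 0 i) ^+ 2 = 2 * \sum_(i < n) 2 ^+ i * a i.+1 ^+ 2.
  by rewrite mulr_sumr; apply: eq_bigr => i _; rewrite /bump/= add1n exprS mulrA.
have := sqr_ge0 (a 0%N - S); rewrite sqrrB sqrrD expr0 mul1r; lra.
Qed.

Lemma sum_half_le (R : realType) (n : nat) : \sum_(k < n) (2 ^+ k)^-1 <= 2 :> R.
Proof.
suff : \sum_(k < n) (2 ^+ k)^-1 <= 2 - 2 / 2 ^+ n :> R.
  move=> H; apply: (le_trans H); rewrite lerBlDr lerDl divr_ge0// exprn_ge0//.
elim: n => [|n IH]; first by rewrite big_ord0 expr0 divr1 subrr.
rewrite big_ord_recr/=; apply: (le_trans (lerD IH (lexx _))).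
rewrite exprS invfM mulrA divff// mul1r; lra.
Qed.

Section square_integrable.
Context (R : realType) (disp : measure_display) (T : measurableType disp).
Context (mu : {measure set T -> \bar R}).
Variables (U : set T) (mU : measurable U).
Implicit Types f g : T -> R.

Definition sqint f := measurable_fun U f /\ (\int[mu]_(x in U) (f x ^+ 2)%:E < +oo)%E.

Lemma sqint_le f g (a : R) : measurable_fun U f -> sqint g ->
  (forall x, U x -> `|f x| <= a * `|g x|) -> sqint f.
Proof.
move=> mf [mg gi] fg; split => //.
apply: (@le_lt_trans _ _ (\int[mu]_(x in U) ((a ^+ 2)%:E * (g x ^+ 2)%:E))%E).
  apply: ge0_le_integral => //.
  - by move=> x _; rewrite lee_fin sqr_ge0.
  - by apply/measurable_EFinP; exact: measurable_funX.
  - by apply: measurable_funeM; apply/measurable_EFinP; exact: measurable_funX.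
  - move=> x Ux; rewrite -EFinM lee_fin -exprMn -[leLHS]real_normK ?num_real//.
    rewrite -[leRHS]real_normK ?num_real// ler_sqr ?nnegrE// normrM.
    by apply: (le_trans (fg x Ux)); rewrite ler_wpM2r// ler_norm.
rewrite ge0_integralZl//; first last.
- by rewrite lee_fin sqr_ge0.
- by move=> x _; rewrite lee_fin sqr_ge0.
- by apply/measurable_EFinP; exact: measurable_funX.
have fin : (\int[mu]_(x in U) (g x ^+ 2)%:E)%E \is a fin_num.
  by rewrite ge0_fin_numE//; apply: integral_ge0 => x _; rewrite lee_fin sqr_ge0.
by rewrite -(fineK fin) -EFinM ltry.
Qed.

Lemma sqint_sqr_integrable f : sqint f -> mu.-integrable U (EFin \o (fun x => f x ^+ 2)).
Proof.
move=> [mf fi]; apply/integrableP; split.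
  by apply/measurable_EFinP; exact: measurable_funX.
by under eq_integral do rewrite /= ger0_norm ?sqr_ge0//.
Qed.

Lemma sqintM_integrable f g : sqint f -> sqint g -> mu.-integrable U (EFin \o (fun x => f x * g x)).
Proof.
move=> sf sg.
have H := integrableD mU (sqint_sqr_integrable sf) (sqint_sqr_integrable sg).
apply: (le_integrable mU) H; first by apply/measurable_EFinP; apply: measurable_funM; [exact: sf.1|exact: sg.1].
move=> x _ /=; rewrite lee_fin [leRHS]ger0_norm ?addr_ge0 ?sqr_ge0// normrM.
rewrite -(real_normK (num_real (f x))) -(real_normK (num_real (g x))).
by have := sqr_ge0 (`|f x| - `|g x|); have := sqr_ge0 `|f x|; have := sqr_ge0 `|g x|; rewrite sqrrB; lra.
Qed.

Lemma sqintD f g : sqint f -> sqint g -> sqint (fun x => f x + g x).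
Proof.
move=> sf sg; split; first by apply: measurable_funD; [exact: sf.1|exact: sg.1].
have H := integrableD mU (integrableD mU (sqint_sqr_integrable sf) (sqint_sqr_integrable sg))
  (integrableD mU (sqintM_integrable sf sg) (sqintM_integrable sf sg)).
apply: le_lt_trans (integrable_lty mU H).
apply: ge0_le_integral => //.
- by move=> x _; rewrite lee_fin sqr_ge0.
- by apply/measurable_EFinP; apply: measurable_funX; apply: measurable_funD; [exact: sf.1|exact: sg.1].
- exact: measurable_int H.
- by move=> x _ /=; rewrite lee_fin sqrrD; lra.
Qed.

Lemma sqintZ (a : R) f : sqint f -> sqint (fun x => a * f x).
Proof.
move=> sf; apply: (@sqint_le _ f `|a|) => //; first by apply: measurable_funM => //; exact: sf.1.
by move=> x _; rewrite normrM.
Qed.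

Lemma sqintN f : sqint f -> sqint (fun x => - f x).
Proof.
move=> sf; apply: (@sqint_le _ f 1) => //; first by apply: measurableT_comp => //; exact: sf.1.
by move=> x _; rewrite normrN mul1r.
Qed.

Lemma sqintB f g : sqint f -> sqint g -> sqint (fun x => f x - g x).
Proof. by move=> sf sg; apply: sqintD => //; exact: sqintN. Qed.

(** A real number, which is 0 by default when the integral is infinite; [EFin_sqnorm] gives it its
    meaning. *)
Definition sqnorm f : R := (\int[mu]_(x in U) (f x ^+ 2))%R.

Lemma sqnorm_ge0 f : 0 <= sqnorm f.
Proof. by apply: Rintegral_ge0 => x _; exact: sqr_ge0. Qed.

Lemma EFin_sqnorm f : sqint f -> (\int[mu]_(x in U) (f x ^+ 2)%:E = (sqnorm f)%:E)%E.
Proof.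
by move=> sf; rewrite fineK//; exact: integrable_fin_num (sqint_sqr_integrable sf).
Qed.

Lemma integral_cauchy f g : sqint f -> sqint g ->
  (\int[mu]_(x in U) (f x * g x))%R ^+ 2 <= sqnorm f * sqnorm g.
Proof.
move=> sf sg; apply: discriminant_le; first exact: sqnorm_ge0.
move=> t.
have If := sqint_sqr_integrable sf; have Ig := sqint_sqr_integrable sg; have Ifg := sqintM_integrable sf sg.
have I1 : mu.-integrable U (EFin \o (fun x => 2 * t * (f x * g x))).
  by have := integrableZl mU (2 * t) Ifg; rewrite /comp; under eq_fun do rewrite -EFinM.
have I2 : mu.-integrable U (EFin \o (fun x => t ^+ 2 * g x ^+ 2)).
  by have := integrableZl mU (t ^+ 2) Ig; rewrite /comp; under eq_fun do rewrite -EFinM.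
have -> : sqnorm f - 2 * t * (\int[mu]_(x in U) (f x * g x))%R + t ^+ 2 * sqnorm g =
    (\int[mu]_(x in U) ((f x ^+ 2 - 2 * t * (f x * g x)) + t ^+ 2 * g x ^+ 2))%R.
  rewrite RintegralD//; last by have := integrableB mU If I1.
  by rewrite RintegralB// !RintegralZl.
by apply: Rintegral_ge0 => x _; have := sqr_ge0 (f x - t * g x); rewrite sqrrB exprMn; lra.
Qed.

Lemma integral_cauchy_norm f g : sqint f -> sqint g ->
  `|(\int[mu]_(x in U) (f x * g x))%R| <= Num.sqrt (sqnorm f) * Num.sqrt (sqnorm g).
Proof.
move=> sf sg; rewrite -sqrtrM ?sqnorm_ge0// -sqrtr_sqr ler_wsqrtr//.
exact: integral_cauchy.
Qed.

Lemma sqnormD_le f g : sqint f -> sqint g ->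
  sqnorm (fun x => f x + g x) <= 2 * sqnorm f + 2 * sqnorm g.
Proof.
move=> sf sg.
have If := sqint_sqr_integrable sf; have Ig := sqint_sqr_integrable sg.
have I1 : mu.-integrable U (EFin \o (fun x => 2 * f x ^+ 2)).
  by have := integrableZl mU 2 If; rewrite /comp; under eq_fun do rewrite -EFinM.
have I2 : mu.-integrable U (EFin \o (fun x => 2 * g x ^+ 2)).
  by have := integrableZl mU 2 Ig; rewrite /comp; under eq_fun do rewrite -EFinM.
rewrite /sqnorm -!RintegralZl// -RintegralD//.
apply: le_Rintegral => //.
- exact: sqint_sqr_integrable (sqintD sf sg).
- by have := integrableD mU I1 I2.
- by move=> x _; have := sqr_ge0 (f x - g x); rewrite sqrrB sqrrD; lra.
Qed.

(** Riesz-Fischer: a subsequence with fast decreasing increments converges almost everywhere, and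
    Fatou's lemma turns its pointwise limit into a limit in L^2. *)
Lemma sqint_complete (f : nat -> T -> R) : (forall n, sqint (f n)) ->
  (forall e, 0 < e -> exists N, forall m n, (N <= m)%N -> (N <= n)%N ->
    sqnorm (fun x => f m x - f n x) <= e) ->
  exists g, sqint g /\ forall e, 0 < e -> exists N, forall n, (N <= n)%N ->
    sqnorm (fun x => f n x - g x) <= e.
Proof.
move=> sf cf.
have : forall k : nat, exists N, forall m n, (N <= m)%N -> (N <= n)%N ->
    sqnorm (fun x => f m x - f n x) <= (4 ^+ k)^-1.
  by move=> k; apply: cf; rewrite invr_gt0 exprn_gt0.
move=> /choice[N0 HN0].
(* Summing the thresholds keeps them valid and makes them nondecreasing in [k]. *)
pose N k := (\sum_(i < k.+1) N0 i)%N.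
have N0N k : (N0 k <= N k)%N by rewrite /N big_ord_recr/= leq_addl.
have NS k : (N k <= N k.+1)%N by rewrite [N k.+1]big_ord_recr/= leq_addr.
have Nmono k l : (k <= l)%N -> (N k <= N l)%N.
  by move=> kl; apply: (homo_leq (r := leq)) kl => //; exact: leq_trans.
pose F k := f (N k).
pose D k x : R := F k.+1 x - F k x.
have sF k : sqint (F k) by exact: sf.
have sD k : sqint (D k) by exact: sqintB.
have nD k : sqnorm (D k) <= (4 ^+ k)^-1.
  apply: HN0; last exact: N0N.
  exact: leq_trans (N0N k) (NS k).
(* the weights [2 ^ k] make the increments summable where [h] is finite *)
pose h x : \bar R := (\sum_(0 <= k <oo) (2 ^+ k * D k x ^+ 2)%:E)%E.
have mh1 k : measurable_fun U (fun x => (2 ^+ k * D k x ^+ 2)%:E).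
  apply/measurable_EFinP; apply: measurable_funM => //; apply: measurable_funX; exact: (sD k).1.
have h1ge0 k x : (0 <= (2 ^+ k * D k x ^+ 2)%:E)%E.
  by rewrite lee_fin; apply: mulr_ge0; [exact: exprn_ge0|exact: sqr_ge0].
have ih1 k : (\int[mu]_(x in U) (2 ^+ k * D k x ^+ 2)%:E <= ((2 ^+ k)^-1)%:E)%E.
  have -> : (\int[mu]_(x in U) (2 ^+ k * D k x ^+ 2)%:E = (2 ^+ k)%:E * \int[mu]_(x in U) (D k x ^+ 2)%:E)%E.
    under eq_integral do rewrite EFinM.
    apply: ge0_integralZl => //.
    - by apply/measurable_EFinP; apply: measurable_funX; exact: (sD k).1.
    - by move=> x _; rewrite lee_fin sqr_ge0.
  rewrite EFin_sqnorm// -EFinM lee_fin.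
  apply: (le_trans (ler_wpM2l (exprn_ge0 k (ler0n R 2)) (nD k))).
  rewrite (_ : 4 = 2 * 2 :> R); last by rewrite -natrM.
  by rewrite exprMn invfM mulrA mulfV ?mul1r// expf_neq0.
have ih : (\int[mu]_(x in U) h x < +oo)%E.
  rewrite /h integral_nneseries//.
  apply: (@le_lt_trans _ _ (\sum_(0 <= k <oo) ((2 ^+ k)^-1)%:E)%E).
    apply: lee_nneseries => [k _ _|k _]; last exact: ih1.
    by apply: integral_ge0 => x _; exact: h1ge0.
  apply: (@le_lt_trans _ _ 2%:E); last by rewrite ltry.
  apply: lime_le; first by apply: is_cvg_nneseries => k _ _; rewrite lee_fin invr_ge0 exprn_ge0.
  near=> n; rewrite sumEFin lee_fin big_mkord; exact: sum_half_le.
have h0 x : (0 <= h x)%E by apply: nneseries_ge0 => k _ _; exact: h1ge0.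
have mh : measurable_fun U h by apply: ge0_emeasurable_sum.
have hint : mu.-integrable U h.
  by apply/integrableP; split => //; under eq_integral do rewrite gee0_abs//.
have hae := integrable_ae mU hint.
(* The weighted series converges on [G], which is almost all of [U]. Multiplying by the indicator of
   [G] makes the limit exist everywhere, so that [g] is measurable. *)
pose G := U `&` [set x | h x \is a fin_num].
have mG : measurable G by exact: emeasurable_fin_num.
pose FG k x : R := F k x * \1_G x.
have cFG x : cvgn (FG ^~ x).
  rewrite /FG indicE; case: (boolP (x \in G)) => xG; last first.
    by rewrite (_ : (fun k => _) = cst 0); [exact: is_cvg_cst|apply/funext => k; rewrite mulr0].
  rewrite (_ : (fun k => _) = F ^~ x); last by apply/funext => k; rewrite mulr1.
  have hx : h x \is a fin_num by move: xG; rewrite inE => -[].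
  set H := fine (h x).
  have Hsum n : \sum_(i < n) 2 ^+ i * D i x ^+ 2 <= H.
    rewrite -lee_fin /H fineK// -sumEFin -(big_mkord xpredT (fun i => (2 ^+ i * D i x ^+ 2)%:E)).
    by apply: nneseries_lim_ge => i _ _; exact: h1ge0.
  have H0 : 0 <= H by rewrite fine_ge0.
  have FF k n : (F (k + n)%N x - F k x) ^+ 2 <= 2 * H / 2 ^+ k.
    have -> : F (k + n)%N x - F k x = \sum_(j < n) D (k + j)%N x.
      rewrite -(big_mkord xpredT (fun j => D (k + j)%N x)).
      rewrite (eq_bigr (fun j => F (k + j.+1)%N x - F (k + j)%N x)); last first.
        by move=> j _; rewrite /D addnS.
      by rewrite (telescope_sumr (fun j => F (k + j)%N x))// addn0.
    apply: (le_trans (sum_sqr_geometric n (fun j => D (k + j)%N x))).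
    rewrite -mulrA ler_pM2l// ler_pdivlMr ?exprn_gt0// mulr_suml.
    apply: le_trans (Hsum (k + n)%N); rewrite big_split_ord/=.
    rewrite -[leLHS]add0r; apply: lerD.
      by apply: sumr_ge0 => i _; apply: mulr_ge0; [exact: exprn_ge0|exact: sqr_ge0].
    apply: ler_sum => i _.
    by rewrite exprD le_eqVlt; apply/orP; left; apply/eqP; ring.
  apply: cauchy_cvg; apply: cauchy_exP => e e0.
  have [k ke] : exists k : nat, 2 * H / 2 ^+ k < e ^+ 2.
    exists (Num.trunc (2 * H / e ^+ 2)).
    rewrite ltr_pdivrMr ?exprn_gt0// -ltr_pdivrMl ?exprn_gt0// mulrC.
    apply: (lt_le_trans (truncnS_gt _)).
    by rewrite -natrX ler_nat ltn_expl.
  exists (F k x); exists k => // m /= km.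
  rewrite /ball/= distrC -(subnKC km) -(ltr_sqr _ _) ?nnegrE ?(ltW e0)// real_normK ?num_real//.
  exact: le_lt_trans (FF _ _) ke.
pose g x := limn (FG ^~ x).
have mFG k : measurable_fun U (FG k).
  apply: measurable_funM; first exact: (sF k).1.
  exact: measurable_indic.
have mg : measurable_fun U g.
  by apply: (measurable_fun_cvg mFG) => x _; exact: cFG.
have pos4 k : 0 < (4 ^+ k : R)^-1 by rewrite invr_gt0 exprn_gt0.
have fat k n : (N k <= n)%N -> (\int[mu]_(x in U) ((f n x - g x) ^+ 2)%:E <= ((4 ^+ k)^-1)%:E)%E.
  move=> kn.
  pose q j x : \bar R := ((f n x - FG (k + j)%N x) ^+ 2)%:E.
  have mq j : measurable_fun U (q j).
    apply/measurable_EFinP; apply: measurable_funX; apply: measurable_funB; [exact: (sf n).1|exact: mFG].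
  have q0 j x : U x -> (0 <= q j x)%E by move=> _; rewrite lee_fin sqr_ge0.
  have iq j : (\int[mu]_(x in U) q j x <= ((4 ^+ k)^-1)%:E)%E.
    rewrite (_ : (\int[mu]_(x in U) q j x)%E = (sqnorm (fun x => f n x - F (k + j)%N x))%:E); last first.
      rewrite -EFin_sqnorm; last exact: sqintB.
      apply: ae_eq_integral => //.
        apply/measurable_EFinP; apply: measurable_funX; exact: (sqintB (sf n) (sF _)).1.
      move: hae; apply: filterS => x hx Ux; rewrite /q /FG indicE mem_set ?mulr1//.
      by split => //; exact: hx.
    rewrite lee_fin; apply: HN0; first exact: leq_trans (N0N k) kn.
    by apply: leq_trans (N0N k) _; apply: Nmono; rewrite leq_addr.
  have lq x : (limn_einf (q ^~ x) = ((f n x - g x) ^+ 2)%:E)%E.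
    apply: (cvg_limn_einf_sup _).1; apply: cvg_EFin; first by near=> j.
    have cx : FG (k + j)%N x @[j --> \oo] --> g x.
      have := cFG x; rewrite -(cvg_shiftn k) => H.
      by under eq_fun do rewrite addnC.
    apply: cvgM; (apply: cvgB; [exact: cvg_cst|exact: cx]).
  apply: (@le_trans _ _ (\int[mu]_(x in U) limn_einf (q ^~ x))%E).
    by under [leRHS]eq_integral do rewrite lq.
  apply: (le_trans (fatou mu mU mq q0)).
  rewrite limn_einf_lim; apply: lime_le; first exact: is_cvg_einfs.
  near=> j; apply: (le_trans _ (iq j)); apply: ereal_inf_lbound.
  by exists j => //=.
have sfg k n : (N k <= n)%N -> sqint (fun x => f n x - g x).
  move=> kn; split; first by apply: measurable_funB; [exact: (sf n).1|exact: mg].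
  exact: le_lt_trans (fat k n kn) (ltry _).
exists g; split.
  have -> : g = (fun x => f (N 0) x - (f (N 0) x - g x)) by apply/funext => x; rewrite subKr.
  apply: sqintB => //; exact: (sfg 0).
move=> e e0; exists (N (Num.trunc e^-1)) => n Nn.
have s := sfg _ _ Nn.
have := fat _ _ Nn; rewrite EFin_sqnorm// lee_fin => /le_trans; apply.
rewrite -[leRHS]invrK lef_pV2 ?posrE ?invr_gt0 ?exprn_gt0//; apply: ltW.
apply: (lt_le_trans (truncnS_gt _)).
by rewrite -natrX ler_nat ltn_expl.
Unshelve. all: by end_near. Qed.

End square_integrable.

(** * An approximate Lax-Milgram lemma *)

Section lax_milgram.
Context (R : realType) (X : lmodType R) (V : set X).
Variables (ip b : X -> X -> R) (l : X -> R) (lambda M L : R).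
Hypothesis V0 : V 0.
Hypothesis VZD : forall (a : R) x y, V x -> V y -> V (a *: x + y).
Hypothesis ipC : forall x y, V x -> V y -> ip x y = ip y x.
Hypothesis ip_lin : forall a x y z, V x -> V y -> V z -> ip (a *: x + y) z = a * ip x z + ip y z.
Hypothesis ip_ge0 : forall x, V x -> 0 <= ip x x.
Hypothesis bl_lin : forall a x y z, V x -> V y -> V z -> b (a *: x + y) z = a * b x z + b y z.
Hypothesis br_lin : forall a x y z, V x -> V y -> V z -> b z (a *: x + y) = a * b z x + b z y.
Hypothesis l_lin : forall a x y, V x -> V y -> l (a *: x + y) = a * l x + l y.
Hypothesis lambda0 : 0 < lambda.
Hypothesis b_coercive : forall x, V x -> lambda * ip x x <= b x x.
Hypothesis M0 : 0 <= M.
Hypothesis b_bounded : forall x y, V x -> V y ->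
  `|b x y| <= M * (Num.sqrt (ip x x) * Num.sqrt (ip y y)).
Hypothesis L0 : 0 <= L.
Hypothesis l_bounded : forall x, V x -> `|l x| <= L * Num.sqrt (ip x x).

Let nrm x := Num.sqrt (ip x x).

Let nrm_ge0 x : 0 <= nrm x. Proof. exact: sqrtr_ge0. Qed.

Let nrm_sqr x : V x -> nrm x ^+ 2 = ip x x.
Proof. by move=> Vx; rewrite sqr_sqrtr// ip_ge0. Qed.

Let ip_sqr a x y : V x -> V y ->
  ip (a *: x + y) (a *: x + y) = a ^+ 2 * ip x x + a * ip x y *+ 2 + ip y y.
Proof.
move=> Vx Vy; have Vxy := VZD a Vx Vy.
rewrite ip_lin// (ipC Vx Vxy) (ipC Vy Vxy) !ip_lin// (ipC Vy Vx); ring.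
Qed.

(* an almost minimizer of the energy almost represents [k]: [V] is not complete *)
Let approx_riesz (k : X -> R) (K e : R) : 0 <= K -> 0 < e ->
  (forall a x y, V x -> V y -> k (a *: x + y) = a * k x + k y) ->
  (forall x, V x -> `|k x| <= K * nrm x) ->
  exists2 z, V z & forall y, V y -> `|ip z y - k y| <= e * nrm y.
Proof.
move=> K0 e0 k_lin k_bnd.
pose J x := ip x x - 2 * k x.
pose S := [set J x | x in V].
have S0 : S !=set0 by exists (J 0), 0.
have lbS : lbound S (- K ^+ 2).
  move=> _ [x Vx <-]; rewrite /J -nrm_sqr//.
  have := k_bnd _ Vx; rewrite ler_norml => /andP[_ kx].
  have : 0 <= (nrm x - K) ^+ 2 by exact: sqr_ge0.
  nra.
have hS : has_inf S by split => //; exists (- K ^+ 2).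
have [_ [z Vz <-] Jz] := inf_adherent (exprn_gt0 2 e0) hS.
exists z => // y Vy.
have Jge t : - e ^+ 2 <= t ^+ 2 * ip y y + 2 * t * (ip z y - k y).
  have Vt := VZD t Vy Vz.
  have : inf S <= J (t *: y + z) by apply: ge_inf; [exact: hS.2|exists (t *: y + z)].
  move: Jz; rewrite /J ip_sqr// k_lin// (ipC Vy Vz); lra.
rewrite -(ger0_norm (mulr_ge0 (ltW e0) (nrm_ge0 y))) -ler_sqr ?nnegrE// !real_normK ?num_real//.
rewrite exprMn nrm_sqr//; apply: discriminant_le; first exact: ip_ge0.
by move=> t; have := Jge (- t); rewrite sqrrN; lra.
Qed.

(** The residual is measured in the dual norm; it replaces the distance to a solution, which may
    fail to exist in [V]. *)
Let res w rho := forall y, V y -> `|l y - b w y| <= rho * nrm y.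

Let cauchy_schwarz x y : V x -> V y -> `|ip x y| <= nrm x * nrm y.
Proof.
move=> Vx Vy.
rewrite -(ger0_norm (mulr_ge0 (nrm_ge0 x) (nrm_ge0 y))) -ler_sqr ?nnegrE// !real_normK ?num_real//.
rewrite exprMn !nrm_sqr//.
apply: discriminant_le; first exact: ip_ge0.
move=> t; have := ip_ge0 (VZD (- t) Vy Vx).
by rewrite ip_sqr// (ipC Vy Vx) sqrrN; lra.
Qed.

(* With [z] representing the residual and [y'] the part of [y] orthogonal to [z], the new residual is
   [(1 - tau * b z z / ip z z) * ip z y - tau * b z y'], whose norm is at most [q * nrm z]. *)
Let res_step : exists2 q : R, 0 <= q < 1 & forall w rho e, V w -> 0 < e -> 0 <= rho -> res w rho ->
  exists2 w', V w' & res w' (q * rho + e).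
Proof.
pose S := lambda ^+ 2 + M ^+ 2.
have S0 : 0 < S by rewrite ltr_pwDl ?exprn_gt0 ?sqr_ge0.
(* This [tau] minimizes (1 - tau lambda)^2 + (tau M)^2, and the minimum is 1 - tau lambda. *)
have [tau tau0 tS] : exists2 tau, 0 < tau & tau * S = lambda.
  by exists (lambda / S); rewrite ?divr_gt0// mulfVK// gt_eqF.
pose q := Num.sqrt ((1 - tau * lambda) ^+ 2 + (tau * M) ^+ 2).
have q2 : q ^+ 2 = (1 - tau * lambda) ^+ 2 + (tau * M) ^+ 2 by rewrite sqr_sqrtr// addr_ge0 ?sqr_ge0.
have q2E : q ^+ 2 = 1 - tau * lambda.
  rewrite q2 (_ : _ + _ = 1 - 2 * (tau * lambda) + tau * (tau * S)); last by rewrite /S; ring.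
  by rewrite tS; ring.
have q0 : 0 <= q by exact: sqrtr_ge0.
have tl0 : 0 < tau * lambda by rewrite mulr_gt0.
have q1 : q < 1 by rewrite -ltr_sqr ?nnegrE// expr1n q2E ltrBlDr ltrDl.
exists q; first by rewrite q0.
move=> w rho e Vw e0 rho0 rw; have e2 : 0 < e / 2 by rewrite divr_gt0.
pose r y := l y - b w y.
have r_lin a x y : V x -> V y -> r (a *: x + y) = a * r x + r y.
  by move=> Vx Vy; rewrite /r l_lin// br_lin//; ring.
have [z Vz zr] := approx_riesz rho0 e2 r_lin rw.
set n := nrm z; have n0 : 0 <= n by exact: nrm_ge0.
have n2 : n ^+ 2 = ip z z by exact: nrm_sqr.
have nz : n <= rho + e / 2.
  have := zr _ Vz; have := rw _ Vz; rewrite -/(r z) !ler_norml -n2 -/n => /andP[_ r1] /andP[_ r2].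
  have [->|nz0] := eqVneq n 0; first by rewrite addr_ge0// ltW.
  by rewrite -(@ler_pM2r _ n) ?lt_neqAle ?n0 1?eq_sym ?nz0//; lra.
exists (tau *: z + w); first exact: VZD.
move=> y Vy; rewrite bl_lin//.
have -> : l y - (tau * b z y + b w y) = (r y - ip z y) + (ip z y - tau * b z y) by rewrite /r; ring.
have ny0 := nrm_ge0 y.
suff main : `|ip z y - tau * b z y| <= n * (q * nrm y).
  apply: (le_trans (ler_normD _ _)); rewrite distrC; apply: (le_trans (lerD (zr _ Vy) main)).
  rewrite mulrA -mulrDl; apply: ler_wpM2r => //.
  have : n * q <= (rho + e / 2) * q by rewrite ler_wpM2r.
  have : e / 2 * q <= e / 2 by rewrite ler_piMr ?ltW.
  lra.
have [nE|nn] := eqVneq n 0.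
  have -> : ip z y = 0.
    by have := cauchy_schwarz Vz Vy; rewrite -/n nE mul0r normr_le0 => /eqP.
  have -> : b z y = 0.
    by have := b_bounded Vz Vy; rewrite -/(nrm z) -/n nE mul0r mulr0 normr_le0 => /eqP.
  by rewrite mulr0 subrr normr0 nE mul0r.
have np : 0 < n by rewrite lt_neqAle eq_sym nn.
have np2 : 0 < n ^+ 2 by rewrite exprn_gt0.
pose a := ip z y / n ^+ 2; pose y' := - a *: z + y; have Vy' : V y' by exact: VZD.
have aE : ip z y = a * n ^+ 2 by rewrite /a mulfVK// gt_eqF.
have y'2 : nrm y' ^+ 2 = nrm y ^+ 2 - (a * n) ^+ 2.
  by rewrite !nrm_sqr// ip_sqr// -n2 aE; ring.
pose beta := b z z / n ^+ 2.
have bE : b z y = a * (beta * n ^+ 2) + b z y'.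
  rewrite /beta mulfVK ?gt_eqF// -br_lin// /y'; congr (b z _).
  by rewrite scaleNr addrA subrr add0r.
have beta1 : lambda <= beta by rewrite ler_pdivlMr// n2; exact: b_coercive.
have beta2 : beta <= M.
  rewrite ler_pdivrMr//; apply: (le_trans (ler_norm _)).
  by have := b_bounded Vz Vz; rewrite -/(nrm z) -/n -expr2.
(* Together with lambda <= beta <= M, this bounds |1 - tau beta| by 1 - tau lambda on both sides. *)
have tMl : tau * (M + lambda) <= 2.
  have : tau * (2 * (M + lambda) * lambda) <= tau * (3 * S).
    by rewrite ler_pM2l// /S; have := sqr_ge0 (M - lambda); have := sqr_ge0 M; rewrite sqrrB; lra.
  have -> : tau * (2 * (M + lambda) * lambda) = 2 * (tau * (M + lambda) * lambda) by ring.
  have -> : tau * (3 * S) = 3 * lambda by rewrite mulrCA tS.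
  by move=> H; rewrite -(ler_pM2r lambda0); have := lambda0; lra.
have tb : `|1 - tau * beta| <= 1 - tau * lambda.
  have h1 : tau * lambda <= tau * beta by rewrite ler_pM2l.
  have h2 : tau * beta <= tau * M by rewrite ler_pM2l.
  by rewrite ler_norml; apply/andP; split; lra.
have tl1 : 0 <= 1 - tau * lambda := le_trans (normr_ge0 _) tb.
have by' := b_bounded Vz Vy'; rewrite -/(nrm z) -/(nrm y') -/n in by'.
have -> : ip z y - tau * b z y = a * n ^+ 2 * (1 - tau * beta) - tau * b z y' by rewrite aE bE; ring.
apply: (@le_trans _ _ (n * ((1 - tau * lambda) * (`|a| * n) + tau * M * nrm y'))).
  apply: (le_trans (ler_normB _ _)); rewrite (normrM (a * _)) (normrM a) (normrM tau).
  rewrite (ger0_norm (ltW tau0)) (ger0_norm (ltW np2)).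
  have h1 := ler_wpM2l (mulr_ge0 (normr_ge0 a) (ltW np2)) tb.
  have h2 := ler_wpM2l (ltW tau0) by'.
  apply: (le_trans (lerD h1 h2)); rewrite le_eqVlt; apply/orP; left; apply/eqP; ring.
(* Cauchy-Schwarz in the plane: one vector has the entries 1 - tau lambda and tau M and the length
   [q]; the other has the entries |a| n and [nrm y'], and its length is [nrm y] because [z] and [y']
   are orthogonal. *)
rewrite ler_pM2l// -ler_sqr ?nnegrE ?addr_ge0 ?mulr_ge0 ?(ltW tau0) ?nrm_ge0//.
rewrite exprMn q2.
have a2 : (`|a| * n) ^+ 2 = (a * n) ^+ 2 by rewrite (exprMn _ `|a|) (exprMn _ a) real_normK ?num_real.
have -> : nrm y ^+ 2 = (`|a| * n) ^+ 2 + nrm y' ^+ 2 by rewrite y'2 a2 addrC subrK.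
move: (1 - tau * lambda) (tau * M) (`|a| * n) (nrm y') => A B c d.
by have := sqr_ge0 (A * d - B * c); rewrite sqrrB !sqrrD !exprMn; lra.
Qed.

(** Neither completeness of [V] nor definiteness of [ip] is assumed, so an exact solution is out of
    reach. Iterating [res_step] from 0 contracts the residual by a fixed factor, up to an error as
    small as desired. *)
Lemma approx_lax_milgram (e : R) : 0 < e ->
  exists2 w, V w & forall y, V y -> `|l y - b w y| <= e * Num.sqrt (ip y y).
Proof.
move=> e0.
have [q' /andP[q0 q1] step] := res_step.
(* With this error, e / 2 is the fixed point of the recursion that sends rho to q' rho + e'. *)
pose e' := e * (1 - q') / 2.
have e'0 : 0 < e' by rewrite /e' divr_gt0// mulr_gt0// subr_gt0.
have iter n : exists2 w, V w & res w (q' ^+ n * L + e / 2).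
  elim: n => [|n [w Vw rw]].
    exists 0 => // y Vy; rewrite expr0 mul1r.
    have -> : b 0 y = 0.
      have := bl_lin 0 V0 V0 Vy; rewrite scale0r add0r mul0r add0r.
      by have := bl_lin 1 V0 V0 Vy; rewrite scale1r addr0 mul1r; lra.
    rewrite subr0 (le_trans (l_bounded Vy))// ler_wpM2r// lerDl ltW//divr_gt0//.
  have r0 : 0 <= q' ^+ n * L + e / 2.
    by rewrite addr_ge0// ?mulr_ge0// ?exprn_ge0// ltW// divr_gt0.
  have [w' Vw' rw'] := step w _ e' Vw e'0 r0 rw.
  exists w' => // y Vy; apply: (le_trans (rw' _ Vy)); apply: ler_wpM2r => //.
  by rewrite /e' exprS; lra.
have [n nL] : exists n, q' ^+ n * L <= e / 2.
  have : (q' ^+ n * L @[n --> \oo] --> 0).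
    rewrite -(mul0r L); apply: cvgM; last exact: cvg_cst.
    by apply: cvg_expr; rewrite ger0_norm.
  move=> /cvgrPdist_le /(_ (e / 2)) /(_ (divr_gt0 e0 (ltr0n R 2)))[n _ /(_ n (leqnn n))].
  rewrite sub0r normrN => H; exists n.
  by apply: le_trans H; exact: ler_norm.
have [w Vw rw] := iter n; exists w => // y Vy.
apply: (le_trans (rw _ Vy)); apply: ler_wpM2r => //; lra.
Qed.
End lax_milgram.

(** * Smooth functions and cut-offs *)

Section chain_rule.
Context (R : realType) (V : normedModType R).

(** Directional derivatives are derivatives of one real variable, to which the mean value theorem
    and the fundamental theorem of calculus apply. *)
Lemma is_derive_line (f : V -> R) (x v : V) (t df : R) :
  is_derive (x + t *: v) v f df <-> is_derive t 1 (fun s => f (x + s *: v)) df.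
Proof.
have E : (fun h : R => h^-1 *: (((fun s => f (x + s *: v)) \o shift t) (h *: 1) - f (x + t *: v))) =
    (fun h : R => h^-1 *: ((f \o shift (x + t *: v)) (h *: v) - f (x + t *: v))).
  apply/funext => h /=; congr (_ *: (f _ - _)).
  by rewrite [_ *: 1]mulr1 scalerDl addrCA addrC.
by split => -[d D]; apply: DeriveDef; [rewrite /derivable E|rewrite -D /derive E|
  rewrite /derivable -E|rewrite -D /derive -E].
Qed.

Lemma is_derive_line0 (f : V -> R) (x v : V) (df : R) :
  is_derive x v f df <-> is_derive (0 : R) 1 (fun s => f (x + s *: v)) df.
Proof. by rewrite -is_derive_line scale0r addr0. Qed.

Lemma is_derive_comp1 (f : R -> R) (g : V -> R) (x v : V) (df dg : R) :
  is_derive (g x) 1 f df -> is_derive x v g dg -> is_derive x v (f \o g) (df * dg).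
Proof.
move=> [df1 Df] /is_derive_line0[dg1 Dg]; apply/is_derive_line0.
have gx : g (x + 0 *: v) = g x by rewrite scale0r addr0.
apply: DeriveDef.
  apply/derivable1_diffP; rewrite (_ : (fun s => _) = f \o (fun s => g (x + s *: v)))//.
  apply: differentiable_comp.
    exact/derivable1_diffP.
  by apply/derivable1_diffP; rewrite gx.
have := @derive1_comp _ (fun s => g (x + s *: v)) f 0 dg1.
by rewrite !derive1E gx => /(_ df1) ->; rewrite Df Dg.
Qed.

End chain_rule.

Section flat.
Context (R : realType).

(* all derivatives of [expR (- t^-1)] are combinations of these functions *)
Definition flat (n : nat) (t : R) : R := if 0 < t then t ^- n * expR (- t^-1) else 0.

Lemma flat_gt0 n t : 0 < t -> 0 < flat n t.
Proof. by move=> t0; rewrite /flat t0 mulr_gt0 ?expR_gt0// invr_gt0 exprn_gt0. Qed.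

Lemma flat_le0 n t : t <= 0 -> flat n t = 0.
Proof. by rewrite /flat ltNge => ->. Qed.

Lemma flat_ge0 n t : 0 <= flat n t.
Proof. by have [/(flat_gt0 n)/ltW//|/(flat_le0 n) ->] := ltP 0 t. Qed.

(** The exponential of 1/t dominates the term of order [n.+2] of its series. The spare factor t^2
    makes the derivative at 0 vanish. *)
Lemma flat_small n t : 0 < t -> flat n t <= (n.+2)`!%:R * t ^+ 2.
Proof.
move=> t0; rewrite /flat t0.
have ti : 0 < t^-1 by rewrite invr_gt0.
have := expR_ge1Dxn n.+1 (ltW ti); rewrite expRN.
set e := expR _ => H.
have e0 : 0 < e by exact: expR_gt0.
have f0 : 0 < (n.+2)`!%:R :> R by rewrite ltr0n fact_gt0.
rewrite ler_pdivrMr// exprVn in H *.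
have -> : t ^- n = t ^- n.+2 * t ^+ 2.
  by rewrite -[n.+2]addn2 exprD invfM -mulrA mulVf ?mulr1// expf_neq0// gt_eqF.
rewrite mulrAC ler_wpM2r ?sqr_ge0//.
by rewrite mulrC -ler_pdivrMr//; lra.
Qed.

Lemma is_derive_flat (n : nat) (t : R) :
  is_derive t 1 (flat n) (flat n.+2 t - n%:R * flat n.+1 t).
Proof.
have [t0|t0|->] := ltgtP t 0.
- rewrite !(flat_le0 _ (ltW t0)) mulr0 subr0.
  apply: (@near_eq_is_derive _ _ _ (cst 0)).
  near=> s; rewrite flat_le0// ltW//; near: s; exact: lt_nbhsl.
- have tn0 : t != 0 by rewrite gt_eqF.
  have dV : is_derive t 1 (fun s : R => s^-1) (- t ^- 2).
    apply: DeriveDef; first exact: derivableV.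
    by rewrite deriveV// derive_id [_ *: _]mulr1.
  have dE := is_derive_comp1 (g := - (fun s : R => s^-1)) (is_derive_expR (- t^-1)) (is_deriveN dV).
  have dX := is_deriveM (is_deriveX n dV) dE.
  apply: (@near_eq_is_derive _ _ _ ((fun s : R => s^-1) ^+ n * (expR \o - (fun s : R => s^-1)))).
    near=> s; have s0 : 0 < s by near: s; exact: lt_nbhsr.
    by rewrite /flat s0 /= fctE exprfctE exprVn.
  apply: is_derive_eq; rewrite /flat t0 exprfctE.
  rewrite -!exprVn /GRing.scale/= ?opprfctE.
  by case: n {dX} => [|m]; rewrite ?exprS ?expr0 /=; ring.
- rewrite !flat_le0// mulr0 subr0.
  have H : h^-1 *: ((flat n \o shift 0) (h *: 1) - flat n 0) @[h --> (0 : R)^'] --> (0 : R).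
    apply/cvgr0Pnorm_le => e e0; near=> h.
    rewrite /= [flat n 0]flat_le0// subr0 addr0 [h *: 1]mulr1 normrM normfV.
    have h0 : 0 < `|h| by rewrite normr_gt0; near: h; exact: nbhs_dnbhs_neq.
    rewrite mulrC ler_pdivrMr// (ger0_norm (flat_ge0 _ _)).
    have [hp|hn] := ltP 0 h; last first.
      by rewrite flat_le0// mulr_ge0// ltW.
    apply: (le_trans (flat_small n hp)); rewrite (ger0_norm (ltW hp)) expr2 mulrA ler_wpM2r ?(ltW hp)//.
    rewrite -ler_pdivlMl ?ltr0n ?fact_gt0//.
    apply: (le_trans (ler_norm h)); near: h.
    apply: dnbhs0_le; rewrite mulr_gt0// invr_gt0 ltr0n fact_gt0//.
  apply: DeriveDef; last exact: cvg_lim H.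
  by apply/cvg_ex; exists 0.
Unshelve. all: by end_near. Qed.

End flat.

Section Ck.
Context (R : realType) (d : nat).
Local Notation E := 'rV[R]_d.
Implicit Types (f g : E -> R) (k : nat) (i : 'I_d).

Lemma Ck_continuous k f : Ck k f -> continuous f.
Proof. by case: k => [|k] //= []. Qed.

Lemma Ck_pred k f : Ck k.+1 f -> Ck k f.
Proof.
elim: k f => [|k IH] f [cf df]; first exact: cf.
by split => // i; have [di Di] := df i; split => //; exact: IH.
Qed.

Lemma Ck_derivable k f i x : Ck k.+1 f -> derivable f x (delta_mx ord0 i).
Proof. by move=> [_ /(_ i)[]]. Qed.

Lemma Ck_partial k f i : Ck k.+1 f -> Ck k (partial f i).
Proof. by move=> [_ /(_ i)[]]. Qed.

Lemma Ck_is_derive k f i x : Ck k.+1 f -> is_derive x (delta_mx ord0 i) f (partial f i x).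
Proof. by move=> Cf; apply/derivableP; exact: Ck_derivable Cf. Qed.

Lemma Ck_intro k f (df : 'I_d -> E -> R) :
  (forall i x, is_derive x (delta_mx ord0 i) f (df i x)) -> (forall i, Ck k (df i)) ->
  continuous f -> Ck k.+1 f.
Proof.
move=> fd Cd cf; split => // i; split => [x|]; first by have [] := fd i x.
by rewrite (_ : partial f i = df i)//; apply/funext => x; rewrite /partial derive_val.
Qed.

Lemma Ck_cst k (c : R) : Ck k (cst c : E -> R).
Proof.
elim: k c => [|k IH] c; first exact: cst_continuous.
apply: (@Ck_intro _ _ (fun _ => cst 0) (fun i x => is_derive_cst _ _ _)) => [i|].
  exact: IH.
exact: cst_continuous.
Qed.

Lemma CkD k f g : Ck k f -> Ck k g -> Ck k (f + g).
Proof.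
elim: k f g => [|k IH] f g Cf Cg; first by move=> x; apply: continuousD; [exact: Cf|exact: Cg].
apply: (@Ck_intro _ _ (fun i => partial f i + partial g i)) => [i x|i|].
- exact: is_deriveD (Ck_is_derive i x Cf) (Ck_is_derive i x Cg).
- by apply: IH; exact: Ck_partial.
- by move=> x; apply: continuousD; [exact: Ck_continuous Cf _|exact: Ck_continuous Cg _].
Qed.

Lemma CkM k f g : Ck k f -> Ck k g -> Ck k (f * g).
Proof.
elim: k f g => [|k IH] f g Cf Cg; first by move=> x; apply: continuousM; [exact: Cf|exact: Cg].
apply: (@Ck_intro _ _ (fun i => f * partial g i + g * partial f i)) => [i x|i|].
- exact: is_deriveM (Ck_is_derive i x Cf) (Ck_is_derive i x Cg).
- by apply: CkD; apply: IH; [exact: Ck_pred|exact: Ck_partial|exact: Ck_pred|exact: Ck_partial].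
- by move=> x; apply: continuousM; [exact: Ck_continuous Cf _|exact: Ck_continuous Cg _].
Qed.

Lemma CkZ k (a : R) f : Ck k f -> Ck k (a *: f).
Proof. by move=> Cf; exact: (CkM (Ck_cst k a) Cf). Qed.

Lemma CkN k f : Ck k f -> Ck k (- f).
Proof. by move=> Cf; rewrite -scaleN1r; exact: CkZ. Qed.

Lemma CkB k f g : Ck k f -> Ck k g -> Ck k (f - g).
Proof. by move=> Cf Cg; apply: CkD => //; exact: CkN. Qed.

Lemma CkV k f : (forall x, f x != 0) -> Ck k f -> Ck k (fun x => (f x)^-1).
Proof.
move=> f0; elim: k f f0 => [|k IH] f f0 Cf; first by move=> x; apply: continuousV => //; exact: Cf.
apply: (@Ck_intro _ _ (fun i => - ((fun x => (f x)^-1) * (fun x => (f x)^-1) * partial f i))) => [i x|i|].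
- have [fd fD] := Ck_is_derive i x Cf.
  apply: DeriveDef; first exact: derivableV.
  by rewrite deriveV// fD [_ *: _]mulNr expr2 invfM.
- apply: CkN; apply: CkM; last exact: Ck_partial.
  by apply: CkM; apply: IH => //; exact: Ck_pred.
- by move=> x; apply: continuousV => //; exact: Ck_continuous Cf _.
Qed.

Lemma Ck_coord k i : Ck k (fun x : E => x ord0 i).
Proof.
case: k => [|k]; first exact: coord_continuous.
apply: (@Ck_intro _ _ (fun j => cst ((delta_mx ord0 j : E) ord0 i))) => [j x|j|].
- apply/is_derive_line0.
  rewrite (_ : (fun s => _) = cst (x ord0 i) + (delta_mx ord0 j : E) ord0 i *: id).
    have := is_deriveD (is_derive_cst (x ord0 i) (0 : R) 1)
      (is_deriveZ ((delta_mx ord0 j : E) ord0 i) (is_derive_id (0 : R) 1)).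
    by rewrite add0r [_ *: 1]mulr1.
  by apply/funext => s; rewrite !mxE /= !fctE mulrC.
- exact: Ck_cst.
- exact: coord_continuous.
Qed.

Lemma Ck_flat k n f : smooth f -> Ck k (flat n \o f).
Proof.
move=> sf; elim: k n => [|k IH] n.
  move=> x; apply: continuous_comp; first exact: (sf 0).
  by apply/differentiable_continuous/derivable1_diffP; have [] := is_derive_flat n (f x).
apply: (@Ck_intro _ _ (fun i => (flat n.+2 \o f - n%:R *: (flat n.+1 \o f)) * partial f i)) => [i x|i|].
- exact: is_derive_comp1 (is_derive_flat n (f x)) (Ck_is_derive i x (sf 1)).
- apply: CkM; last exact: Ck_partial (sf k.+1).
  by apply: CkB => //; exact: CkZ.
- move=> x; apply: continuous_comp; first exact: (sf 0).
  by apply/differentiable_continuous/derivable1_diffP; have [] := is_derive_flat n (f x).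
Qed.

Definition enorm2 (x : E) : R := \sum_(i < d) x ord0 i ^+ 2.

Lemma smooth_enorm2 (a : E) : smooth (fun x => enorm2 (x - a)).
Proof.
move=> k; rewrite /enorm2.
rewrite (_ : (fun x => _) = \sum_(i < d) (fun x : E => (x ord0 i - a ord0 i) ^+ 2)); last first.
  by apply/funext => x; rewrite fct_sumE; apply: eq_bigr => i _; rewrite !mxE.
elim/big_ind: _ => [|f g|i _]; [exact: Ck_cst|exact: CkD|].
have C1 : Ck k (fun x : E => x ord0 i - a ord0 i) by apply: CkB; [exact: Ck_coord|exact: Ck_cst].
exact: CkM.
Qed.

(** The cut-off is u / (u + v), where [u] is positive exactly inside the radius [s] and [v] exactly
    outside the radius [r]; since r < s, the denominator never vanishes. *)
Lemma smooth_cutoff (a : E) (r s : R) : 0 <= r -> r < s ->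
  exists chi : E -> R, [/\ smooth chi, (forall x, enorm2 (x - a) <= r ^+ 2 -> chi x = 1)
    & forall x, s ^+ 2 <= enorm2 (x - a) -> chi x = 0].
Proof.
move=> r0 rs; pose q x := enorm2 (x - a).
have rs2 : r ^+ 2 < s ^+ 2 by rewrite ltr_sqr ?nnegrE// (le_trans r0)// ltW.
pose u := flat 0 \o (cst (s ^+ 2) - q); pose v := flat 0 \o (q - cst (r ^+ 2)).
have sq : smooth q := smooth_enorm2 a.
have su : smooth u by move=> k; apply: Ck_flat => k'; apply: CkB => //; exact: Ck_cst.
have sv : smooth v by move=> k; apply: Ck_flat => k'; apply: CkB => //; exact: Ck_cst.
have uv0 x : u x + v x != 0.
  rewrite gt_eqF// /u /v /= !fctE; have [qs|qs] := ltP (q x) (s ^+ 2).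
    by rewrite ltr_pwDl ?flat_ge0// flat_gt0// subr_gt0.
  by rewrite ltr_wpDl ?flat_ge0// flat_gt0// subr_gt0 (lt_le_trans rs2).
exists (u * (fun x => ((u + v) x)^-1)); split.
- by move=> k; apply: CkM => //; apply: CkV => //; exact: CkD.
- move=> x qr; have v0 : v x = 0 by rewrite /v /= !fctE flat_le0// subr_le0.
  by have := uv0 x; rewrite !fctE v0 addr0 => /divff.
- by move=> x qs; rewrite !fctE [u x]flat_le0 ?mul0r//= !fctE subr_le0.
Qed.

End Ck.

(** * The line inequality *)

Section line_integral.
Context (R : realType) (d : nat).
Local Notation E := 'rV[R]_d.
Implicit Types (f : E -> R) (x y v w : E).

Lemma MVT_line (g g' : R -> R) (h : R) : (forall s : R, is_derive s 1 g (g' s)) ->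
  exists2 theta, `|theta| <= `|h| & g h - g 0 = g' theta * h.
Proof.
move=> dg.
have cg : continuous g by move=> s; apply/differentiable_continuous/derivable1_diffP; have [] := dg s.
have [h0|h0|->] := ltgtP h 0.
- have [c + Eg] := MVT h0 (fun s _ => dg s) (continuous_subspaceT cg).
  rewrite in_itv/= => /andP[hc c0].
  exists c; last by rewrite -opprB Eg; ring.
  by rewrite !ltr0_norm// lerN2 ltW.
- have [c + Eg] := MVT h0 (fun s _ => dg s) (continuous_subspaceT cg).
  rewrite in_itv/= => /andP[hc c0].
  exists c; last by rewrite Eg subr0.
  by rewrite !gtr0_norm// ltW.
- by exists 0 => //; rewrite subrr mulr0.
Qed.

(** Strict differentiability along [v]: the estimate is uniform over base points [y] close to [x].
    Unlike a plain directional derivative, it is additive in [v], since the increment along [w] may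
    start at y + h v. *)
Let sdiff f x v (l : R) := forall e : R, 0 < e -> exists2 r : R, 0 < r &
  forall y (h : R), `|y - x| < r -> `|h| < r -> `|f (y + h *: v) - f y - h * l| <= e * `|h|.

Let sdiff_partial f x i : Ck 1 f -> sdiff f x (delta_mx ord0 i) (partial f i x).
Proof.
move=> Cf e e0.
have cp : continuous (partial f i) := Ck_continuous (Ck_partial i Cf).
have /cvgrPdist_lt/(_ e e0)/nbhs_ballP[r /= r0 rP] := cp x.
set v : E := delta_mx ord0 i.
have v1 : 0 < 1 + `|v| by rewrite ltr_wpDr.
exists (r / (1 + `|v|)); first by rewrite divr_gt0.
move=> y h yr hr.
have dg (s : R) : is_derive s 1 (fun s : R => f (y + s *: v)) (partial f i (y + s *: v)).
  exact: (proj1 (is_derive_line f y v s _) (Ck_is_derive i (y + s *: v) Cf)).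
have [t th] := MVT_line h dg.
rewrite scale0r addr0 => ->.
rewrite (_ : _ - _ = (partial f i (y + t *: v) - partial f i x) * h); last by ring.
rewrite normrM ler_wpM2r// ltW// distrC; apply: rP.
rewrite -ball_normE /ball_/= distrC addrAC (le_lt_trans (ler_normD _ _))// normrZ.
rewrite (@lt_le_trans _ _ (r / (1 + `|v|) + r / (1 + `|v|) * `|v|))//.
  by rewrite ltr_leD// ler_wpM2r// (le_trans th)// ltW.
by rewrite -[X in X + _]mulr1 -mulrDr mulfVK// gt_eqF.
Qed.

Let sdiff0 f x : sdiff f x 0 0.
Proof.
move=> e e0; exists 1 => // y h _ _.
by rewrite scaler0 addr0 mulr0 subr0 subrr normr0 mulr_ge0// ltW.
Qed.

Let sdiffD f x v w l m : sdiff f x v l -> sdiff f x w m -> sdiff f x (v + w) (l + m).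
Proof.
move=> fv fw e e0; have e2 : 0 < e / 2 by rewrite divr_gt0.
have [r1 r10 H1] := fv _ e2; have [r2 r20 H2] := fw _ e2.
have v1 : 0 < 1 + `|v| by rewrite ltr_wpDr.
exists (Num.min r1 (Num.min r2 (r2 / (1 + `|v|)))); first by rewrite !lt_min r10 r20 divr_gt0.
move=> y h; rewrite !lt_min => /and3P[y1 y2 y3] /and3P[h1 h2 h3].
have := H1 y h y1 h1; have := H2 (y + h *: v) h.
rewrite addrAC (_ : `|y - x + h *: v| < r2).
  move=> /(_ isT h2) A B; rewrite scalerDr addrA.
  rewrite (_ : _ - _ = (f (y + h *: v + h *: w) - f (y + h *: v) - h * m) +
     (f (y + h *: v) - f y - h * l)); last by ring.
  by rewrite (le_trans (ler_normD _ _))// (splitr e) mulrDl lerD.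
rewrite (le_lt_trans (ler_normD _ _))// normrZ.
rewrite (@lt_le_trans _ _ (r2 / (1 + `|v|) + r2 / (1 + `|v|) * `|v|))//.
  by rewrite ltr_leD// ler_wpM2r// ltW.
by rewrite -[X in X + _]mulr1 -mulrDr mulfVK// gt_eqF.
Qed.

Let sdiffZ f x v l (c : R) : sdiff f x v l -> sdiff f x (c *: v) (c * l).
Proof.
move=> fv e e0; have c1 : 0 < 1 + `|c| by rewrite ltr_wpDr.
have [r r0 H] := fv (e / (1 + `|c|)) (divr_gt0 e0 c1).
have c2 : `|c| / (1 + `|c|) <= 1 by rewrite ler_pdivrMr// mul1r lerDr.
exists (Num.min r (r / (1 + `|c|))); first by rewrite lt_min r0 divr_gt0.
move=> y h; rewrite !lt_min => /andP[y1 _] /andP[_ h2].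
have := H y (h * c) y1; rewrite scalerA mulrA normrM => H'; apply: (le_trans (H' _)).
  rewrite ltr_pdivlMr// in h2; apply: le_lt_trans h2.
  by rewrite ler_wpM2l// lerDr.
have -> : e / (1 + `|c|) * (`|h| * `|c|) = e * `|h| * (`|c| / (1 + `|c|)) by ring.
by rewrite ler_piMr// mulr_ge0// ltW.
Qed.

(** [Ck] speaks of the coordinate directions only. Continuity of the partial derivatives gives
    strict differentiability along these, which then passes to linear combinations. *)
Lemma is_derive_C1 f x v : Ck 1 f ->
  is_derive x v f (\sum_(i < d) v ord0 i * partial f i x).
Proof.
move=> Cf.
have S : sdiff f x v (\sum_(i < d) v ord0 i * partial f i x).
  rewrite [X in sdiff _ _ X](_ : v = \sum_(i < d) v ord0 i *: (delta_mx ord0 i : E)); last first.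
    by rewrite {1}(row_sum_delta v).
  elim/big_ind2: _ => [||i _]; [exact: sdiff0|by move=> *; exact: sdiffD|].
  by apply: sdiffZ; exact: sdiff_partial.
set l := \sum_(i < d) _ in S *.
have H : h^-1 *: ((f \o shift x) (h *: v) - f x) @[h --> (0 : R)^'] --> l.
  apply/cvgrPdist_le => e e0; have [r r0 H] := S e e0; near=> h.
  have h0 : h != 0 by near: h; exact: nbhs_dnbhs_neq.
  have hr : `|h| < r by near: h; exact: dnbhs0_lt.
  have := H x h; rewrite subrr normr0 => /(_ r0 hr).
  rewrite /= [h *: v + x]addrC => H'.
  rewrite (_ : l - _ = - (h^-1 * (f (x + h *: v) - f x - h * l))); last first.
    by rewrite mulrBr mulKf// /GRing.scale/=; ring.
  by rewrite normrN normrM normfV mulrC ler_pdivrMr// normr_gt0.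
apply: DeriveDef; last exact: cvg_lim H.
by apply/cvg_ex; exists l.
Unshelve. all: by end_near. Qed.

Lemma sum_sqr_cauchy (a b : 'I_d -> R) :
  (\sum_(i < d) a i * b i) ^+ 2 <= (\sum_(i < d) a i ^+ 2) * (\sum_(i < d) b i ^+ 2).
Proof.
apply: discriminant_le => [|t]; first by apply: sumr_ge0 => i _; exact: sqr_ge0.
rewrite !mulr_sumr -sumrB -big_split/=; apply: sumr_ge0 => i _.
by have := sqr_ge0 (a i - t * b i); rewrite sqrrB exprMn; lra.
Qed.

Lemma enorm2_ge0 x : 0 <= enorm2 x.
Proof. by apply: sumr_ge0 => i _; exact: sqr_ge0. Qed.

Lemma continuous_grad_sqr f : Ck 1 f -> continuous (fun x => enorm2 (grad f x)).
Proof.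
move=> Cf.
rewrite (_ : (fun x => _) = \sum_(i < d) (partial f i * partial f i)); last first.
  by apply/funext => x; rewrite fct_sumE; apply: eq_bigr => i _; rewrite mxE expr2.
elim/big_ind: _ => [|g h cg ch|i _].
- exact: cst_continuous.
- by move=> x; apply: continuousD; [exact: cg|exact: ch].
- have cp : continuous (partial f i) := Ck_continuous (Ck_partial i Cf).
  by move=> x; apply: continuousM; exact: cp.
Qed.

Lemma integrable_segment (g : R -> R) (T : R) : continuous g ->
  lebesgue_measure.-integrable `[(0 : R), T] (EFin \o g).
Proof.
move=> cg; apply: continuous_compact_integrable; first exact: segment_compact.
exact: continuous_subspaceT.
Qed.

Lemma sqr_integral_le (g : R -> R) (T : R) : 0 < T -> continuous g ->
  ((\int[lebesgue_measure]_(t in `[0%R, T]) g t) ^+ 2 <=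
   T * \int[lebesgue_measure]_(t in `[0%R, T]) (g t ^+ 2))%R.
Proof.
move=> T0 cg; pose U : set (measurableTypeR R) := `[(0 : R), T]%classic.
have mU : measurable U by exact: measurable_itv.
have sq (h : R -> R) : continuous h -> sqint lebesgue_measure U h.
  move=> ch; have I := integrable_segment T (continuous_fun_mul ch ch); split.
    by apply/measurable_EFinP; exact: measurable_int (integrable_segment T ch).
  exact: integrable_lty I.
have c1 : continuous (cst 1 : R -> R) by exact: cst_continuous.
have := integral_cauchy mU (sq g cg) (sq _ c1); rewrite mulrC.
have -> : sqnorm lebesgue_measure U (cst 1 : R -> R) = T.
  rewrite /sqnorm; under eq_Rintegral do rewrite expr1n.
  rewrite Rintegral_cst// mul1r.
  by rewrite [X in fine X](lebesgue_segment T0).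
by under eq_Rintegral do rewrite mulr1.
Qed.

(** The increment is the integral of the directional derivative; Cauchy-Schwarz is applied on the
    segment and then to the scalar product of [v] with the gradient. *)
Lemma line_inequality f x v (T : R) : 0 < T -> Ck 1 f ->
  (((f (x + T *: v) - f x) ^+ 2)%:E <= (T * enorm2 v)%:E *
   \int[lebesgue_measure]_(t in `[0%R, T]) (enorm2 (grad f (x + t *: v)))%:E)%E.
Proof.
move=> T0 Cf.
pose g (t : R) := f (x + t *: v).
pose k (t : R) := \sum_(i < d) v ord0 i * partial f i (x + t *: v).
have dg (t : R) : is_derive t 1 g (k t).
  exact: (proj1 (is_derive_line f x v t _) (is_derive_C1 (x + t *: v) v Cf)).
have cl : continuous (fun t : R => x + t *: v).
  apply: continuous_fun_add; first exact: cst_continuous.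
  exact: scalel_continuous.
have ck : continuous k.
  rewrite /k (_ : (fun t => _) = \sum_(i < d) (fun t : R => v ord0 i * partial f i (x + t *: v))); last first.
    by apply/funext => t; rewrite fct_sumE.
  elim/big_ind: _ => [|a b ca cb|i _]; first exact: cst_continuous.
    exact: continuous_fun_add.
  apply: continuous_fun_mul => [|t]; first exact: cst_continuous.
  by apply: (continuous_comp (cl t)); exact: Ck_continuous (Ck_partial i Cf) _.
have cg : continuous g by move=> s; apply/differentiable_continuous/derivable1_diffP; have [] := dg s.
have FTC : (\int[lebesgue_measure]_(t in `[0%R, T]) (k t)%:E = (g T)%:E - (g 0)%:E)%E.
  apply: continuous_FTC2 => //; first exact: continuous_subspaceT.
    split; first by move=> t _; have [] := dg t.
      by apply: cvg_at_right_filter; exact: cg.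
    by apply: cvg_at_left_filter; exact: cg.
  by move=> t _; rewrite derive1E derive_val.
have -> : f (x + T *: v) - f x = (\int[lebesgue_measure]_(t in `[0%R, T]) k t)%R.
  by rewrite /Rintegral FTC -EFinB/= /g scale0r addr0.
have cG : continuous (fun t : R => enorm2 (grad f (x + t *: v))).
  move=> t; rewrite (_ : (fun t => _) = (fun y => enorm2 (grad f y)) \o (fun t : R => x + t *: v))//.
  apply: continuous_comp; first exact: cl.
  exact: continuous_grad_sqr.
have cint := @integrable_segment ^~ T.
rewrite -(fineK (integrable_fin_num _ (cint _ cG)))// -EFinM lee_fin.
apply: (le_trans (sqr_integral_le T0 ck)); rewrite -mulrA ler_pM2l//.
rewrite -[fine _]/(Rintegral _ _ _) -RintegralZl//; last exact: cint.
apply: le_Rintegral => //.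
- by apply: cint; exact: continuous_fun_mul.
- by apply: cint; apply: continuous_fun_mul => //; exact: cst_continuous.
- move=> t _; rewrite /k; apply: (le_trans (sum_sqr_cauchy _ _)).
  by rewrite le_eqVlt; apply/orP; left; apply/eqP; congr (_ * _); apply: eq_bigr => i _; rewrite mxE.
Qed.

End line_integral.

(** * Test functions *)

Section test_functions.
Context (R : realType) (d : nat).
Local Notation E := 'rV[R]_d.
Local Notation mu := (lebesgue_rV R d).
Implicit Types (f g : E -> R) (U : set E).

Definition supp f : set E := closure [set x | f x != 0].

Lemma supp_out f x : ~ supp f x -> f x = 0.
Proof.
move=> nfx; apply/eqP; apply: contra_notT nfx => fx.
exact: subset_closure.
Qed.

Lemma partial_out f i x : ~ supp f x -> partial f i x = 0.
Proof.
move=> nfx.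
have H : \near x, f x = cst 0 x.
  have : nbhs x (~` supp f) by apply: open_nbhs_nbhs; split => //; exact/closed_openC/closed_closure.
  by apply: filterS => y /supp_out.
have dv : is_derive x (delta_mx ord0 i : E) f 0.
  apply: near_eq_is_derive (is_derive_cst 0 x (delta_mx ord0 i : E)).
  by move: H; apply: filterS => y ->.
by rewrite /partial derive_val.
Qed.

Lemma supp_sub f (F : set E) : closed F -> (forall x, ~ F x -> f x = 0) -> supp f `<=` F.
Proof.
move=> cF H; rewrite [X in _ `<=` X](closure_id F).1//; apply: closureS => x /= /eqP fx.
by apply: contrapT => /H.
Qed.

Lemma test_fun_of U f (F : set E) : smooth f -> compact F -> F `<=` U ->
  (forall x, ~ F x -> f x = 0) -> test_fun U f.
Proof.
move=> sf cF FU H.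
have sF : supp f `<=` F by apply: supp_sub => //; apply: compact_closed.
split => //; last exact: subset_trans FU.
by apply: subclosed_compact sF => //; exact: closed_closure.
Qed.

Lemma test_fun_smooth U f : test_fun U f -> smooth f. Proof. by case. Qed.

Lemma test_fun_compact U f : test_fun U f -> compact (supp f). Proof. by case. Qed.

Lemma test_fun_supp U f : test_fun U f -> supp f `<=` U. Proof. by case. Qed.

Lemma test_funS U U' f : U `<=` U' -> test_fun U f -> test_fun U' f.
Proof. by move=> UU' [sf cf fU]; split => //; exact: subset_trans UU'. Qed.

Lemma test_fun0 U : test_fun U (0 : E -> R).
Proof.
apply: (test_fun_of (F := set0)) => //; [move=> k; exact: Ck_cst|exact: compact0].
Qed.

Lemma test_fun_lin U (a : R) f g : test_fun U f -> test_fun U g -> test_fun U (a *: f + g).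
Proof.
move=> [sf cf fU] [sg cg gU]; apply: (test_fun_of (F := supp f `|` supp g)).
- by move=> k; apply: CkD => //; exact: CkZ.
- exact: compactU.
- by rewrite subUset.
- by move=> x /not_orP[/supp_out fx /supp_out gx]; rewrite !fctE fx gx scaler0 addr0.
Qed.

Lemma test_funM U (f g : E -> R) : test_fun U f -> smooth g -> test_fun U (f * g).
Proof.
move=> [sf cf fU] sg; apply: (test_fun_of (F := supp f)) => //.
- by move=> k; apply: CkM.
- by move=> x /supp_out fx; rewrite !fctE fx mul0r.
Qed.

Lemma partialD f g i x : Ck 1 f -> Ck 1 g -> partial (f + g) i x = partial f i x + partial g i x.
Proof. by move=> Cf Cg; rewrite /partial deriveD//; [exact: Ck_derivable Cf|exact: Ck_derivable Cg]. Qed.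

Lemma partialZ (a : R) f i x : Ck 1 f -> partial (a *: f) i x = a * partial f i x.
Proof. by move=> Cf; rewrite /partial deriveZ//; exact: Ck_derivable Cf. Qed.

Lemma partialM f g i x : Ck 1 f -> Ck 1 g ->
  partial (f * g) i x = f x * partial g i x + g x * partial f i x.
Proof. by move=> Cf Cg; rewrite /partial deriveM//; [exact: Ck_derivable Cf|exact: Ck_derivable Cg]. Qed.

Lemma test_fun_continuous U f : test_fun U f -> continuous f.
Proof. by move=> [sf _ _]; exact: (sf 0). Qed.

Lemma test_fun_continuous_partial U f i : test_fun U f -> continuous (partial f i).
Proof. by move=> [sf _ _]; exact: Ck_continuous (Ck_partial i (sf 1)). Qed.

(** A class containing the test functions and their partial derivatives, so that boundedness and
    integrability are proved once for both. *)
Definition ccfun f := continuous f /\ exists2 K : set E, compact K & forall x, ~ K x -> f x = 0.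

Lemma ccfun_test U f : test_fun U f -> ccfun f.
Proof.
move=> tf; split; first exact: test_fun_continuous tf.
by exists (supp f); [exact: test_fun_compact tf|move=> x; exact: supp_out].
Qed.

Lemma ccfun_partial U f i : test_fun U f -> ccfun (partial f i).
Proof.
move=> tf; split; first exact: test_fun_continuous_partial tf.
by exists (supp f); [exact: test_fun_compact tf|move=> x; exact: partial_out].
Qed.

Lemma ccfunM f g : ccfun f -> continuous g -> ccfun (fun x => f x * g x).
Proof.
move=> [cf [K cK fK]] cg; split; first exact: continuous_fun_mul.
by exists K => // x /fK ->; rewrite mul0r.
Qed.

Lemma ccfun_bounded f : ccfun f -> exists2 M : R, 0 <= M & forall x, `|f x| <= M.
Proof.
move=> [cf [K cK fK]].
have /compact_bounded[M [Mr HM]] := continuous_compact (continuous_subspaceT cf) cK.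
exists (`|M| + 1); first by rewrite addr_ge0.
move=> x; have [/asboolP Kx|/asboolP Kx] := boolP `[< K x >].
  apply: HM; last by exists x.
  by rewrite ltr_pwDr// ler_norm.
by rewrite fK// normr0 addr_ge0.
Qed.

Lemma ccfun_radius f : ccfun f -> exists2 r : R, 0 < r & forall x, r <= `|x| -> f x = 0.
Proof.
move=> [_ [K /compact_bounded[M [Mr HM]] fK]].
exists (`|M| + 2); first by rewrite ltr_wpDl.
move=> x Mx; apply: fK => Kx; have := HM (`|M| + 1); rewrite ltr_pwDr// ?ler_norm// => /(_ isT x Kx).
by move=> /(le_trans Mx); lra.
Qed.

Lemma norm_rV_lt (x : E) (r : R) : 0 < r -> (`|x| < r) = [forall j, `|x ord0 j| < r].
Proof.
move=> r0; apply/idP/forallP => [xr j|xr].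
  apply: le_lt_trans xr; rewrite [leRHS]/Num.Def.normr/= mx_normrE.
  exact: (le_bigmax _ (fun ij : 'I_1 * 'I_d => `|x ij.1 ij.2|) (ord0, j)).
rewrite [ltLHS]/Num.Def.normr/= mx_normrE; apply/bigmax_ltP; split => // -[i j] _ /=.
by rewrite ord1.
Qed.

Lemma ball_obox (p : E) (r : R) : 0 < r ->
  [set q | `|q - p| < r] = obox (fun j => p ord0 j - r) (fun j => p ord0 j + r).
Proof.
move=> r0; apply/seteqP; split => [q /=|q /= qp].
  rewrite norm_rV_lt// => /forallP H j; have := H j.
  rewrite !mxE in_itv/= ltr_norml => /andP[? ?]; apply/andP; split; lra.
rewrite norm_rV_lt//; apply/forallP => j; have := qp j.
rewrite !mxE in_itv/= ltr_norml => /andP[? ?]; apply/andP; split; lra.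
Qed.

(** The norm is the sup norm, so that the ball is a cube of side 2 r. *)
Lemma lebesgue_ball (p : E) (r : R) : 0 < r ->
  mu [set q | `|q - p| < r] = ((2 * r) ^+ d)%:E.
Proof.
move=> r0; rewrite ball_obox// lebesgue_obox; congr EFin.
rewrite -[X in _ ^+ X](card_ord d) -prodr_const; apply: eq_bigr => j _.
rewrite (_ : _ - _ = 2 * r); last by ring.
by rewrite max_r// mulr_ge0// ltW.
Qed.

Lemma measurable_ball_rV (p : E) (r : R) : measurable [set q : E | `|q - p| < r].
Proof.
have [r0|r0] := ltP 0 r; first by rewrite ball_obox//; exact: measurable_obox.
rewrite (_ : [set _ | _] = set0)//; apply/seteqP; split => // q /= H.
by have := le_lt_trans (normr_ge0 _) H; rewrite ltNge r0.
Qed.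

Lemma ccfun_measurable f D : ccfun f -> measurable_fun D f.
Proof. by move=> [cf _]; apply: measurable_funTS; exact: continuous_measurable_rV. Qed.

Lemma bounded_support_integrable (f : E -> R) (r M : R) :
  measurable_fun setT f -> (forall x, `|f x| <= M) -> (forall x, r <= `|x| -> f x = 0) ->
  mu.-integrable setT (EFin \o f).
Proof.
move=> mf fM fr; pose r' := Num.max r 1; have r'0 : 0 < r' by rewrite lt_max ltr01 orbT.
pose B : set E := [set q | `|q - 0| < r'].
have mB : measurable B := measurable_ball_rV 0 r'.
have -> : EFin \o f = (EFin \o f) \_ B.
  apply/funext => x; rewrite patchE; case: ifPn => // /negP; rewrite inE /B/= subr0 => /negP.
  by rewrite -leNgt /r' => H /=; rewrite fr//; apply: le_trans H; rewrite le_max lexx.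
rewrite -integrable_mkcond//; apply: measurable_bounded_integrable => //.
- by rewrite [X in (X < _)%E](lebesgue_ball 0 r'0) ltry.
- exact: measurable_funTS.
- exists M; split; first exact: num_real.
  by move=> N MN x _; apply: le_trans (fM x) (ltW MN).
Qed.

Lemma ccfun_integrable D f : measurable D -> ccfun f -> mu.-integrable D (EFin \o f).
Proof.
move=> mD cf; apply: (integrableS measurableT) => //.
have [M _ fM] := ccfun_bounded cf; have [r _ fr] := ccfun_radius cf.
by apply: (bounded_support_integrable _ fM fr); exact: ccfun_measurable.
Qed.

Lemma integral_translate_signed (p : E) (f : E -> \bar R) : measurable_fun [set: E] f ->
  (\int[mu]_q f (p + q)%R = \int[mu]_x f x)%E.
Proof.
move=> mf; rewrite integralE [RHS]integralE; congr (_ - _)%E.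
- rewrite -(@integral_translate R d p (f ^\+)%E (measurable_funepos mf) (funepos_ge0 _)).
  by apply: eq_integral => x _; rewrite !funeposE.
- rewrite -(@integral_translate R d p (f ^\-)%E (measurable_funeneg mf) (funeneg_ge0 _)).
  by apply: eq_integral => x _; rewrite !funenegE.
Qed.

(** Difference quotients of [f] have integral 0 by translation invariance, and they converge
    dominatedly to the partial derivative. *)
Lemma integral_partial_eq0 U f i : test_fun U f -> (\int[mu]_x partial f i x = 0)%R.
Proof.
move=> tf.
set v : E := delta_mx ord0 i.
pose h (n : nat) : R := n.+1%:R^-1.
have h0 n : 0 < h n by rewrite invr_gt0.
have hn0 n : h n != 0 by rewrite gt_eqF.
pose q n x := (h n)^-1 * (f (x + h n *: v) - f x).
have cf := ccfun_test tf; have cp := ccfun_partial i tf.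
have mf : measurable_fun setT f by exact: ccfun_measurable.
have ctr n : continuous (fun x : E => x + h n *: v).
  by apply: continuous_fun_add; [move=> ?; exact: cvg_id|exact: cst_continuous].
have cq n : continuous (q n).
  apply: continuous_fun_mul; first exact: cst_continuous.
  apply: continuous_fun_add.
    by move=> x; exact: (continuous_comp (ctr n x) (cf.1 _)).
  by move=> x; apply: continuousN; exact: cf.1.
have mq n : measurable_fun setT (q n) := continuous_measurable_rV (cq n).
have [M M0 pM] := ccfun_bounded cp; have [r r0 fr] := ccfun_radius cf.
have v1 : `|v| <= 1.
  rewrite [leLHS]/Num.Def.normr/= mx_normrE; apply: bigmax_le => // -[a b] _ /=.
  by rewrite !mxE; case: (_ && _); rewrite ?normr1 ?normr0.
(* By the mean value theorem a difference quotient is a value of the partial derivative, so one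
   bound serves for all [n]. *)
have qM n x : `|q n x| <= M.
  have dg (s : R) : is_derive s 1 (fun s : R => f (x + s *: v)) (partial f i (x + s *: v)).
    exact: (proj1 (is_derive_line f x v s _) (Ck_is_derive i (x + s *: v) (test_fun_smooth tf 1))).
  have [t _] := MVT_line (h n) dg; rewrite scale0r addr0 /q => ->.
  by rewrite mulrCA mulVf// mulr1.
have qr n x : r + 1 <= `|x| -> q n x = 0.
  move=> rx; rewrite /q !fr ?subrr ?mulr0//; first by lra.
  have hv : `|h n *: v| <= 1.
    rewrite normrZ (ger0_norm (ltW (h0 n))) mulr_ile1// ?(ltW (h0 n))//.
    by rewrite invf_le1// ler1n.
  by have := lerB_normD x (h n *: v); lra.
have iq n : mu.-integrable setT (EFin \o q n).
  exact: (bounded_support_integrable (mq n) (qM n) (qr n)).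
have q0 n : (\int[mu]_x (q n x)%:E = 0)%E.
  have int1 : mu.-integrable setT (EFin \o f) by exact: ccfun_integrable.
  have c1 : ccfun (fun x => f (x + h n *: v)).
    split; first by move=> x; exact: (continuous_comp (ctr n x) (cf.1 _)).
    exists [set x : E | `|x| <= r + 1].
      apply: bounded_closed_compact.
        by exists (r + 1); split; [exact: num_real|move=> s rs x /= xr; apply: (le_trans xr (ltW rs))].
      rewrite (_ : [set _ | _] = (Num.norm : E -> R) @^-1` [set s | s <= r + 1])//.
      by apply: closed_comp; [move=> x _; exact: norm_continuous|exact: closed_le].
    move=> x /= /negP; rewrite -ltNge => rx; apply: fr.
    have hv : `|h n *: v| <= 1.
      rewrite normrZ (ger0_norm (ltW (h0 n))) mulr_ile1// ?(ltW (h0 n))//.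
      by rewrite invf_le1// ler1n.
    by have := lerB_normD x (h n *: v); lra.
  have int2 : mu.-integrable setT (EFin \o (fun x => f (x + h n *: v))) by exact: ccfun_integrable.
  rewrite /q; under eq_integral do rewrite EFinM.
  have mm : measurable [set: E] by [].
  rewrite (integralZl mm); last by have := integrableB mm int2 int1.
  under eq_integral do rewrite EFinB.
  rewrite (integralB_EFin mm int2 int1).
  under eq_integral do rewrite addrC.
  rewrite (@integral_translate_signed (h n *: v) (EFin \o f)); last exact/measurable_EFinP.
  by rewrite subee ?mule0//; exact: integrable_fin_num int1.
have dom : mu.-integrable setT (EFin \o (fun x : E => if `|x - 0| < r + 1 then M else 0)).
  apply: (@bounded_support_integrable _ (r + 1) M).
  - apply: measurable_fun_ifT => //; apply: (measurable_fun_bool true).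
    by rewrite setTI (_ : _ @^-1` _ = [set x : E | `|x - 0| < r + 1])//; exact: measurable_ball_rV.
  - by move=> x; case: ifP => _; rewrite ?normr0// ger0_norm.
  - by move=> x rx; rewrite subr0 ltNge rx.
have cv : {ae mu, forall x, [set: E] x -> (q n x)%:E @[n --> \oo] --> (partial f i x)%:E}.
  apply: aeW => x _; apply: cvg_EFin; first by near=> n.
  have /cvgrPdist_lt D : (fun s : R => s^-1 *: ((f \o shift x) (s *: v) - f x)) @ (0 : R)^' --> partial f i x.
    by have := @Ck_derivable _ _ _ _ i x (test_fun_smooth tf 1).
  apply/cvgrPdist_lt => e e0; have := D e e0 => /nbhs_ballP[s /= s0 H].
  have := near_infty_natSinv_lt (PosNum s0); apply: filterS => n /= ns.
  have := H (h n); rewrite /ball/= sub0r normrN ger0_norm ?(ltW (h0 n))// => /(_ ns (hn0 n)).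
  by rewrite [_ *: v + x]addrC.
have [] := @dominated_convergence _ _ _ mu setT measurableT (fun n => EFin \o q n)
  (EFin \o partial f i) _ _ _ cv dom _.
- by move=> n; exact/measurable_EFinP.
- by apply/measurable_EFinP; exact: ccfun_measurable.
- apply: aeW => x n _ /=; rewrite lee_fin subr0; case: ifPn => [_|]; first exact: qM.
  by rewrite -leNgt => /qr ->; rewrite normr0.
- move=> _ _; rewrite [X in X @ _ --> _](_ : _ = cst 0%E); last by apply/funext => n; exact: q0.
  move=> C; have := cvg_lim (@ereal_hausdorff R) C; rewrite lim_cst// => {}C.
  by rewrite /Rintegral -[X in fine X]C.
Unshelve. all: by end_near. Qed.

End test_functions.

(** * Chains of points *)

Section enorm.
Context (R : realType) (d : nat).
Local Notation E := 'rV[R]_d.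
Implicit Types (x y z p q : E).

Lemma enorm_sqr x : enorm x ^+ 2 = enorm2 x.
Proof. by rewrite sqr_sqrtr// enorm2_ge0. Qed.

Lemma enorm_ge0 x : 0 <= enorm x. Proof. exact: sqrtr_ge0. Qed.

Lemma enorm2D x y : enorm2 (x + y) = enorm2 x + 2 * (\sum_(i < d) x ord0 i * y ord0 i) + enorm2 y.
Proof.
rewrite /enorm2 mulr_sumr -!big_split/=; apply: eq_bigr => i _; rewrite mxE; ring.
Qed.

Lemma enormD x y : enorm (x + y) <= enorm x + enorm y.
Proof.
have xy0 : 0 <= enorm x + enorm y by rewrite addr_ge0 ?enorm_ge0.
rewrite -ler_sqr ?nnegrE ?enorm_ge0// sqrrD !enorm_sqr enorm2D.
suff : \sum_(i < d) x ord0 i * y ord0 i <= enorm x * enorm y by lra.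
apply: (le_trans (ler_norm _)).
rewrite -ler_sqr ?nnegrE ?mulr_ge0 ?enorm_ge0// real_normK ?num_real// exprMn !enorm_sqr.
exact: sum_sqr_cauchy.
Qed.

Lemma enormZ (a : R) x : enorm (a *: x) = `|a| * enorm x.
Proof.
rewrite /enorm -sqrtr_sqr -sqrtrM ?sqr_ge0//; congr Num.sqrt.
by rewrite mulr_sumr; apply: eq_bigr => i _; rewrite mxE exprMn.
Qed.

Lemma enormN x : enorm (- x) = enorm x.
Proof. by rewrite -scaleN1r enormZ normrN1 mul1r. Qed.

Lemma enormC x y : enorm (x - y) = enorm (y - x).
Proof. by rewrite -enormN opprB. Qed.

Lemma enorm0 : enorm (0 : E) = 0.
Proof. by rewrite -(scale0r (0 : E)) enormZ normr0 mul0r. Qed.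

Lemma enorm_dist x y z : enorm (x - z) <= enorm (x - y) + enorm (y - z).
Proof. by rewrite -[x - z](subrKA y) enormD. Qed.

Lemma norm_le_enorm x : `|x| <= enorm x.
Proof.
rewrite [leLHS]/Num.Def.normr/= mx_normrE; apply: bigmax_le => [|[i j] _ /=]; first exact: enorm_ge0.
rewrite ord1 -ler_sqr ?nnegrE ?enorm_ge0// real_normK ?num_real// enorm_sqr.
by rewrite /enorm2 (bigD1 j)//= lerDl sumr_ge0// => k _; exact: sqr_ge0.
Qed.

Lemma coord_le_norm x j : `|x ord0 j| <= `|x|.
Proof.
rewrite [leRHS]/Num.Def.normr/= mx_normrE.
exact: (le_bigmax _ (fun ij : 'I_1 * 'I_d => `|x ij.1 ij.2|) (ord0, j)).
Qed.

Lemma enorm_le_norm x : enorm x <= d%:R * `|x|.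
Proof.
rewrite -ler_sqr ?nnegrE ?enorm_ge0 ?mulr_ge0// enorm_sqr.
have : enorm2 x <= \sum_(i < d) `|x| ^+ 2.
  apply: ler_sum => i _; rewrite -real_normK ?num_real// ler_sqr ?nnegrE//.
  exact: coord_le_norm.
rewrite sumr_const card_ord => H; apply: (le_trans H).
rewrite -[leLHS]mulr_natl exprMn ler_wpM2r ?sqr_ge0//.
have [->|d0] := posnP d; first by rewrite expr0n.
by rewrite ler_eXnr// ler1n.
Qed.

Lemma enorm_continuous : continuous (@enorm R d).
Proof.
move=> x; apply/(@cvgrPdist_le _ _ _ (nbhs x) _) => e e0; near=> y.
have H : `|enorm x - enorm y| <= enorm (x - y).
  have := enorm_dist x y 0; have := enorm_dist y x 0.
  rewrite !subr0 (enormC y x) ler_norml; lra.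
apply: (le_trans H); apply: (le_trans (enorm_le_norm _)).
have d1 : 0 < 1 + d%:R :> R by rewrite ltr_pwDl.
apply: (@le_trans _ _ ((1 + d%:R) * `|x - y|)); first by rewrite ler_wpM2r// lerDr.
rewrite -ler_pdivlMl//; near: y.
rewrite -nbhs_nearE; apply/nbhs_ballP; exists ((1 + d%:R)^-1 * e) => /=; first by rewrite mulr_gt0// invr_gt0.
by move=> y; rewrite -ball_normE /ball_/= => /ltW.
Unshelve. all: by end_near. Qed.

Lemma continuous_enormB x : continuous (fun y : E => enorm (y - x)).
Proof.
move=> y; apply: (@continuous_comp _ _ _ (fun y : E => y - x)); last exact: enorm_continuous.
by apply: continuous_fun_add; [move=> ?; exact: cvg_id|exact: cst_continuous].
Qed.

Lemma open_eball x (r : R) : open (eball x r).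
Proof.
rewrite (_ : eball x r = (fun y : E => enorm (y - x)) @^-1` [set s | s < r])//.
by apply: open_comp; [move=> y _; exact: continuous_enormB|exact: open_lt].
Qed.

Lemma enorm_delta (i : 'I_d) : enorm (delta_mx ord0 i : E) = 1.
Proof.
rewrite /enorm (bigD1 i)//= mxE !eqxx/= expr1n big1 ?addr0 ?sqrtr1// => j ji.
by rewrite mxE (negbTE ji) andbF expr0n.
Qed.

Lemma edist_ge (A : set E) x (a : R) : (a%:E <= Defs.edist A x)%E <-> forall y, A y -> a <= enorm (x - y).
Proof.
split=> [H y Ay|H]; last by apply: le_ereal_inf_tmp => _ [y Ay <-]; rewrite lee_fin H.
by rewrite -lee_fin (le_trans H)// ereal_inf_lbound//; exists y.
Qed.

Lemma edist_lt (A : set E) x (a : \bar R) : (Defs.edist A x < a)%E <-> exists2 y, A y & ((enorm (x - y))%:E < a)%E.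
Proof.
split=> [/ereal_inf_lt[_ [y Ay <-]]|[y Ay ya]]; first by exists y.
by apply: le_lt_trans ya; apply: ereal_inf_lbound; exists y.
Qed.

(** The polygon with vertices at the times 0, t and 1 is inscribed in the curve. The end times are
    treated apart because partitions are strictly increasing. *)
Lemma curve_length_ge (g : R -> E) t : t \in `[(0 : R), 1] ->
  ((enorm (g t - g 0))%:E <= curve_length g 0 1)%E.
Proof.
rewrite in_itv/= => /andP[]; rewrite le_eqVlt => /predU1P[<-|t0] t1.
  rewrite subrr enorm0; apply: (@le_trans _ _ (enorm (g 1 - g 0))%:E); first by rewrite lee_fin enorm_ge0.
  apply: ereal_sup_ubound; exists [:: 1] => /=; last by rewrite big_nat1.
  by split => //=; rewrite ltr01.
move: t1; rewrite le_eqVlt => /predU1P[->|t1].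
  apply: ereal_sup_ubound; exists [:: 1] => /=; last by rewrite big_nat1.
  by split => //=; rewrite ltr01.
apply: (@le_trans _ _ (enorm (g t - g 0) + enorm (g 1 - g t))%:E); first by rewrite lee_fin lerDl enorm_ge0.
apply: ereal_sup_ubound.
  exists [:: t; 1] => /=; last by rewrite big_nat_recr//= big_nat1.
  by split => //=; rewrite t0 t1.
Qed.

End enorm.

Section chains.
Context (R : realType) (d : nat).
Local Notation E := 'rV[R]_d.

Let is_chain (G : set E) (sg : R) (m : nat) (p : nat -> E) :=
  (forall i, G (p i)) /\ forall i, (i < m)%N -> enorm (p i.+1 - p i) <= sg.

(** Each edge of the path of cells costs two steps, one inside the current cell and one into the
    next cell; a last step inside the final cell reaches [b]. *)
Let chain_path (T : finType) (G : set E) (cell : E -> T) (sg : R) (e : rel T) :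
  (forall p q, G p -> G q -> cell p = cell q -> enorm (p - q) <= sg) ->
  (forall i j, e i j -> exists p q, [/\ G p, G q, cell p = i, cell q = j & enorm (q - p) <= sg]) ->
  forall (s : seq T) i a b, G a -> G b -> cell a = i -> path e i s -> last i s = cell b ->
  exists p, [/\ is_chain G sg (size s).*2.+1 p, p 0%N = a & p (size s).*2.+1 = b].
Proof.
move=> same He; elim=> [|j s IH] i a b Ga Gb ai /=.
  move=> _ ib; exists (fun k => if k is 0%N then a else b); split => //; split => [[]//|k].
  by rewrite ltnS leqn0 => /eqP ->; apply: same => //; rewrite -ib ai.
move=> /andP[/He[p [q [Gp Gq pi qj pq]]] es] lb.
have [c [[Gc cs] c0 cm]] := IH j q b Gq Gb qj es lb.
exists (fun k => if k is k'.+1 then if k' is k''.+1 then c k'' else p else a); split => //.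
split=> [[|[|k]]//|[|[|k]]] km /=.
- by apply: same => //; rewrite pi ai.
- by rewrite c0.
- by apply: cs; rewrite -ltnS -ltnS.
Qed.

(** The points whose cells are reachable from that of [a] form a subset of [G] that is relatively
    open and closed, hence all of [G]. The number of steps depends only on the number of cells. *)
Lemma connected_chain (T : finType) (G : set E) (cell : E -> T) (sg : R) (a b : E) :
  connected G -> 0 < sg -> G a -> G b ->
  (forall p q, G p -> G q -> cell p = cell q -> enorm (p - q) <= sg) ->
  exists p : nat -> E, [/\ forall i, G (p i), forall i, enorm (p i.+1 - p i) <= sg,
    p 0%N = a & p #|T|.*2 = b].
Proof.
move=> cG sg0 Ga Gb same.
pose e : rel T := fun i j => `[< exists p q, [/\ G p, G q, cell p = i, cell q = j & enorm (q - p) <= sg] >].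
have eE p q : G p -> G q -> enorm (q - p) <= sg -> e (cell p) (cell q).
  by move=> Gp Gq pq; apply/asboolP; exists p, q.
pose A := [set p | G p /\ connect e (cell a) (cell p)].
have AG : A = G.
  apply: cG.
  - by exists a; split => //; exact: connect0.
  - exists (\bigcup_(p in A) eball p sg); first by apply: bigcup_open => p _; exact: open_eball.
    apply/seteqP; split => [p [Gp ap]|q [Gq [p [Gp ap] pq]]].
      by split => //; exists p => //; rewrite /eball/= subrr enorm0.
    by split => //; apply: connect_trans ap (connect1 _); apply: eE => //; exact: ltW.
  - exists (~` \bigcup_(p in G `\` A) eball p sg).
      by apply: open_closedC; apply: bigcup_open => p _; exact: open_eball.
    apply/seteqP; split => [p [Gp ap]|p [Gp np]].
      split => // -[q [Gq nq] qp]; apply: nq; split => //.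
      by apply: connect_trans ap (connect1 _); apply: eE => //; rewrite enormC ltW.
    apply: contrapT => nA; apply: np; exists p => //.
    by rewrite /eball/= subrr enorm0.
have : A b by rewrite AG.
move=> [_ /connectP[s0 es0 ls0]].
(* A path without repeated cells bounds the number of steps by twice the number of cells; afterwards
   the chain rests at [b]. *)
move: ls0; case/shortenP: es0 => s es us _ ls.
have [|p [[Gp ps] p0 pm]] := @chain_path T G cell sg e same _ s (cell a) a b Ga Gb erefl es (esym ls).
  by move=> i j /asboolP.
have sT : ((size s).*2.+1 <= #|T|.*2)%N.
  have := max_card (mem (cell a :: s)); rewrite (card_uniqP us) /= => H.
  by rewrite -(leq_double) doubleS in H; apply: leq_trans H.
exists (fun i => p (minn i (size s).*2.+1)); split.
- by move=> i; exact: Gp.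
- move=> i /=; have [im|im] := ltnP i (size s).*2.+1.
    have -> : minn i.+1 (size s).*2.+1 = i.+1 by apply/minn_idPl.
    exact: ps.
  have -> : minn i.+1 (size s).*2.+1 = (size s).*2.+1 by apply/minn_idPr; exact: leqW.
  by rewrite subrr enorm0 ltW.
- by rewrite min0n.
- by rewrite (minn_idPr sT).
Qed.

(** The cells are cubes of side proportional to [r] in a grid covering the ball of radius [K * r].
    Their number is scale invariant, so one [M] serves for all sets and all scales. *)
Lemma scaled_chain (K kap : R) : (0 < d)%N -> 0 < K -> 0 < kap ->
  exists M : nat, forall (y a b : E) (r : R) (G : set E), 0 < r -> connected G -> G a -> G b ->
    (forall p, G p -> enorm (p - y) <= K * r) ->
    exists p : nat -> E, [/\ forall i, G (p i), forall i, enorm (p i.+1 - p i) <= kap * r,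
      p 0%N = a & p M = b].
Proof.
move=> d0 K0 kap0.
have dR : 0 < d%:R :> R by rewrite ltr0n.
(* The Euclidean norm is at most [d] times the sup norm, so two points of a cell of side tau r are
   at Euclidean distance at most kap r. *)
pose tau := kap / d%:R; have tau0 : 0 < tau by rewrite divr_gt0.
pose n := Num.trunc (2 * K / tau).
pose T : finType := {ffun 'I_d -> 'I_n.+1}.
exists #|T|.*2 => y a b r G r0 cG Ga Gb Gy.
have tr0 : 0 < tau * r by rewrite mulr_gt0.
pose c (p : E) (j : 'I_d) : R := (p ord0 j - y ord0 j + K * r) / (tau * r).
have cb p j : G p -> 0 <= c p j <= 2 * K / tau.
  move=> /Gy Gp; have := le_trans (coord_le_norm _ j) (le_trans (norm_le_enorm _) Gp).
  rewrite !mxE ler_norml => /andP[p1 p2]; rewrite divr_ge0 ?(ltW tr0)//=; last by lra.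
  rewrite ler_pdivrMr// mulrA mulfVK ?gt_eqF//; lra.
pose cell (p : E) : T := [ffun j => inord (Num.trunc (c p j))].
apply: (@connected_chain T G cell) => //; first by rewrite mulr_gt0.
move=> p q Gp Gq /ffunP pq.
apply: (le_trans (enorm_le_norm _)).
suff H : `|p - q| <= tau * r.
  by rewrite (le_trans (ler_wpM2l (ltW dR) H))// /tau mulrA mulrCA mulfV ?mulr1// gt_eqF.
rewrite [leLHS]/Num.Def.normr/= mx_normrE; apply: bigmax_le => [|[i j] _ /=]; first exact: ltW.
rewrite ord1 !mxE; have := pq j; rewrite !ffunE => /(congr1 val) /=.
have /andP[p0 p1] := cb p j Gp; have /andP[q0 q1] := cb q j Gq.
rewrite !inordK ?ltnS ?le_truncn//.
move=> E1; have := truncn_itv p0; have := truncn_itv q0; rewrite E1 => /andP[a1 a2] /andP[b1 b2].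
have -> : p ord0 j - q ord0 j = (c p j - c q j) * (tau * r) by rewrite /c; field; rewrite !gt_eqF.
rewrite normrM (gtr0_norm tr0) ler_piMl ?(ltW tr0)//.
rewrite -natr1 in a2 b2.
rewrite ler_norml; apply/andP; split; lra.
Qed.

End chains.

(** * First exit of a segment from an open set *)

Section first_exit.
Context (R : realType) (d : nat).
Local Notation E := 'rV[R]_d.

Lemma continuous_line (y v : E) : continuous (fun t : R => y + t *: v).
Proof.
apply: continuous_fun_add; first exact: cst_continuous.
exact: scalel_continuous.
Qed.

(** At the infimum [T] of the exit times the point is outside [O]. The half-open segment before it
    is a connected part of [O] containing [y], so the exit point is also a boundary point of the
    component of [y]. *)
Lemma first_exit (O : set E) (y v : E) (L : R) : open O -> O y -> 0 < L -> ~ O (y + L *: v) ->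
  exists T : R, [/\ 0 < T, T <= L, forall t, 0 <= t < T -> O (y + t *: v),
    bd (connected_component O y) (y + T *: v) & bd O (y + T *: v)].
Proof.
move=> oO Oy L0 nOL; have cl := @continuous_line y v.
pose S := [set t : R | 0 <= t <= L /\ ~ O (y + t *: v)].
have S0 : S !=set0 by exists L; split => //; rewrite lexx ltW.
have lbS : lbound S 0 by move=> t [/andP[]].
have hS : has_inf S by split => //; exists 0.
set T := inf S.
have T0 : 0 <= T by apply: lb_le_inf.
have TS t : S t -> T <= t by move=> St; apply: ge_inf => //; exists 0.
have TL : T <= L by apply: TS; split => //; rewrite lexx ltW.
have nOT : ~ O (y + T *: v).
  move=> OT; have nO : nbhs (y + T *: v) O by apply: open_nbhs_nbhs.
  have /nbhs_ballP[r /= r0 rO] := cl T _ nO.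
  have [t St tT] := inf_adherent r0 hS.
  have [_] := St; apply; apply: rO.
  by rewrite /ball/= ltr_distlC; have := TS _ St; rewrite -/T in tT *; move=> ?; apply/andP; split; lra.
have Tp : 0 < T.
  rewrite lt_neqAle T0 andbT; apply/eqP => TT; apply: nOT.
  by rewrite -TT scale0r addr0.
have OT t : 0 <= t < T -> O (y + t *: v).
  move=> /andP[t0 tT]; apply: contrapT => nO.
  have : S t by split => //; rewrite t0 (le_trans (ltW tT)).
  by move=> /TS; rewrite leNgt tT.
have ccT t : 0 <= t < T -> connected_component O y (y + t *: v).
  move=> tT.
  apply: (@connected_component_max _ O [set y + t *: v | t in `[0, T[%classic]).
  - by exists 0; [rewrite /= in_itv/= lexx|rewrite scale0r addr0].
  - by move=> _ [u + <-]; rewrite /= in_itv/=; exact: OT.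
  - apply: connected_continuous_connected; last exact: continuous_subspaceT.
    by apply/connected_intervalP; exact: interval_is_interval.
  - by exists t => //=; rewrite in_itv.
have clT : closure (connected_component O y) (y + T *: v).
  move=> B /(cl T _) /nbhs_ballP[r /= r0 rB].
  pose t := Num.max 0 (T - r / 2).
  have tT : 0 <= t < T.
    by rewrite /t le_max lexx/= gt_max Tp/= ltrBlDr ltrDl divr_gt0.
  exists (y + t *: v); split; first exact: ccT.
  apply: rB; rewrite /ball/=; move: tT => /andP[_ tT]; rewrite gtr0_norm ?subr_gt0//.
  have : T - r / 2 <= t by rewrite /t le_max lexx orbT.
  lra.
exists T; split => //; split => //.
- by move=> /interior_subset /connected_component_sub.
- by move: clT; apply: closureS; exact: connected_component_sub.
- by move=> /interior_subset.
Qed.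

End first_exit.

(** * Line integrals averaged over moving cubes *)

Section tonelli.
Context (R : realType) (d : nat).
Local Notation E := 'rV[R]_d.
Local Notation mu := (lebesgue_rV R d).
Local Notation leb := (@lebesgue_measure R).
Variables (g : E -> R) (mg : measurable_fun [set: E] g) (g0 : forall x, 0 <= g x).
Variables (p v : E) (h k T l : R).
Hypotheses (T0 : 0 < T) (l0 : 0 < l) (lh : forall t, 0 <= t <= T -> l <= h + t * k).

Let z (q : E) (t : R) : E := p + t *: v + (h + t * k) *: q.
Let H (x : E * measurableTypeR R) : \bar R := (\1_(`[0%R, T]%classic : set R) x.2 * g (z x.1 x.2))%:E.

Let mH : measurable_fun setT H.
Proof.
apply/measurable_EFinP; apply: measurable_funM.
  by apply: (measurableT_comp _ measurable_snd); exact: measurable_indic.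
apply: (measurableT_comp mg); apply: measurable_fun_rV => j.
rewrite (_ : (fun x => _) = (fun x : E * measurableTypeR R =>
  p ord0 j + x.2 * v ord0 j + (h + x.2 * k) * x.1 ord0 j)); last first.
  by apply/funext => x; rewrite !mxE.
have m1 : measurable_fun setT (fun x : E * measurableTypeR R => x.1 ord0 j : measurableTypeR R).
  exact: (measurableT_comp (measurable_coord j) measurable_fst).
have m2 : measurable_fun setT (fun x : E * measurableTypeR R => x.2 : measurableTypeR R).
  exact: measurable_snd.
apply: measurable_funD.
  by apply: measurable_funD => //; apply: measurable_funM.
by apply: measurable_funM => //; apply: measurable_funD => //; apply: measurable_funM.
Qed.

Let H0 x : (0 <= H x)%E.
Proof. by rewrite lee_fin mulr_ge0// indicE ler0n. Qed.

Let int_t q : (\int[leb]_t H (q, t) = \int[leb]_(t in `[0%R, T]) (g (z q t))%:E)%E.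
Proof.
rewrite [RHS]integral_mkcond; apply: eq_integral => t _.
rewrite patchE /H /= indicE; case: ifPn => tT; first by rewrite mul1r.
by rewrite mul0r.
Qed.

Lemma measurable_line_integral :
  measurable_fun setT (fun q : E => \int[leb]_(t in `[0%R, T]) (g (p + t *: v + (h + t * k) *: q))%:E)%E.
Proof.
under eq_fun do rewrite -int_t.
exact: (measurable_fun_fubini_tonelli_F H mH H0).
Qed.

(** For fixed [t] the map from [q] to the point is a homothety of ratio at least [l], so the change
    of variables costs at most l^(-d). *)
Lemma tonelli_affine :
  (\int[mu]_q \int[leb]_(t in `[0%R, T]) (g (p + t *: v + (h + t * k) *: q))%:E <=
   (T * l ^- d)%:E * \int[mu]_x (g x)%:E)%E.
Proof.
under eq_integral do rewrite -int_t.
rewrite (fubini_tonelli H)//.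
have I0 : (0 <= \int[mu]_x (g x)%:E)%E by apply: integral_ge0 => x _; rewrite lee_fin.
apply: (@le_trans _ _ (\int[leb]_(t in `[0%R, T]) ((l ^- d)%:E * \int[mu]_x (g x)%:E))%E); last first.
  rewrite integral_cst// EFinM muleC muleA le_eqVlt; apply/orP; left; apply/eqP; congr (_ * _ * _)%E.
  exact: lebesgue_segment.
rewrite [leRHS]integral_mkcond; apply: ge0_le_integral => //.
- by move=> t _; apply: integral_ge0.
- exact: (measurable_fun_fubini_tonelli_G H mH H0).
- by apply/(measurable_restrictT _ _).1 => //; exact: measurable_cst.
- move=> t _; rewrite patchE; case: ifPn => tT; last first.
    by rewrite integral0_eq// => q _; rewrite /H/= indicE (negbTE tT) mul0r.
  rewrite (eq_integral (fun q : E => (g ((p + t *: v) + (h + t * k) *: q))%:E)); last first.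
    by move=> q _; rewrite /H/= indicE tT mul1r.
  have lt : l <= h + t * k by apply: lh; move: tT; rewrite inE/= in_itv.
  have h0 := lt_le_trans l0 lt.
  have mG : measurable_fun [set: E] (EFin \o g) by exact/measurable_EFinP.
  have G0 x : (0 <= (EFin \o g) x)%E by rewrite lee_fin.
  rewrite (integral_affine (p + t *: v) h0 mG G0).
  apply: lee_wpmul2r => //; rewrite lee_fin lef_pV2 ?posrE ?exprn_gt0//.
  by rewrite lerXn2r// nnegrE ltW.
Qed.

End tonelli.

Section step_inequality.
Context (R : realType) (d : nat).
Local Notation E := 'rV[R]_d.
Local Notation mu := (lebesgue_rV R d).
Local Notation leb := (@lebesgue_measure R).

(** Extended by 0 outside [O], so that integrals over cubes and segments can be enlarged freely
    without leaving the energy of [f] on [O]. *)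
Definition grad_sqr_on (O : set E) (f : E -> R) (x : E) : R := \1_O x * enorm2 (grad f x).

Lemma grad_sqr_on_ge0 O f x : 0 <= grad_sqr_on O f x.
Proof. by rewrite mulr_ge0 ?enorm2_ge0// indicE ler0n. Qed.

Lemma measurable_grad_sqr_on O f : measurable O -> Ck 1 f ->
  measurable_fun [set: E] (grad_sqr_on O f).
Proof.
move=> mO Cf; apply: measurable_funM; first exact: measurable_indic.
by apply: continuous_measurable_rV; exact: continuous_grad_sqr.
Qed.

(* The segments joining the corresponding points of two cubes stay in [O]; averaging the line
   inequality over them gives a gradient integral over a neighbourhood. *)
Lemma step_inequality (O : set E) (f : E -> R) (y p p' : E) (rho l h h' C : R) :
  measurable O -> Ck 1 f -> 0 < l -> l <= h -> l <= h' ->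
  (forall t q, 0 <= t <= 1 -> `|q| < 1 ->
     let z := p + t *: (p' - p) + (h + t * (h' - h)) *: q in O z /\ `|z - y| < rho) ->
  (forall q, `|q| < 1 -> enorm2 ((p' - p) + (h' - h) *: q) <= C) ->
  (\int[mu]_(q in [set q | `|q| < 1]%R) ((f (p' + h' *: q) - f (p + h *: q)) ^+ 2)%:E <=
   (C * l ^- d)%:E * \int[mu]_z (\1_[set z | `|z - y| < rho]%R z * grad_sqr_on O f z)%:E)%E.
Proof.
move=> mO Cf l0 lh lh' Hz HC.
pose Q0 : set E := [set q | `|q| < 1].
have mQ0 : measurable Q0.
  by have := measurable_ball_rV (0 : E) 1; rewrite /Q0; under eq_set do rewrite subr0.
pose g z := \1_[set z : E | `|z - y| < rho] z * grad_sqr_on O f z.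
have g0 z : 0 <= g z by rewrite mulr_ge0 ?grad_sqr_on_ge0// indicE ler0n.
have mg : measurable_fun [set: E] g.
  apply: measurable_funM; last exact: measurable_grad_sqr_on.
  by apply: measurable_indic; exact: measurable_ball_rV.
have C0 : 0 <= C.
  by apply: (le_trans (enorm2_ge0 _) (HC 0 _)); rewrite normr0.
have lht t : 0 <= t <= 1 -> l <= h + t * (h' - h).
  move=> /andP[t0 t1]; have -> : h + t * (h' - h) = (1 - t) * h + t * h' by ring.
  have := ler_wpM2l t0 lh'; have t1' : 0 <= 1 - t by rewrite subr_ge0.
  have := ler_wpM2l t1' lh; lra.
have pw q : Q0 q -> (((f (p' + h' *: q) - f (p + h *: q)) ^+ 2)%:E <=
   C%:E * \int[leb]_(t in `[0%R, 1%R]) (g (p + t *: (p' - p) + (h + t * (h' - h)) *: q)%R)%:E)%E.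
  move=> q1.
  have := line_inequality (p + h *: q) ((p' - p) + (h' - h) *: q) ltr01 Cf.
  rewrite scale1r mul1r (_ : p + h *: q + _ = p' + h' *: q); last first.
    by apply/rowP => j; rewrite !mxE; ring.
  move=> H; apply: (le_trans H).
  rewrite [X in (_ * X <= _)%E](_ : _ = \int[leb]_(t in `[0%R, 1%R])
      (g (p + t *: (p' - p) + (h + t * (h' - h)) *: q)%R)%:E)%E.
    apply: lee_wpmul2r; last by rewrite lee_fin; exact: HC.
    by apply: integral_ge0 => t _; rewrite lee_fin.
  apply: eq_integral => t; rewrite inE/= in_itv/= => tT; congr EFin.
  have [Oz zy] := Hz t q tT q1.
  rewrite /g /grad_sqr_on !indicE !mem_set//= !mul1r; congr (enorm2 (grad f _)).
  by apply/rowP => j; rewrite !mxE; ring.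
have IQ : (\int[mu]_(q in Q0) ((f (p' + h' *: q) - f (p + h *: q)) ^+ 2)%:E <=
  \int[mu]_(q in Q0) (C%:E * \int[leb]_(t in `[0%R, 1%R]) (g (p + t *: (p' - p) + (h + t * (h' - h)) *: q)%R)%:E))%E.
  have mf : measurable_fun [set: E] f by apply: continuous_measurable_rV; exact: Ck_continuous Cf.
  apply: ge0_le_integral => //.
  - by move=> q _; rewrite lee_fin sqr_ge0.
  - apply/measurable_EFinP; apply: measurable_funTS; apply: measurable_funX; apply: measurable_funB.
      by apply: (measurableT_comp mf); exact: measurable_affine.
    by apply: (measurableT_comp mf); exact: measurable_affine.
  - apply: measurable_funTS; apply: measurable_funeM.
    exact: (measurable_line_integral mg g0).
apply: (le_trans IQ).
apply: (@le_trans _ _ (\int[mu]_q (C%:E *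
    \int[leb]_(t in `[0%R, 1%R]) (g (p + t *: (p' - p) + (h + t * (h' - h)) *: q)%R)%:E))%E).
  apply: ge0_subset_integral => //.
  - by apply: measurable_funeM; exact: (measurable_line_integral mg g0).
  - by move=> q _; apply: mule_ge0; [rewrite lee_fin|apply: integral_ge0 => t _; rewrite lee_fin].
rewrite ge0_integralZl//; last 2 first.
- exact: (measurable_line_integral mg g0).
- by move=> q _; apply: integral_ge0 => t _; rewrite lee_fin.
rewrite EFinM -muleA; apply: lee_wpmul2l; first by rewrite lee_fin.
have := tonelli_affine mg g0 p (p' - p) ltr01 l0 lht.
by rewrite mul1r.
Qed.

(** Along the segment [f] vanishes at the first exit point from [O], which is in [D] or outside the
    ball, or at the far end of the segment if it stays in [O]. The line inequality is applied up to
    that point. *)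
Lemma friedrichs_point (O D : set E) (f : E -> R) (x y : E) (s L : R) (i : 'I_d) :
  open O -> test_fun (eball x s `\` D) f -> O y -> 0 < L ->
  ~ eball x s (y + L *: delta_mx ord0 i) ->
  (forall p, bd (connected_component O y) p -> bd O p -> eball x s p -> D p) ->
  ((f y ^+ 2)%:E <= L%:E *
   \int[leb]_(t in `[0%R, L]) (grad_sqr_on O f (y + t *: delta_mx ord0 i))%:E)%E.
Proof.
move=> oO tf Oy L0 exL bdD; set e : E := delta_mx ord0 i in exL *.
have Cf : Ck 1 f := test_fun_smooth tf 1.
have fout p : ~ (eball x s `\` D) p -> f p = 0.
  by move=> np; apply: supp_out => /(test_fun_supp tf).
have [T [T0 TL fT OT]] : exists T : R, [/\ 0 < T, T <= L, f (y + T *: e) = 0 &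
    forall t, 0 <= t < T -> O (y + t *: e)].
  have [OL|/existsNP[t1 /not_implyP[/andP[t10 t1L] nO1]]] := pselect (forall t, 0 <= t <= L -> O (y + t *: e)).
    exists L; split => //; first by apply: fout => -[].
    by move=> t /andP[t0 tL]; apply: OL; rewrite t0 ltW.
  have t1p : 0 < t1.
    rewrite lt_neqAle t10 andbT; apply/eqP => t1E; apply: nO1.
    by rewrite -t1E scale0r addr0.
  have [T [T0 Tt OT bdcT bdT]] := first_exit oO Oy t1p nO1.
  exists T; split => //; first exact: le_trans t1L.
  by apply: fout => -[xp nD]; apply: nD; exact: bdD.
have := line_inequality y e T0 Cf.
rewrite fT sub0r sqrrN -enorm_sqr enorm_delta expr1n mulr1 => H; apply: (le_trans H).
have mline := measurable_line y e.
have gm : measurable_fun [set: measurableTypeR R] (fun t => (enorm2 (grad f (y + t *: e)))%:E : \bar R).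
  apply/measurable_EFinP.
  exact: (measurableT_comp (continuous_measurable_rV (continuous_grad_sqr Cf)) mline).
have gm' : measurable_fun [set: measurableTypeR R] (fun t => (grad_sqr_on O f (y + t *: e))%:E : \bar R).
  apply/measurable_EFinP.
  exact: (measurableT_comp (measurable_grad_sqr_on (open_measurable_rV oO) Cf) mline).
(* At time [T] the point may be outside [O], where [grad_sqr_on] is 0; the half-open interval avoids
   it. *)
rewrite -(@integral_itv_bndo_bndc R (BLeft 0) T); last exact: measurable_funTS.
apply: lee_pmul => //.
- by rewrite lee_fin ltW.
- by apply: integral_ge0 => t _; rewrite lee_fin enorm2_ge0.
apply: (@le_trans _ _ (\int[leb]_(t in `[0%R, T[) (grad_sqr_on O f (y + t *: e))%:E)%E).
  rewrite le_eqVlt; apply/orP; left; apply/eqP; apply: eq_integral => t.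
  rewrite inE/= in_itv/= => tT; rewrite /grad_sqr_on indicE mem_set ?mul1r//; exact: OT.
apply: ge0_subset_integral => //.
- exact: measurable_funTS.
- by move=> t _; rewrite lee_fin grad_sqr_on_ge0.
- by move=> t /=; rewrite !in_itv/= => /andP[-> /ltW tT]; rewrite (le_trans tT).
Qed.

End step_inequality.

(** * Local uniformity *)

Section access.
Context (R : realType) (d : nat).
Local Notation E := 'rV[R]_d.
Implicit Types (O D B : set E).

Lemma joined_by_cigarS O B B' (eps : R) x y : B' `<=` B ->
  joined_by_cigar O B eps x y -> joined_by_cigar O B' eps x y.
Proof.
move=> BB [g [cg g0 g1 lg Hg]]; exists g; split => // t t01.
have [Og eg] := Hg t t01; split => //; move/edist_ge in eg; apply/edist_ge => z /BB; exact: eg.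
Qed.

(** The conditions pass to any smaller thickness, so an infinite one may be replaced by 1. Shrinking
    it also shrinks the part of the boundary from which cigars keep their distance. *)
Lemma uniform_real O D : uniform_near_neumann O D -> exists eps dl C : R,
  [/\ 0 < eps <= 1, 0 < dl, 0 < C,
    forall x y, O x -> O y -> ethick (neumann O D) dl%:E x -> ethick (neumann O D) dl%:E y ->
      0 < enorm (x - y) -> enorm (x - y) < dl ->
      joined_by_cigar O (bd O `&` ethick (neumann O D) dl%:E) eps x y &
    forall z, O z -> bd (connected_component O z) `&` neumann O D !=set0 ->
      ((C * dl)%:E <= ediam (connected_component O z))%E].
Proof.
move=> [eps [delta [C [eps01 delta0 C0 cig dia]]]].
have [dl [dl0 dld]] : exists dl : R, 0 < dl /\ (dl%:E <= delta)%E.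
  case: delta delta0 {cig dia} => [dl||]//; first by rewrite lte_fin => dl0; exists dl.
  by exists 1; rewrite leey.
exists eps, dl, C; split => //.
- move=> x y Ox Oy Nx Ny xy xyd.
  have thS z : ethick (neumann O D) dl%:E z -> ethick (neumann O D) delta z.
    by move=> zd; apply: lt_le_trans dld.
  apply: (@joined_by_cigarS _ (bd O `&` ethick (neumann O D) delta)).
    by move=> z [bz /thS].
  apply: cig => //; [by split => //; exact: thS|by split => //; exact: thS|].
  by apply: lt_le_trans dld; rewrite lte_fin.
- move=> z Oz bz; apply: le_trans (dia z Oz bz).
  by rewrite EFinM lee_wpmul2l// lee_fin ltW.
Qed.

(** The factor 3 puts a point at distance [scale s 0] from [y] at distance at least 2 s from [x],
    when [y] is in the ball of radius [s] about [x]. *)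
Definition scale (s : R) (k : nat) : R := 3 * s / 2 ^+ k.

Lemma scale_gt0 s k : 0 < s -> 0 < scale s k.
Proof. by move=> s0; rewrite divr_gt0 ?exprn_gt0// mulr_gt0. Qed.

Lemma scaleS s k : scale s k = 2 * scale s k.+1.
Proof. by rewrite /scale exprS; field; rewrite expf_neq0. Qed.

Lemma scale_le s k : 0 < s -> scale s k <= 3 * s.
Proof.
move=> s0; rewrite /scale ler_pdivrMr ?exprn_gt0//.
rewrite ler_peMr ?exprn_ege1 ?ler1n//; lra.
Qed.

(* the vertices [P k i], [i <= M], link the scales [scale s k] and [scale s k.+1] *)
Definition access O (x y : E) (s kap K : R) (M : nat) := exists P : nat -> nat -> E,
  [/\ forall k, P k M = P k.+1 0%N,
    forall k i, eball (P k i) (kap * scale s k) `<=` O,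
    forall k i, enorm (P k i - y) <= K * scale s k,
    forall k i, enorm (P k i.+1 - P k i) <= kap / 2 * scale s k &
    2 * s <= enorm (P 0%N 0%N - x)].

Lemma connected_enorm_ivt (A : set E) (c y z : E) (r : R) : connected A -> A y -> A z ->
  enorm (y - c) <= r <= enorm (z - c) -> exists2 p, A p & enorm (p - c) = r.
Proof.
move=> cA Ay Az rr.
have cf := @continuous_enormB R d c.
have : connected ((fun p : E => enorm (p - c)) @` A).
  by apply: connected_continuous_connected => //; exact: continuous_subspaceT.
move=> /connected_intervalP I.
have [p Ap pr] : ((fun p : E => enorm (p - c)) @` A) r.
  by apply: (I _ _ (imageP _ Ay) (imageP _ Az)).
by exists p.
Qed.

Lemma connected_curve (g : R -> E) : {within `[0, 1], continuous g} -> connected (g @` `[0, 1]%classic).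
Proof.
move=> cg; apply: connected_continuous_connected => //.
by apply/connected_intervalP; exact: interval_is_interval.
Qed.

End access.

Section access_uniform.
Context (R : realType) (d : nat).
Local Notation E := 'rV[R]_d.
Implicit Types (O D B : set E).

(** A cigar from [y] to a distant point of its component only provides one base point [p k] at each
    scale: between two of them it may wander far away, and its pieces cannot be covered by a bounded
    number of cells. Consecutive base points are therefore joined by new cigars, whose length and
    clearance are comparable to the current scale, and these are discretized by [scaled_chain]. *)
Lemma access_of_uniform O D : (0 < d)%N -> open O -> uniform_near_neumann O D ->
  exists R0 kap K : R, exists M : nat, [/\ 0 < R0, 0 < kap <= 1, 0 < K &
    forall x s, 0 < s <= R0 -> neumann O D `&` eball x s !=set0 ->
    forall y, O y -> eball x s y -> bd (connected_component O y) `&` neumann O D !=set0 ->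
    access O x y s kap K M].
Proof.
move=> d0 oO /uniform_real[eps [dl [C [/andP[eps0 eps1] dl0 C0 cig dia]]]].
set N := neumann O D in cig dia *.
(* With r = [scale s k.+1], the new cigars turn out to have clearance at least eps^2 r / 16 away
   from their ends and length at most 3 r / eps. Here kap (2 r) is half of that clearance, and K (2
   r) bounds the distance to [y]. *)
pose kap := eps ^+ 2 / 64; pose K := 3 / eps.
have kap0 : 0 < kap by rewrite /kap divr_gt0// exprn_gt0.
have e2 : eps ^+ 2 <= eps by rewrite expr2 ler_piMl// ltW.
have K0 : 0 < K by rewrite divr_gt0.
have kap20 : 0 < kap / 2 by rewrite divr_gt0.
have [M HM] := scaled_chain d0 K0 kap20.
(* The first bound keeps every point considered, at distance at most 40 s / eps from [x], in the
   neighbourhood of N; the second one makes the diameter of the component exceed 12 s. *)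
pose R0 := Num.min (dl * eps / 200) (C * dl / 20).
exists R0, kap, K, M; split => //.
- by rewrite /R0 lt_min !divr_gt0// mulr_gt0.
- by rewrite kap0/= /kap; move: e2 eps1; clear; lra.
move=> x s /andP[s0]; rewrite /R0 le_min => /andP[sR1 sR2] [n0 [Nn0 n0s]] y Oy ys bdy.
have ie : 1 <= eps^-1 by rewrite invf_ge1.
have ie0 : 0 < eps^-1 by rewrite invr_gt0.
have seps : s / eps <= dl / 200 by rewrite ler_pdivrMr//; move: sR1; clear; lra.
have sse : s <= s / eps by rewrite ler_peMr// ltW.
have near p : enorm (p - x) <= 40 * (s / eps) -> ethick N dl%:E p.
  move=> px; apply/edist_lt; exists n0 => //; rewrite lte_fin.
  have := enorm_dist p x n0; rewrite (enormC x n0); move: n0s px seps sse dl0; rewrite /eball/=; clear; lra.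
(* Cigars keep their distance only from the part of the boundary near N. This controls the whole
   boundary, since a segment of length less than [a] leaving [O] from [p] does so at a point still
   near N. *)
have inO p a : O p -> enorm (p - x) <= 30 * (s / eps) -> a <= s ->
    (a%:E <= Defs.edist (bd O `&` ethick N dl%:E) p)%E -> eball p a `<=` O.
  move=> Op px as_ /edist_ge Ha q qp; apply: contrapT => nOq.
  have nO1 : ~ O (p + 1 *: (q - p)) by rewrite scale1r addrC subrK.
  have [T [T0 T1 _ _ bT]] := first_exit oO Op ltr01 nO1.
  have Tqp : enorm (p - (p + T *: (q - p))) < a.
    rewrite opprD addrA subrr add0r enormN enormZ gtr0_norm//.
    by apply: le_lt_trans qp; rewrite ler_piMl// enorm_ge0.
  have : a <= enorm (p - (p + T *: (q - p))).
    apply: Ha; split => //; apply: near.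
    have := enorm_dist (p + T *: (q - p)) p x; rewrite (enormC _ p); move: Tqp px as_ sse s0; clear; lra.
  by rewrite leNgt Tqp.
(* The component is too large for the ball of radius 6 s about [x], so by connectedness it meets the
   sphere. *)
have [z ccz zx] : exists2 z, connected_component O y z & enorm (z - x) = 6 * s.
  have [z0 cz0 z0x] : exists2 z, connected_component O y z & 6 * s <= enorm (z - x).
    apply: contrapT => nz.
    have /(le_trans (dia y Oy bdy)) : (ediam (connected_component O y) <= (12 * s)%:E)%E.
      apply: ge_ereal_sup => _ [a ca [b cb <-]]; rewrite lee_fin.
      have ha : enorm (a - x) < 6 * s by rewrite ltNge; apply/negP => H; apply: nz; exists a.
      have hb : enorm (b - x) < 6 * s by rewrite ltNge; apply/negP => H; apply: nz; exists b.
      have := enorm_dist a x b; rewrite (enormC x b); move: ha hb; clear; lra.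
    by rewrite lee_fin; have := mulr_gt0 C0 dl0; move: sR2; clear; lra.
  apply: (@connected_enorm_ivt _ _ _ x y z0).
  - exact: component_connected.
  - exact: connected_component_refl.
  - exact: cz0.
  - by rewrite z0x andbT; move: ys s0; rewrite /eball/=; clear; lra.
have Oz : O z by exact: connected_component_sub ccz.
have yx : enorm (y - x) < s by exact: ys.
have yz1 : 5 * s <= enorm (y - z).
  by have := enorm_dist z y x; rewrite (enormC z y); move: zx yx; clear; lra.
have yz2 : enorm (y - z) <= 7 * s.
  by have := enorm_dist y x z; rewrite (enormC x z); move: zx yx; clear; lra.
have [g [cg g0 g1 _ Hg]] : joined_by_cigar O (bd O `&` ethick N dl%:E) eps y z.
  apply: cig => //.
  - by apply: near; move: yx sse s0; clear; lra.
  - by apply: near; move: zx sse s0; clear; lra.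
  - by move: yz1 s0; clear; lra.
  - by move: yz2 sse seps dl0; clear; lra.
have in01 (a : R) : a \in `[0, 1] -> `[0, 1]%classic a by [].
have r_le k : scale s k <= 3 * s := scale_le k s0.
have r_gt0 k : 0 < scale s k := scale_gt0 k s0.
(* The curve crosses the sphere of radius [scale s k] about [y]. There it is at distance at least 2
   s from [z], while [y] and [z] are at distance at most 7 s; the clearance is then at least 2/7 of
   eps times the scale. *)
have : forall k, exists p, [/\ O p, enorm (p - y) = scale s k & eball p (eps / 4 * scale s k) `<=` O].
  move=> k; have rk := r_le k; have rk0 := r_gt0 k.
  have [_ [t t01 <-] tr] : exists2 p, (g @` `[0, 1]%classic) p & enorm (p - y) = scale s k.
    apply: (@connected_enorm_ivt _ _ _ y y z).
    - exact: connected_curve.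
    - by exists 0 => //; rewrite /= in_itv/= lexx ler01.
    - by exists 1 => //; rewrite /= in_itv/= ler01 lexx.
    - by rewrite subrr enorm0 (enormC z); apply/andP; split; move: rk0 rk yz1 s0; clear; lra.
  have [Og eg] := Hg t t01; exists (g t); split => //.
  apply: inO => //.
  - by have := enorm_dist (g t) y x; rewrite tr; move: rk yx sse s0; clear; lra.
  - have : eps / 4 * scale s k <= 1 / 4 * scale s k by rewrite ler_wpM2r// ?(ltW rk0)//; move: eps1; clear; lra.
    by move: rk s0; clear; lra.
  - apply: le_trans eg; rewrite lee_fin tr.
    rewrite ler_pdivlMr; last by move: yz1 s0; clear; lra.
    have gz : 2 * s <= enorm (g t - z).
      by have := enorm_dist y (g t) z; rewrite (enormC y (g t)) tr; move: rk yz1; clear; lra.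
    have er0 : 0 < eps * scale s k by rewrite mulr_gt0.
    have := ler_wpM2l (ltW er0) gz; have := ler_wpM2l (ltW er0) yz2; have := mulr_gt0 er0 s0; clear; lra.
move=> /choice[p Hp].
have : forall k, exists c : nat -> E, [/\ forall i, eball (c i) (kap * scale s k) `<=` O,
    forall i, enorm (c i - y) <= K * scale s k,
    forall i, enorm (c i.+1 - c i) <= kap / 2 * scale s k, c 0%N = p k & c M = p k.+1].
  move=> k; have [Op py Bp] := Hp k; have [Op' py' Bp'] := Hp k.+1.
  set r := scale s k.+1 in py' Bp' *.
  have r0 : 0 < r := r_gt0 k.+1.
  have rE : scale s k = 2 * r by exact: scaleS.
  have rs : 2 * r <= 3 * s by rewrite -rE; exact: r_le.
  rewrite rE in py Bp *.
  have D1 : r <= enorm (p k - p k.+1).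
    by have := enorm_dist (p k) (p k.+1) y; move: py py'; clear; lra.
  have D2 : enorm (p k - p k.+1) <= 3 * r.
    by have := enorm_dist (p k) y (p k.+1); rewrite (enormC y (p k.+1)); move: py py'; clear; lra.
  have px : enorm (p k - x) <= 4 * s by have := enorm_dist (p k) y x; move: py rs yx; clear; lra.
  have px' : enorm (p k.+1 - x) <= 4 * s by have := enorm_dist (p k.+1) y x; move: py' r0 rs yx; clear; lra.
  have [h [ch h0 h1 lh Hh]] : joined_by_cigar O (bd O `&` ethick N dl%:E) eps (p k) (p k.+1).
    apply: cig => //.
    - by apply: near; move: px sse s0; clear; lra.
    - by apply: near; move: px' sse s0; clear; lra.
    - by move: D1 r0; clear; lra.
    - by move: D2 rs sse seps dl0; clear; lra.
  set Dk := enorm (p k - p k.+1) in D1 D2 lh Hh.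
  have Dk0 : 0 < Dk by move: D1 r0; clear; lra.
  have re0 : 0 < r / eps by rewrite divr_gt0.
  have rre : r <= r / eps by rewrite ler_peMr// ltW.
  have hp t : t \in `[(0 : R), 1] -> enorm (h t - p k) <= 3 * (r / eps).
    move=> t01; have := le_trans (curve_length_ge h t01) lh; rewrite h0 lee_fin => H.
    by apply: (le_trans H); rewrite mulrA ler_wpM2r// ltW.
  pose G := h @` `[0, 1]%classic.
  have Gy q : G q -> enorm (q - y) <= K * (2 * r).
    move=> [t t01 <-]; have := hp t t01; have := enorm_dist (h t) (p k) y.
    have -> : K * (2 * r) = 6 * (r / eps) by rewrite /K; ring.
    by move: py rre re0; clear; lra.
  have er0 : 0 < eps * r by rewrite mulr_gt0.
  have e2r : eps ^+ 2 * r <= eps * r by rewrite ler_wpM2r// ltW.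
  have GO q0 : G q0 -> eball q0 (kap * (2 * r)) `<=` O.
    move=> [t t01 <-]; have [Oh eh] := Hh t t01.
    have kE : kap * (2 * r) = eps ^+ 2 * r / 32 by rewrite /kap; field.
    have e4E : eps / 4 * (2 * r) = eps * r / 2 by field.
    (* The clearance of a cigar degenerates at its ends, where the balls around the base points take
       over. *)
    have [u1|u1] := lerP (enorm (h t - p k)) (eps * r / 8).
      move=> q hq; apply: Bp; rewrite /eball/= e4E; move: hq; rewrite /eball/= kE.
      by have := enorm_dist q (h t) (p k); move: u1 e2r er0; clear; lra.
    have [w1|w1] := lerP (enorm (h t - p k.+1)) (eps * r / 8).
      move=> q hq; apply: Bp'; rewrite /eball/=; move: hq; rewrite /eball/= kE.
      by have := enorm_dist q (h t) (p k.+1); move: w1 e2r er0; clear; lra.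
    apply: (@subset_trans _ (eball (h t) (eps ^+ 2 * r / 16))).
      move=> q; rewrite /eball/= kE => /lt_le_trans; apply.
      by have : 0 < eps ^+ 2 * r by [rewrite mulr_gt0// exprn_gt0]; clear; lra.
    apply: inO => //.
    - by have := hp t t01; have := enorm_dist (h t) (p k) x;
        have : r / eps <= 3 / 2 * (s / eps) by [rewrite mulrA ler_wpM2r ?(ltW ie0)//; move: rs; clear; lra];
        move: px sse s0; clear; lra.
    - by have : eps * r <= 1 * r by [rewrite ler_wpM2r ?(ltW r0)]; move: e2r rs s0 r0; clear; lra.
    apply: le_trans eh; rewrite lee_fin ler_pdivlMr//.
    have uw : Dk <= enorm (h t - p k) + enorm (h t - p k.+1).
      by have := enorm_dist (p k) (h t) (p k.+1); rewrite (enormC (p k) (h t)).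
    rewrite -/Dk in uw *.
    suff : eps * r / 8 * (Dk / 2) <= enorm (h t - p k) * enorm (h t - p k.+1).
      move=> H; have := ler_wpM2l (ltW eps0) H.
      by move: H er0; clear; lra.
    have Dk2 : 0 <= Dk / 2 by move: Dk0; clear; lra.
    have er8 : 0 <= eps * r / 8 by move: er0; clear; lra.
    have [ul|ul] := lerP (Dk / 2) (enorm (h t - p k)).
      rewrite mulrC; apply: ler_pM => //; exact: ltW.
    by apply: ler_pM => //; [exact: ltW|move: uw ul; clear; lra].
  have Gp : G (p k) by exists 0 => //; rewrite /= in_itv/= lexx ler01.
  have Gp' : G (p k.+1) by exists 1 => //; rewrite /= in_itv/= ler01 lexx.
  have [c [Gc cs c0 cM]] := HM y (p k) (p k.+1) (2 * r) G (mulr_gt0 (ltr0n R 2) r0)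
    (connected_curve ch) Gp Gp' Gy.
  by exists c; split => // i; [exact: GO|exact: Gy].
move=> /choice[P HP]; exists P; split.
- by move=> k; have [_ _ _ _ ->] := HP k; have [_ _ _ -> _] := HP k.+1.
- by move=> k i; have [H _ _ _ _] := HP k; exact: H.
- by move=> k i; have [_ H _ _ _] := HP k; exact: H.
- by move=> k i; have [_ _ H _ _] := HP k; exact: H.
- have [_ _ _ -> _] := HP 0%N; have [_ py _] := Hp 0%N.
  have r0E : scale s 0 = 3 * s by rewrite /scale expr0 divr1.
  have := enorm_dist (p 0%N) x y; rewrite (enormC x y); move: py r0E yx; clear; lra.
Qed.

End access_uniform.

(** * The Poincaré inequality *)

Section poincare.
Context (R : realType) (d : nat).
Local Notation E := 'rV[R]_d.
Local Notation mu := (lebesgue_rV R d).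
Local Notation leb := (@lebesgue_measure R).

(** By Tonelli's theorem each point [z] is counted with the volume of the cube of centres [y] whose
    cube contains it. *)
Lemma integral_local_average (g : E -> R) (rho : R) : measurable_fun [set: E] g ->
  (forall x, 0 <= g x) -> 0 < rho ->
  measurable_fun [set: E] (fun y => \int[mu]_z (\1_[set z | `|z - y| < rho]%R z * g z)%:E)%E /\
  (\int[mu]_y \int[mu]_z (\1_[set z | `|z - y| < rho]%R z * g z)%:E =
   ((2 * rho) ^+ d)%:E * \int[mu]_x (g x)%:E)%E.
Proof.
move=> mg g0 rho0.
pose H (x : E * E) : \bar R := (\1_[set w : E | `|w - 0| < rho] (x.2 - x.1) * g x.2)%:E.
have HE y z : H (y, z) = (\1_[set z : E | `|z - y| < rho] z * g z)%:E.
  by rewrite /H/= !indicE; congr ((nat_of_bool _)%:R * _)%:E; apply/idP/idP; rewrite !inE/= subr0.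
have mH : measurable_fun setT H.
  apply/measurable_EFinP; apply: measurable_funM; last exact: (measurableT_comp mg measurable_snd).
  have m1 : measurable_fun setT (fun x : E * E => x.2 - x.1).
    apply: measurable_fun_rV => j; under eq_fun do rewrite !mxE.
    apply: measurable_funB.
      exact: (measurableT_comp (measurable_coord j) measurable_snd).
    exact: (measurableT_comp (measurable_coord j) measurable_fst).
  have mI : measurable_fun [set: E] (\1_[set w : E | `|w - 0| < rho] : E -> R).
    by apply: measurable_indic; exact: measurable_ball_rV.
  exact: (measurableT_comp mI m1).
have H0 x : (0 <= H x)%E by rewrite lee_fin mulr_ge0// indicE ler0n.
have FE : (fun y => \int[mu]_z (\1_[set z : E | `|z - y| < rho]%R z * g z)%:E)%E =
    (fun y => \int[mu]_z H (y, z))%E.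
  by apply/funext => y; apply: eq_integral => z _; rewrite HE.
split; first by rewrite FE; exact: (measurable_fun_fubini_tonelli_F H mH H0).
rewrite FE (fubini_tonelli H mH H0).
have mG : measurable_fun [set: E] (EFin \o g) by exact/measurable_EFinP.
have G0 x : [set: E] x -> (0 <= (g x)%:E)%E by rewrite lee_fin.
have K0 : (0 <= ((2 * rho) ^+ d)%:E)%E.
  by rewrite lee_fin; apply: exprn_ge0; apply: mulr_ge0; [exact: ler0n|exact: ltW].
transitivity (\int[mu]_x (((2 * rho) ^+ d)%:E * (g x)%:E))%E; last first.
  exact: ge0_integralZl.
apply: eq_integral => z _.
transitivity (\int[mu]_y ((g z)%:E * (\1_[set y : E | `|y - z| < rho] y)%:E))%E.
  apply: eq_integral => y _; rewrite HE -EFinM mulrC; congr (_ * _)%:E; rewrite !indicE.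
  by congr ((nat_of_bool _)%:R); apply/idP/idP; rewrite !inE/= distrC.
have mB := measurable_ball_rV z rho.
have mI : measurable_fun [set: E] (fun y : E => (\1_[set y : E | `|y - z| < rho] y : R)%:E).
  by apply/measurable_EFinP; exact: measurable_indic.
have I0 x : [set: E] x -> (0 <= (\1_[set y : E | `|y - z| < rho] x : R)%:E)%E.
  by rewrite lee_fin indicE ler0n.
have gz : (0 <= (g z)%:E)%E by rewrite lee_fin.
transitivity ((g z)%:E * \int[mu]_y (\1_[set y : E | `|y - z| < rho] y)%:E)%E.
  exact: ge0_integralZl.
rewrite (integral_indic mu measurableT mB) setIT muleC; congr (_ * _)%E.
exact: lebesgue_ball.
Qed.

(** The bound [G2] depends on [f]; it only serves to make the remainder of a telescoping sum tend to
    0. *)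
Lemma lipschitz_test (f : E -> R) (G2 : R) a b : Ck 1 f ->
  (forall z, enorm2 (grad f z) <= G2) -> (f b - f a) ^+ 2 <= G2 * enorm2 (b - a).
Proof.
move=> Cf HG; have := line_inequality a (b - a) ltr01 Cf.
rewrite scale1r [a + _]addrC subrK mul1r => H.
have : (((f b - f a) ^+ 2)%:E <= (enorm2 (b - a))%:E * G2%:E)%E.
  apply: (le_trans H); apply: lee_wpmul2l; first by rewrite lee_fin enorm2_ge0.
  apply: (@le_trans _ _ (\int[leb]_(t in `[0%R, 1%R]) (cst G2%:E t))%E).
    apply: ge0_le_integral => //.
    - by move=> t _; rewrite lee_fin enorm2_ge0.
    - apply: measurable_funTS; apply/measurable_EFinP.
      exact: (measurableT_comp (continuous_measurable_rV (continuous_grad_sqr Cf)) (measurable_line _ _)).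
    - by move=> t _; rewrite lee_fin.
  rewrite integral_cst// [X in (_ * X)%E](_ : _ = 1%E) ?mule1//.
  exact: lebesgue_segment.
by rewrite -EFinM lee_fin mulrC.
Qed.

Lemma sum_sqr_le (n : nat) (a : nat -> R) :
  (\sum_(k < n) a k) ^+ 2 <= n%:R * \sum_(k < n) a k ^+ 2.
Proof.
have := @sum_sqr_cauchy R n (fun k => a k) (fun _ => 1).
rewrite [X in _ * X](eq_bigr (fun _ => 1)); last by move=> *; rewrite expr1n.
rewrite sumr_const card_ord mulrC => H; apply: le_trans H.
by rewrite le_eqVlt; apply/orP; left; apply/eqP; congr (_ ^+ 2); apply: eq_bigr => i _; rewrite mulr1.
Qed.

Lemma telescope_sqr (n : nat) (a : nat -> R) :
  (a n - a 0%N) ^+ 2 <= n%:R * \sum_(k < n) (a k.+1 - a k) ^+ 2.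
Proof.
apply: le_trans (sum_sqr_le n (fun k => a k.+1 - a k)).
by rewrite -(big_mkord xpredT (fun k => a k.+1 - a k)) telescope_sumr.
Qed.
End poincare.

(** * Telescoping along a chain of cubes *)

Section access_bound.
Context (R : realType) (d : nat).
Local Notation E := 'rV[R]_d.
Local Notation mu := (lebesgue_rV R d).

Lemma lebesgue_unit_ball : measurable [set q : E | `|q| < 1] /\ mu [set q : E | `|q| < 1] = (2 ^+ d)%:E.
Proof.
have EQ : [set q : E | `|q| < 1] = [set q : E | `|q - 0| < 1].
  by apply/seteqP; split => q /=; rewrite subr0.
split; first by rewrite EQ; exact: measurable_ball_rV.
by rewrite EQ; have := lebesgue_ball (0 : E) (ltr01 : 0 < (1 : R)); rewrite mulr1.
Qed.

Lemma enormZ_le (a : R) (q : E) : 0 <= a -> `|q| < 1 -> enorm (a *: q) <= a * d%:R.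
Proof.
move=> a0 q1; rewrite enormZ ger0_norm// ler_wpM2l//.
by apply: (le_trans (enorm_le_norm _)); rewrite ler_piMr// ltW.
Qed.

(** The factor 4 * 2^k comes from separating the remainder and from [sum_sqr_geometric]. One factor
    M + 1 is Cauchy-Schwarz over the links of a scale, and the other counts these links. The rest is
    the bound of [step_inequality] for one link. *)
Definition access_coef (s kap : R) (M k : nat) : R :=
  4 * 2 ^+ k * M.+1%:R ^+ 2 * scale s k ^+ 2 * (kap * scale s k.+1 / (4 * d%:R)) ^- d.

Variables (O : set E) (f : E -> R) (x y : E) (s kap K G2 : R) (M : nat).
Hypotheses (d0 : (0 < d)%N) (mO : measurable O) (s0 : 0 < s) (kap0 : 0 < kap) (kap1 : kap <= 1).
Hypotheses (K0 : 0 < K) (Cf : Ck 1 f) (HG : forall z, enorm2 (grad f z) <= G2).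
Hypothesis f0 : forall z, ~ eball x s z -> f z = 0.

Let J (k : nat) : \bar R :=
  (\int[mu]_z (\1_[set z | `|z - y| < (K + 1) * scale s k]%R z * grad_sqr_on O f z)%:E)%E.

(** Half the side of the cubes at scale [k]: their Euclidean radius is at most a quarter of the
    clearance kap * [scale s k], and a link moves the centre by at most half of it, so the segments
    between corresponding points stay in [O]. *)
Let h k : R := kap * scale s k / (4 * d%:R).

Let dR : 0 < d%:R :> R. Proof. by rewrite ltr0n. Qed.

Let h_gt0 k : 0 < h k.
Proof. by rewrite divr_gt0// mulr_gt0// scale_gt0. Qed.

Let hd k : h k * d%:R = kap * scale s k / 4.
Proof. by rewrite /h; field; rewrite gt_eqF. Qed.

Let hS k : h k.+1 <= h k.
Proof.
rewrite /h (scaleS s k) ler_pM2r ?invr_gt0 ?mulr_gt0// ler_pM2l//.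
by have := scale_gt0 k.+1 s0; lra.
Qed.

(** The second cube may be smaller, which covers the passage from one scale to the next. *)
Let access_step (k : nat) (p p' : E) (t' : R) :
  eball p (kap * scale s k) `<=` O -> enorm (p - y) <= K * scale s k ->
  enorm (p' - p) <= kap / 2 * scale s k -> h k.+1 <= t' <= h k ->
  (\int[mu]_(q in [set q | `|q| < 1]%R) ((f (p' + t' *: q) - f (p + h k *: q)) ^+ 2)%:E <=
   (scale s k ^+ 2 * h k.+1 ^- d)%:E * J k)%E.
Proof.
move=> pO py pp /andP[t1 t2].
have r0 := scale_gt0 k s0.
have kr0 : 0 < kap * scale s k by rewrite mulr_gt0.
have kr1 : kap * scale s k <= scale s k by rewrite ler_piMl// ltW.
apply: step_inequality => //.
- move=> t q /andP[ta tb] q1.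
  set z := _ + _.
  have zp : enorm (z - p) < kap * scale s k.
    have -> : z - p = t *: (p' - p) + (h k + t * (t' - h k)) *: q.
      by rewrite /z addrC !addrA addNr add0r.
    apply: (le_lt_trans (enormD _ _)).
    have c0 : 0 <= h k + t * (t' - h k).
      have -> : h k + t * (t' - h k) = (1 - t) * h k + t * t' by ring.
      apply: addr_ge0; apply: mulr_ge0 => //; [by rewrite subr_ge0|exact: ltW|].
      exact: le_trans (ltW (h_gt0 _)) t1.
    have c1 : h k + t * (t' - h k) <= h k.
      by rewrite gerDl mulr_ge0_le0// subr_le0.
    have e1 : enorm (t *: (p' - p)) <= kap / 2 * scale s k.
      rewrite enormZ ger0_norm//; apply: le_trans pp.
      by rewrite ler_piMl// enorm_ge0.
    have e2 : enorm ((h k + t * (t' - h k)) *: q) <= kap * scale s k / 4.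
      by apply: (le_trans (enormZ_le c0 q1)); rewrite -hd ler_pM2r.
    lra.
  split; first exact: pO.
  apply: (le_lt_trans (norm_le_enorm _)).
  have := enorm_dist z p y; lra.
- move=> q q1; rewrite -enorm_sqr ler_sqr ?nnegrE ?enorm_ge0 ?(ltW r0)//.
  apply: (le_trans (enormD _ _)).
  rewrite -[(t' - h k) *: q]opprK -scaleNr enormN opprB.
  have a0 : 0 <= h k - t' by rewrite subr_ge0.
  have := enormZ_le a0 q1; rewrite mulrBl hd.
  have : 0 <= t' * d%:R by rewrite mulr_ge0// (le_trans (ltW (h_gt0 k.+1)) t1).
  lra.
Qed.

(* [f y] is the limit of the averages of [f] over the cubes [P k 0 + h k *: Q0]; the cube at scale 0 lies
   outside the ball, and consecutive cubes of the chain are compared by [access_step]. *)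
Lemma access_bound n : access O x y s kap K M ->
  ((2 ^+ d * f y ^+ 2)%:E <=
    \sum_(k < n) (access_coef s kap M k)%:E * J k +
    (2 ^+ d * (2 * G2 * ((K + 1) * scale s n) ^+ 2))%:E)%E.
Proof.
move=> [P [PM PO Py Pstep P0]].
have [mQ0 volQ0] := lebesgue_unit_ball.
set Q0 := [set q : E | _] in mQ0 volQ0.
(* Scale [k] has M + 1 links: [M] links between cubes of equal size, then one that keeps the centre
   [P k M] = [P k.+1 0] and shrinks the cube. *)
pose pos k i := if (i <= M)%N then P k i else P k.+1 0%N.
pose hh k i := if (i <= M)%N then h k else h k.+1.
pose a k i (q : E) : R := f (pos k i + hh k i *: q).
pose F k (q : E) : R := f (P k 0%N + h k *: q).
have aF k q : a k 0%N q = F k q by [].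
have aFS k q : a k M.+1 q = F k.+1 q by rewrite /a /pos /hh ltnn.
have step k i : (i < M.+1)%N ->
    (\int[mu]_(q in Q0) ((a k i.+1 q - a k i q) ^+ 2)%:E <= (scale s k ^+ 2 * h k.+1 ^- d)%:E * J k)%E.
  rewrite ltnS => iM.
  have pp : enorm (pos k i.+1 - pos k i) <= kap / 2 * scale s k.
    rewrite /pos iM; case: ltnP => // Mi.
    have -> : i = M by apply/eqP; rewrite eqn_leq iM.
    rewrite -PM subrr enorm0; apply: mulr_ge0; last exact/ltW/scale_gt0.
    by rewrite divr_ge0// ltW.
  have hb : h k.+1 <= hh k i.+1 <= h k.
    by rewrite /hh; case: ifP => _; rewrite !lexx hS.
  have := @access_step k (P k i) (pos k i.+1) (hh k i.+1) (PO k i) (Py k i).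
  by rewrite -{1}/(P k i) /a /pos /hh iM in pp hb * => /(_ pp hb).
(* The centre is at distance at least 2 s from [x], and the Euclidean radius of the cube is at most
   3 s / 4. *)
have F00 q : Q0 q -> F 0%N q = 0.
  move=> q1; apply: f0; rewrite /eball/=; apply/negP; rewrite -leNgt.
  have := enormZ_le (ltW (h_gt0 0)) q1; rewrite hd.
  have := enorm_dist (P 0%N 0%N) (P 0%N 0%N + h 0%N *: q) x.
  rewrite opprD addrA subrr add0r enormN.
  have : kap * scale s 0 <= 1 * (3 * s).
    rewrite /scale expr0 divr1 ler_wpM2r//; apply: mulr_ge0 => //; exact: ltW.
  move=> H1 H2 H3; rewrite -(lerD2l (enorm (h 0%N *: q))); apply: le_trans H2; apply: le_trans P0.
  by move: H1 H3 s0; lra.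
have G20 : 0 <= G2 by apply: le_trans (HG 0); exact: enorm2_ge0.
pose B : R := 2 * G2 * ((K + 1) * scale s n) ^+ 2.
have B0 : 0 <= B by rewrite /B; apply: mulr_ge0; [apply: mulr_ge0|exact: sqr_ge0].
pose w k : R := 4 * 2 ^+ k * M.+1%:R.
have w0 k : 0 <= w k by rewrite /w; apply: mulr_ge0 => //; apply: mulr_ge0 => //; exact: exprn_ge0.
have last q : Q0 q -> 2 * (f y - F n q) ^+ 2 <= B.
  move=> q1; rewrite /B -mulrA ler_pM2l//.
  apply: (le_trans (lipschitz_test _ _ Cf HG)); rewrite ler_wpM2l// -enorm_sqr.
  have r0 := scale_gt0 n s0.
  have Kr0 : 0 <= (K + 1) * scale s n by apply: mulr_ge0; [apply: addr_ge0 => //; exact: ltW|exact: ltW].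
  rewrite ler_sqr ?nnegrE ?enorm_ge0//.
  have := enormZ_le (ltW (h_gt0 n)) q1; rewrite hd.
  have := enorm_dist y (P n 0%N) (P n 0%N + h n *: q).
  have -> : P n 0%N - (P n 0%N + h n *: q) = - (h n *: q) by rewrite opprD addrA subrr sub0r.
  rewrite (enormN (h n *: q)) (enormC y (P n 0%N)).
  have := Py n 0%N.
  have : kap * scale s n <= scale s n by rewrite ler_piMl// ltW.
  have : 0 < scale s n by [].
  lra.
have pw q : Q0 q -> f y ^+ 2 <= B + \sum_(k < n) \sum_(i < M.+1) w k * (a k i.+1 q - a k i q) ^+ 2.
  move=> q1.
  have E1 : f y ^+ 2 <= 2 * (f y - F n q) ^+ 2 + 2 * F n q ^+ 2.
    by have := sqr_ge0 (f y - F n q - F n q); rewrite !sqrrB; lra.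
  apply: (le_trans E1); apply: lerD; first exact: last.
  have -> : F n q = \sum_(k < n) (F k.+1 q - F k q).
    by rewrite -(big_mkord xpredT (fun k => F k.+1 q - F k q)) telescope_sumr// F00// subr0.
  have := sum_sqr_geometric n (fun k => F k.+1 q - F k q).
  move=> /(ler_wpM2l (ler0n R 2)) H; apply: (le_trans H).
  rewrite mulrA mulr_sumr; apply: ler_sum => k _.
  rewrite -mulr_sumr.
  have c0 : 0 <= (4 * 2 ^+ k : R) by apply: mulr_ge0 => //; exact: exprn_ge0.
  have /= := ler_wpM2l c0 (telescope_sqr M.+1 (fun i => a k i q)).
  rewrite aF aFS /w => H2.
  rewrite [leRHS](_ : _ = 4 * 2 ^+ k * (M.+1%:R * \sum_(i < M.+1) (a k i.+1 q - a k i q) ^+ 2)); last by ring.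
  by rewrite [leLHS](_ : _ = 4 * 2 ^+ k * (F k.+1 q - F k q) ^+ 2)//; ring.
have ma k i : measurable_fun [set: E] (a k i).
  have mf : measurable_fun [set: E] f by apply: continuous_measurable_rV; exact: Ck_continuous Cf.
  exact: (measurableT_comp mf (measurable_affine _ _)).
pose D k i (q : E) : \bar R := ((a k i.+1 q - a k i q) ^+ 2)%:E.
have mD k i : measurable_fun Q0 (D k i).
  apply/measurable_EFinP; apply: measurable_funTS.
  by apply: measurable_funX; apply: measurable_funB.
have D0 k i q : (0 <= D k i q)%E by rewrite lee_fin sqr_ge0.
pose T (q : E) : \bar R := (B%:E + \sum_(k < n) \sum_(i < M.+1) ((w k)%:E * D k i q))%E.
have fT q : Q0 q -> ((f y ^+ 2)%:E <= T q)%E.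
  move=> /pw H.
  rewrite (_ : T q = (B + \sum_(k < n) \sum_(i < M.+1) w k * (a k i.+1 q - a k i q) ^+ 2)%:E) ?lee_fin//.
  rewrite /T EFinD -sumEFin; congr (_ + _)%E; apply: eq_bigr => k _.
  by rewrite -sumEFin; apply: eq_bigr => i _.
have mwD k i : measurable_fun Q0 (fun q => (w k)%:E * D k i q)%E by exact: measurable_funeM.
have wD0 k i q : (0 <= (w k)%:E * D k i q)%E by apply: mule_ge0 => //; rewrite lee_fin.
have msum k : measurable_fun Q0 (fun q => \sum_(i < M.+1) ((w k)%:E * D k i q))%E.
  by apply: emeasurable_sum => i.
have sum0 k q : (0 <= \sum_(i < M.+1) ((w k)%:E * D k i q))%E by apply: sume_ge0.
have mss : measurable_fun Q0 (fun q => \sum_(k < n) \sum_(i < M.+1) ((w k)%:E * D k i q))%E.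
  by apply: emeasurable_sum => k.
have cstQ (c : R) : (\int[mu]_(q in Q0) (cst c%:E q) = (2 ^+ d * c)%:E)%E.
  rewrite integral_cst//; transitivity (c%:E * mu Q0)%E => //.
  by rewrite volQ0 -EFinM mulrC.
have IT : (\int[mu]_(q in Q0) T q =
    (2 ^+ d * B)%:E + \sum_(k < n) \sum_(i < M.+1) ((w k)%:E * \int[mu]_(q in Q0) D k i q))%E.
  rewrite /T ge0_integralD//; last by move=> q _; apply: sume_ge0.
  congr (_ + _)%E; first exact: cstQ.
  rewrite ge0_integral_sum//; apply: eq_bigr => k _.
  rewrite ge0_integral_sum//; apply: eq_bigr => i _.
  by apply: ge0_integralZl => //; rewrite lee_fin.
have I1 : ((2 ^+ d * f y ^+ 2)%:E <= \int[mu]_(q in Q0) T q)%E.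
  have -> : ((2 ^+ d * f y ^+ 2)%:E = \int[mu]_(q in Q0) (cst (f y ^+ 2)%:E q))%E.
    by rewrite cstQ.
  apply: ge0_le_integral => //.
  - by move=> q _; rewrite lee_fin sqr_ge0.
  - by apply: emeasurable_funD.
apply: (le_trans I1); rewrite IT addeC; apply: leeD => //.
apply: lee_sum => k _.
apply: (@le_trans _ _ (\sum_(i < M.+1) ((w k)%:E * ((scale s k ^+ 2 * h k.+1 ^- d)%:E * J k)))%E).
  by apply: lee_sum => i _; apply: lee_wpmul2l; [by rewrite lee_fin|exact: step].
have J0 : (0 <= J k)%E.
  by apply: integral_ge0 => z _; rewrite lee_fin mulr_ge0 ?grad_sqr_on_ge0// indicE ler0n.
rewrite (eq_bigr (fun _ => (w k * (scale s k ^+ 2 * h k.+1 ^- d))%:E * J k))%E; last first.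
  by move=> i _; rewrite muleA.
rewrite -ge0_sume_distrl; last first.
  move=> i _; rewrite lee_fin; apply: mulr_ge0 => //.
  by apply: mulr_ge0; [exact: sqr_ge0|rewrite invr_ge0 exprn_ge0// ltW].
rewrite sumEFin sumr_const card_ord; apply: lee_wpmul2r => //.
rewrite lee_fin /access_coef -/(h k.+1) le_eqVlt; apply/orP; left; apply/eqP.
by rewrite /w -mulr_natl; ring.
Qed.

End access_bound.

Section poincare_inequality.
Context (R : realType) (d : nat).
Local Notation E := 'rV[R]_d.
Local Notation mu := (lebesgue_rV R d).
Local Notation leb := (@lebesgue_measure R).

(** The powers of order [d] of the scale cancel. There remains 2^k times the square of the scale,
    which is 9 s^2 / 2^k: the sum is geometric and bounded independently of [n]. *)
Lemma access_coef_sum (s kap K : R) (M n : nat) : (0 < d)%N -> 0 < s -> 0 < kap -> 0 < K ->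
  \sum_(k < n) (access_coef d s kap M k * (2 * ((K + 1) * scale s k)) ^+ d) <=
  72 * s ^+ 2 * M.+1%:R ^+ 2 * (16 * d%:R * (K + 1) / kap) ^+ d.
Proof.
move=> d0 s0 kap0 K0; have dR : 0 < d%:R :> R by rewrite ltr0n.
set c := 36 * s ^+ 2 * M.+1%:R ^+ 2 * (16 * d%:R * (K + 1) / kap) ^+ d.
have c0 : 0 <= c.
  rewrite /c; apply: mulr_ge0.
    by apply: mulr_ge0; [apply: mulr_ge0 => //|]; exact: sqr_ge0.
  apply: exprn_ge0; apply: divr_ge0; last exact: ltW.
  by apply: mulr_ge0; [apply: mulr_ge0|apply: addr_ge0 => //; exact: ltW].
rewrite (_ : 72 * _ * _ * _ = c * 2); last by rewrite /c; ring.
apply: le_trans (ler_wpM2l c0 (sum_half_le R n)); rewrite mulr_sumr; apply: ler_sum => k _.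
rewrite le_eqVlt; apply/orP; left; apply/eqP; rewrite /access_coef /c.
have r0 := scale_gt0 k.+1 s0.
have eM (p a b : R) : p * a ^- d * b ^+ d = p * (a^-1 * b) ^+ d by rewrite exprMn exprVn mulrA.
rewrite eM.
have -> : (kap * scale s k.+1 / (4 * d%:R))^-1 * (2 * ((K + 1) * scale s k)) = 16 * d%:R * (K + 1) / kap.
  by rewrite (scaleS s k); field; rewrite !gt_eqF.
rewrite [RHS]mulrAC; congr (_ * _).
by rewrite /scale; field; rewrite expf_neq0.
Qed.

Lemma access_coef_ge0 (s kap : R) (M k : nat) : 0 < s -> 0 < kap -> 0 <= access_coef d s kap M k.
Proof.
move=> s0 kap0; rewrite /access_coef; apply: mulr_ge0.
  apply: mulr_ge0; last exact: sqr_ge0.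
  by apply: mulr_ge0; [apply: mulr_ge0; [exact: ler0n|exact: exprn_ge0]|exact: sqr_ge0].
rewrite invr_ge0; apply: exprn_ge0; apply: divr_ge0; last by apply: mulr_ge0; exact: ler0n.
by apply: mulr_ge0; apply: ltW; [exact: kap0|exact: scale_gt0].
Qed.

Lemma integral_grad_sqr_on (O : set E) (f : E -> R) :
  (\int[mu]_x (grad_sqr_on O f x)%:E = \int[mu]_(x in O) (enorm2 (grad f x))%:E)%E.
Proof.
rewrite [RHS]integral_mkcond; apply: eq_integral => x _.
by rewrite patchE /grad_sqr_on indicE; case: ifP => _; rewrite ?mul1r ?mul0r.
Qed.

(** The bound adds the terms for the two kinds of points, [L] for those near the Dirichlet part
    along a segment and [J] for those joined to the outside by a chain. The integral is thus never
    split according to the kind of [y]. The remainder [W n] disappears only after integration. *)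
Lemma integral_le_of_pointwise (Y : set E) (u : E -> R) (L : E -> \bar R) (J : nat -> E -> \bar R)
    (a b v C2 : R) (c m W : nat -> R) (I : \bar R) :
  measurable Y -> measurable_fun [set: E] u -> (forall y, 0 <= u y) ->
  measurable_fun [set: E] L -> (forall y, (0 <= L y)%E) ->
  (forall k, measurable_fun [set: E] (J k)) -> (forall k y, (0 <= J k y)%E) ->
  0 <= a -> 0 <= b -> 0 <= C2 -> (forall k, 0 <= c k) -> (forall k, 0 <= m k) -> (forall n, 0 <= W n) ->
  (0 <= I)%E ->
  (forall n y, Y y -> ((u y)%:E <= a%:E * L y + (\sum_(k < n) (c k)%:E * J k y + (W n)%:E))%E) ->
  (\int[mu]_y L y <= b%:E * I)%E -> (forall k, (\int[mu]_y J k y <= (m k)%:E * I)%E) ->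
  (mu Y <= v%:E)%E -> (forall n, \sum_(k < n) (c k * m k) <= C2) ->
  (forall r, 0 < r -> exists n, W n * v <= r) ->
  (\int[mu]_(y in Y) (u y)%:E <= (a * b + C2)%:E * I)%E.
Proof.
move=> mY mu_ u0 mL L0 mJ J0 a0 b0 C20 c0 m0 W0 I0 pw IL IJ muY cm Wsmall.
have aL0 y : (0 <= a%:E * L y)%E by apply: mule_ge0; rewrite ?lee_fin.
have cJ0 k y : (0 <= (c k)%:E * J k y)%E by apply: mule_ge0; rewrite ?lee_fin.
have S0 n y : (0 <= \sum_(k < n) (c k)%:E * J k y)%E by apply: sume_ge0.
have maL : measurable_fun Y (fun y => a%:E * L y)%E.
  by apply: measurable_funTS; exact: measurable_funeM.
have mcJ k : measurable_fun Y (fun y => (c k)%:E * J k y)%E.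
  by apply: measurable_funTS; exact: measurable_funeM.
have mS n : measurable_fun Y (fun y => \sum_(k < n) (c k)%:E * J k y)%E.
  by apply: emeasurable_sum => k.
have mSW n : measurable_fun Y (fun y => \sum_(k < n) (c k)%:E * J k y + (W n)%:E)%E.
  by apply: emeasurable_funD.
have SW0 n y : (0 <= \sum_(k < n) (c k)%:E * J k y + (W n)%:E)%E.
  by apply: adde_ge0 => //; rewrite lee_fin.
have subY (h : E -> \bar R) : measurable_fun [set: E] h -> (forall y, 0 <= h y)%E ->
    (\int[mu]_(y in Y) h y <= \int[mu]_y h y)%E.
  by move=> mh h0; apply: ge0_subset_integral.
have IT n : (\int[mu]_(y in Y) (a%:E * L y + (\sum_(k < n) (c k)%:E * J k y + (W n)%:E)) <=
    (a * b + C2)%:E * I + (W n * v)%:E)%E.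
  rewrite ge0_integralD//.
  have -> : ((a * b + C2)%:E * I = (a * b)%:E * I + C2%:E * I)%E.
    by rewrite EFinD ge0_muleDl// lee_fin// mulr_ge0.
  rewrite -[leRHS]addeA; apply: leeD.
    rewrite ge0_integralZl//; last exact: measurable_funTS.
    rewrite EFinM -muleA; apply: lee_wpmul2l; first by rewrite lee_fin.
    exact: le_trans (subY L mL L0) IL.
  rewrite ge0_integralD//; last by move=> y _; rewrite lee_fin.
  apply: leeD; last first.
    by rewrite integral_cst// EFinM; apply: lee_wpmul2l; rewrite ?lee_fin.
  rewrite ge0_integral_sum//.
  apply: (@le_trans _ _ (\sum_(k < n) (c k * m k)%:E * I)%E).
    apply: lee_sum => k _.
    rewrite ge0_integralZl//; [|exact: measurable_funTS|by rewrite lee_fin].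
    rewrite EFinM -muleA; apply: lee_wpmul2l; first by rewrite lee_fin.
    exact: le_trans (subY (J k) (mJ k) (J0 k)) (IJ k).
  rewrite -ge0_sume_distrl; last by move=> k _; rewrite lee_fin mulr_ge0.
  by rewrite sumEFin; apply: lee_wpmul2r => //; rewrite lee_fin.
apply/lee_addgt0Pr => r /Wsmall[n Wn].
apply: (@le_trans _ _ ((a * b + C2)%:E * I + (W n * v)%:E)%E); last first.
  by apply: leeD => //; rewrite lee_fin.
apply: le_trans (IT n); apply: ge0_le_integral => //.
- by move=> y _; rewrite lee_fin.
- by apply: measurable_funTS; exact/measurable_EFinP.
- by apply: emeasurable_funD.
- by move=> y; exact: pw.
Qed.

Lemma poincare (O D : set E) : (0 < d)%N -> open O -> uniform_near_neumann O D ->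
  exists2 R0 : R, 0 < R0 & forall x s, 0 < s <= R0 -> exists2 C : R, 0 <= C &
    forall f, test_fun (eball x s `\` D) f ->
    (\int[mu]_(y in O) (f y ^+ 2)%:E <= C%:E * \int[mu]_(y in O) (enorm2 (grad f y))%:E)%E.
Proof.
move=> d0 oO unif.
have [R0 [kap [K [M [R00 /andP[kap0 kap1] K0 acc]]]]] := access_of_uniform d0 oO unif.
exists R0 => // x s sR0; have /andP[s0 _] := sR0.
have mO : measurable O := open_measurable_rV oO.
(* If the right-hand alternative fails, its counterexample is a point of N in the ball and on the
   boundary of the component, which is what [access_of_uniform] asks for. *)
have cases y : O y -> eball x s y -> access O x y s kap K M \/
    (forall p, bd (connected_component O y) p -> bd O p -> eball x s p -> D p).
  move=> Oy ys.
  have [[p [bp bOp xp nDp]]|H] := pselect (exists p, [/\ bd (connected_component O y) p, bd O p,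
      eball x s p & ~ D p]).
    by left; apply: acc => //; exists p; split => //; split.
  by right => p bp bOp xp; apply: contrapT => nD; apply: H; exists p; split.
set C2 := 72 * s ^+ 2 * M.+1%:R ^+ 2 * (16 * d%:R * (K + 1) / kap) ^+ d.
have K10 : 0 < K + 1 by rewrite addr_gt0.
have C20 : 0 <= C2.
  rewrite /C2; apply: mulr_ge0.
    by apply: mulr_ge0; [apply: mulr_ge0 => //|]; exact: sqr_ge0.
  apply: exprn_ge0; apply: divr_ge0; last exact: ltW.
  by apply: mulr_ge0; [apply: mulr_ge0|exact: ltW].
have s20 : 0 < 2 * s by rewrite mulr_gt0.
have p2 : 0 < 2 ^+ d :> R by rewrite exprn_gt0.
have a0 : 0 <= 2 ^+ d * (2 * s) by apply: mulr_ge0; exact: ltW.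
pose C1 := 2 ^+ d * (2 * s) * (2 * s) + C2.
have C10 : 0 <= C1.
  by apply: addr_ge0 => //; apply: mulr_ge0 => //; exact: ltW.
exists ((2 ^+ d)^-1 * C1); first by apply: mulr_ge0 => //; rewrite invr_ge0 ltW.
move=> f tf.
have Cf : Ck 1 f := test_fun_smooth tf 1.
have f0 z : ~ eball x s z -> f z = 0.
  by move=> nz; apply: supp_out => /(test_fun_supp tf)[].
have [G2 HG] : exists G2 : R, forall z, enorm2 (grad f z) <= G2.
  have : ccfun (fun z => enorm2 (grad f z)).
    split; first exact: continuous_grad_sqr.
    exists (supp f); first exact: test_fun_compact tf.
    by move=> z /partial_out fz; rewrite /enorm2 big1// => i _; rewrite mxE fz expr0n.
  move=> /ccfun_bounded[G2 _ H]; exists G2 => z; exact: le_trans (ler_norm _) (H z).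
have G20 : 0 <= G2 by apply: le_trans (HG 0); exact: enorm2_ge0.
pose e : E := delta_mx ord0 (Ordinal d0).
pose g := grad_sqr_on O f.
have g0 z : 0 <= g z := grad_sqr_on_ge0 O f z.
have mg : measurable_fun [set: E] g := measurable_grad_sqr_on mO Cf.
pose rho k : R := (K + 1) * scale s k.
have rho0 k : 0 < rho k by apply: mulr_gt0 => //; exact: scale_gt0.
pose Y := O `&` eball x s.
have mY : measurable Y by apply: measurableI => //; apply: open_measurable_rV; exact: open_eball.
pose W n : R := 2 ^+ d * (2 * G2 * (rho n) ^+ 2).
have W0 n : 0 <= W n.
  by apply: mulr_ge0; [exact: ltW|apply: mulr_ge0; [apply: mulr_ge0|exact: sqr_ge0]].
have mf : measurable_fun [set: E] f by apply: continuous_measurable_rV; exact: Ck_continuous Cf.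
have IO : (\int[mu]_(y in O) (f y ^+ 2)%:E = \int[mu]_(y in Y) (f y ^+ 2)%:E)%E.
  rewrite [LHS]integral_mkcond [RHS]integral_mkcond; apply: eq_integral => y _.
  rewrite !patchE; case: ifPn => yO; case: ifPn => yY //.
    rewrite f0 ?expr0n// => ys; move/negP: yY; apply.
    by rewrite inE; split => //; rewrite inE in yO.
  by move/negP: yO; case; move: yY; rewrite !inE => -[].
have muY : (mu Y <= ((2 * s) ^+ d)%:E)%E.
  rewrite -(lebesgue_ball x s0); apply: le_measure; rewrite ?inE//; first exact: measurable_ball_rV.
  by move=> y [_ ys] /=; apply: le_lt_trans ys; exact: norm_le_enorm.
have Wsmall r : 0 < r -> exists n, W n * (2 * s) ^+ d <= r.
  move=> r0.
  have Kap0 : 0 <= 2 ^+ d * (2 * G2 * ((K + 1) * (3 * s)) ^+ 2) * (2 * s) ^+ d.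
    apply: mulr_ge0; last by apply: exprn_ge0; exact: ltW.
    by apply: mulr_ge0; [exact: ltW|apply: mulr_ge0; [apply: mulr_ge0|exact: sqr_ge0]].
  set Kap := (X in 0 <= X) in Kap0.
  (* The remainder is [Kap] divided by 4^n, and a single factor 2^n already exceeds Kap / r. *)
  pose n := Num.trunc (Kap / r); exists n.
  have Kn : Kap <= r * 2 ^+ n.
    rewrite -ler_pdivrMl//; apply: ltW; rewrite mulrC.
    apply: (lt_le_trans (truncnS_gt _)).
    by rewrite -natrX ler_nat ltn_expl.
  have -> : W n * (2 * s) ^+ d = Kap / 2 ^+ n / 2 ^+ n.
    by rewrite /W /Kap /rho /scale; field; rewrite expf_neq0.
  have n0 : 0 < 2 ^+ n :> R by rewrite exprn_gt0.
  rewrite ler_pdivrMr// ler_pdivrMr//; apply: (le_trans Kn).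
  rewrite ler_peMr ?exprn_ege1 ?ler1n//.
  by apply: mulr_ge0; exact: ltW.
have mu2 : measurable_fun [set: E] (fun y => 2 ^+ d * f y ^+ 2).
  by apply: measurable_funM => //; exact: measurable_funX.
have u0 y : 0 <= 2 ^+ d * f y ^+ 2 by apply: mulr_ge0; [exact: ltW|exact: sqr_ge0].
pose I : \bar R := (\int[mu]_z (g z)%:E)%E.
have I0 : (0 <= I)%E by apply: integral_ge0 => z _; rewrite lee_fin.
pose L (y : E) : \bar R := (\int[leb]_(t in `[0%R, (2 * s)%R]) (g (y + t *: e)%R)%:E)%E.
pose J k (y : E) : \bar R := (\int[mu]_z (\1_[set z | `|z - y| < rho k]%R z * g z)%:E)%E.
have L0 y : (0 <= L y)%E by apply: integral_ge0 => t _; rewrite lee_fin.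
have J0 k y : (0 <= J k y)%E.
  by apply: integral_ge0 => z _; rewrite lee_fin mulr_ge0// indicE ler0n.
have key : (\int[mu]_(y in Y) (2 ^+ d * f y ^+ 2)%:E <= C1%:E * I)%E.
  (* Translates of a segment are the case of constant ratio 1 in [tonelli_affine]. *)
  have LE : L = (fun y => \int[leb]_(t in `[0%R, (2 * s)%R]) (g (0 + t *: e + (1 + t * 0) *: y)%R)%:E)%E.
    apply/funext => y; apply: eq_integral => t _.
    by rewrite mulr0 addr0 scale1r add0r addrC.
  apply: (@integral_le_of_pointwise Y _ L J _ _ ((2 * s) ^+ d) C2 (access_coef d s kap M)
    (fun k => (2 * rho k) ^+ d) W).
  - exact: mY.
  - exact: mu2.
  - exact: u0.
  - by rewrite LE; exact: (measurable_line_integral mg g0).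
  - exact: L0.
  - by move=> k; exact: (integral_local_average mg g0 (rho0 k)).1.
  - exact: J0.
  - exact: a0.
  - exact: ltW s20.
  - exact: C20.
  - by move=> k; exact: access_coef_ge0.
  - by move=> k; apply: exprn_ge0; apply: mulr_ge0; [exact: ler0n|exact: ltW (rho0 k)].
  - exact: W0.
  - exact: I0.
  - move=> n y [Oy ys].
    have cJ0 : (0 <= \sum_(k < n) (access_coef d s kap M k)%:E * J k y)%E.
      apply: sume_ge0 => k _; apply: mule_ge0; last exact: J0.
      by rewrite lee_fin; exact: access_coef_ge0.
    have [ac|H] := cases y Oy ys.
      apply: (le_trans (access_bound d0 mO s0 kap0 kap1 K0 Cf HG f0 n ac)).
      rewrite -[leLHS]add0e; apply: leeD; last exact: lexx.
      by apply: mule_ge0; [rewrite lee_fin; exact: a0|exact: L0].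
    have fr : ((f y ^+ 2)%:E <= (2 * s)%:E * L y)%E.
      apply: (friedrichs_point oO tf); [exact: Oy|exact: s20|..].
        rewrite /eball/=; apply/negP; rewrite -leNgt.
        have := enorm_dist (y + (2 * s) *: e) x y.
        rewrite addrAC subrr add0r enormZ enorm_delta mulr1 (gtr0_norm s20).
        rewrite (enormC x y); move: ys; rewrite /eball/=.
        by move: (enorm (y - x)) (enorm (y + _ - x)) s0; clear; move=> *; lra.
      exact: H.
    apply: (@le_trans _ _ ((2 ^+ d)%:E * ((2 * s)%:E * L y))%E).
      by rewrite EFinM; apply: lee_wpmul2l; [rewrite lee_fin; exact: ltW|exact: fr].
    rewrite muleA -EFinM -[leLHS]adde0; apply: leeD; first exact: lexx.
    by apply: adde_ge0; [exact: cJ0|rewrite lee_fin; exact: W0].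
  - have := tonelli_affine mg g0 0 e (h := 1) (k := 0) s20 ltr01.
    by rewrite expr1n invr1 mulr1 LE; apply => t _; rewrite mulr0 addr0.
  - by move=> k; rewrite (integral_local_average mg g0 (rho0 k)).2; exact: lexx.
  - exact: muY.
  - by move=> n; exact: access_coef_sum.
  - exact: Wsmall.
rewrite IO -integral_grad_sqr_on -/I.
have p2i : (0 <= ((2 ^+ d)^-1 : R)%:E)%E by rewrite lee_fin invr_ge0; exact: ltW.
have := lee_wpmul2l p2i key; rewrite muleA -EFinM.
have -> : (\int[mu]_(y in Y) (2 ^+ d * f y ^+ 2)%:E = (2 ^+ d)%:E * \int[mu]_(y in Y) (f y ^+ 2)%:E)%E.
  under eq_integral do rewrite EFinM.
  apply: ge0_integralZl; [exact: mY| |by move=> y _; rewrite lee_fin; exact: sqr_ge0|by rewrite lee_fin; exact: ltW].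
  by apply/measurable_EFinP; apply: measurable_funTS; exact: measurable_funX.
by rewrite muleA -EFinM mulVf ?mul1e// gt_eqF.
Qed.

End poincare_inequality.

(** * Complex vector fields *)

Section complex_vectors.
Context (R : realType) (d : nat).
Local Notation C := R[i].
Implicit Types (z w : C) (xi zeta eta : 'cV[C]_d).
Local Notation Re := (@complex.Re R).
Local Notation Im := (@complex.Im R).

Lemma ReD z w : Re (z + w) = Re z + Re w. Proof. by case: z w => ? ? [? ?]. Qed.
Lemma ImD z w : Im (z + w) = Im z + Im w. Proof. by case: z w => ? ? [? ?]. Qed.
Lemma ReN z : Re (- z) = - Re z. Proof. by case: z. Qed.
Lemma ImN z : Im (- z) = - Im z. Proof. by case: z. Qed.
Lemma ReM z w : Re (z * w) = Re z * Re w - Im z * Im w. Proof. by case: z w => ? ? [? ?]. Qed.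
Lemma ImM z w : Im (z * w) = Re z * Im w + Im z * Re w. Proof. by case: z w => ? ? [? ?]. Qed.

Lemma Re_sum n (F : 'I_n -> C) : Re (\sum_(i < n) F i) = \sum_(i < n) Re (F i).
Proof. by apply: (big_morph Re) => [z w|]; rewrite ?ReD. Qed.

Lemma Im_sum n (F : 'I_n -> C) : Im (\sum_(i < n) F i) = \sum_(i < n) Im (F i).
Proof. by apply: (big_morph Im) => [z w|]; rewrite ?ImD. Qed.

Lemma normc_sqr z : ComplexField.Normc.normc z ^+ 2 = Re z ^+ 2 + Im z ^+ 2.
Proof. by case: z => a b /=; rewrite sqr_sqrtr// addr_ge0 ?sqr_ge0. Qed.

(** The real part of the Hermitian product, a real inner product to which the real theory applies;
    the imaginary part is recovered by multiplying one argument by i. *)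
Definition rdot xi zeta : R :=
  \sum_(i < d) (Re (xi i ord0) * Re (zeta i ord0) + Im (xi i ord0) * Im (zeta i ord0)).

Lemma Re_cdot xi zeta : Re (cdot xi zeta) = rdot xi zeta.
Proof.
rewrite /cdot Re_sum; apply: eq_bigr => i _.
by case: (xi i ord0) (zeta i ord0) => a b [a' b'] /=; rewrite mulrN opprK.
Qed.

Lemma Im_cdot xi zeta : Im (cdot xi zeta) = rdot xi (Complex 0 1 *: zeta).
Proof.
rewrite /cdot Im_sum; apply: eq_bigr => i _; rewrite mxE.
case: (xi i ord0) (zeta i ord0) => a b [a' b'] /=; ring.
Qed.

Lemma rdotC xi zeta : rdot xi zeta = rdot zeta xi.
Proof. by apply: eq_bigr => i _; congr (_ + _); rewrite mulrC. Qed.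

Lemma rdot_linl (a : R) xi zeta eta :
  rdot (Complex a 0 *: xi + zeta) eta = a * rdot xi eta + rdot zeta eta.
Proof.
rewrite /rdot mulr_sumr -big_split/=; apply: eq_bigr => i _; rewrite !mxE ReD ImD ReM ImM/=; ring.
Qed.

Lemma rdot_linr (a : R) xi zeta eta :
  rdot eta (Complex a 0 *: xi + zeta) = a * rdot eta xi + rdot eta zeta.
Proof. by rewrite rdotC rdot_linl !(rdotC eta). Qed.

Lemma rdot_ge0 xi : 0 <= rdot xi xi.
Proof. by apply: sumr_ge0 => i _; rewrite -!expr2 addr_ge0 ?sqr_ge0. Qed.

Lemma cnormE xi : cnorm xi = Num.sqrt (rdot xi xi).
Proof.
rewrite /cnorm; congr Num.sqrt; apply: eq_bigr => i _.
by rewrite normc_sqr -!expr2.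
Qed.

Lemma cnorm_ge0 xi : 0 <= cnorm xi. Proof. exact: sqrtr_ge0. Qed.

Lemma cnorm_sqr xi : cnorm xi ^+ 2 = rdot xi xi.
Proof. by rewrite cnormE sqr_sqrtr// rdot_ge0. Qed.

Lemma rdot_cauchy xi zeta : `|rdot xi zeta| <= cnorm xi * cnorm zeta.
Proof.
rewrite !cnormE -sqrtrM ?rdot_ge0// -sqrtr_sqr ler_wsqrtr//.
apply: discriminant_le; first exact: rdot_ge0.
move=> t; have := rdot_ge0 (Complex (- t) 0 *: zeta + xi).
by rewrite rdot_linl !rdot_linr (rdotC zeta xi); lra.
Qed.

Lemma rdotDl xi zeta eta : rdot (xi + zeta) eta = rdot xi eta + rdot zeta eta.
Proof. by rewrite /rdot -big_split/=; apply: eq_bigr => i _; rewrite !mxE ReD ImD; ring. Qed.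

Lemma rdotNl xi eta : rdot (- xi) eta = - rdot xi eta.
Proof. by rewrite /rdot -sumrN; apply: eq_bigr => i _; rewrite !mxE ReN ImN; ring. Qed.

Lemma cnormN xi : cnorm (- xi) = cnorm xi.
Proof. by rewrite !cnormE rdotNl rdotC rdotNl opprK. Qed.

Lemma cnormD_sqr_le xi zeta : cnorm (xi + zeta) ^+ 2 <= 2 * cnorm xi ^+ 2 + 2 * cnorm zeta ^+ 2.
Proof.
rewrite !cnorm_sqr rdotDl (rdotC xi (xi + zeta)) (rdotC zeta (xi + zeta)) !rdotDl.
have := rdot_ge0 (xi - zeta).
rewrite rdotDl (rdotC xi (xi - zeta)) (rdotC (- zeta) (xi - zeta)) !rdotDl !rdotNl.
by rewrite (rdotC zeta (- zeta)) (rdotC xi (- zeta)) !rdotNl (rdotC zeta xi); lra.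
Qed.

Lemma cnormZ (a : R) xi : cnorm (Complex a 0 *: xi) = `|a| * cnorm xi.
Proof.
have -> : cnorm (Complex a 0 *: xi) = Num.sqrt (a ^+ 2 * rdot xi xi).
  rewrite cnormE; congr Num.sqrt; rewrite /rdot mulr_sumr; apply: eq_bigr => i _.
  by rewrite !mxE ReM ImM/=; ring.
by rewrite sqrtrM ?sqr_ge0// sqrtr_sqr -cnormE.
Qed.

Lemma cnorm0 : cnorm (0 : 'cV[C]_d) = 0.
Proof. by rewrite -(scale0r (0 : 'cV[C]_d)) (cnormZ 0) normr0 mul0r. Qed.

Lemma cnorm_eq0 xi : cnorm xi = 0 -> xi = 0.
Proof.
move=> H; have := cnorm_sqr xi; rewrite H expr0n/= => /esym/eqP.
rewrite /rdot psumr_eq0; last by move=> i _; rewrite -!expr2 addr_ge0 ?sqr_ge0.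
move=> /allP H0; apply/matrixP => i j; rewrite ord1 mxE.
have := H0 i (mem_index_enum _); rewrite -!expr2 paddr_eq0 ?sqr_ge0// !sqrf_eq0.
by case: (xi i ord0) => a b /= /andP[/eqP -> /eqP ->].
Qed.

(** The supremum in [opnorm] is informative only for a bounded set; crude bounds by the entries are
    enough for this. *)
Lemma has_sup_opnorm (M : 'M[C]_d) :
  has_sup [set cnorm (M *m xi) | xi in [set xi : 'cV[C]_d | cnorm xi <= 1]].
Proof.
split; first by exists (cnorm (M *m 0)), 0 => //=; rewrite cnorm0.
pose K i : R := \sum_(j < d) (`|Re (M i j)| + `|Im (M i j)|).
exists (Num.sqrt (\sum_(i < d) ((K i ^+ 2) + (K i ^+ 2)))) => _ [xi /= x1 <-].
rewrite cnormE ler_wsqrtr//; apply: ler_sum => i _; rewrite -!expr2.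
have c1 j : `|Re (xi j ord0)| <= 1 /\ `|Im (xi j ord0)| <= 1.
  have : Re (xi j ord0) ^+ 2 + Im (xi j ord0) ^+ 2 <= 1.
    have : cnorm xi ^+ 2 <= 1 by rewrite expr_le1 ?cnorm_ge0.
    rewrite cnorm_sqr /rdot (bigD1 j)//= -!expr2; apply: le_trans; rewrite lerDl.
    by apply: sumr_ge0 => k _; rewrite -!expr2 addr_ge0 ?sqr_ge0.
  move=> H; split; rewrite -(@expr_le1 _ 2)// real_normK ?num_real//; apply: le_trans H.
    by rewrite lerDl sqr_ge0.
  by rewrite lerDr sqr_ge0.
have K0 : 0 <= K i by apply: sumr_ge0 => j _; rewrite addr_ge0.
have sq (x : R) : `|x| <= K i -> x ^+ 2 <= K i ^+ 2.
  by move=> xK; rewrite -real_normK ?num_real// ler_sqr ?nnegrE.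
apply: lerD; apply: sq.
  rewrite mxE Re_sum; apply: (le_trans (ler_norm_sum _ _ _)); apply: ler_sum => j _.
  rewrite ReM (le_trans (ler_normB _ _))// !normrM; have [a b] := c1 j.
  by apply: lerD; apply: ler_piMr.
rewrite mxE Im_sum; apply: (le_trans (ler_norm_sum _ _ _)); apply: ler_sum => j _.
rewrite ImM (le_trans (ler_normD _ _))// !normrM; have [a b] := c1 j.
by apply: lerD; apply: ler_piMr.
Qed.

Lemma opnorm_bound (M : 'M[C]_d) xi : cnorm (M *m xi) <= opnorm M * cnorm xi.
Proof.
have [x0|x0] := eqVneq (cnorm xi) 0.
  by rewrite (cnorm_eq0 x0) mulmx0 !cnorm0 mulr0.
have xp : 0 < cnorm xi by rewrite lt_neqAle eq_sym x0 cnorm_ge0.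
rewrite -ler_pdivrMr//.
have -> : cnorm (M *m xi) / cnorm xi = cnorm (M *m (Complex (cnorm xi)^-1 0 *: xi)).
  by rewrite -scalemxAr cnormZ ger0_norm ?invr_ge0 ?cnorm_ge0// mulrC.
apply: sup_upper_bound; first exact: has_sup_opnorm.
by exists (Complex (cnorm xi)^-1 0 *: xi) => //=; rewrite cnormZ ger0_norm ?invr_ge0 ?cnorm_ge0// mulVf.
Qed.

Lemma rdot_opnorm (M : 'M[C]_d) xi zeta :
  `|rdot (M *m xi) zeta| <= opnorm M * (cnorm xi * cnorm zeta).
Proof.
apply: (le_trans (rdot_cauchy _ _)); rewrite mulrA ler_wpM2r ?cnorm_ge0//.
exact: opnorm_bound.
Qed.

End complex_vectors.

(** * Square-integrable vector fields and bilinear forms *)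

Section vector_fields.
Context (R : realType) (d : nat).
Local Notation E := 'rV[R]_d.
Local Notation mu := (lebesgue_rV R d).
Local Notation Re := (@complex.Re R).
Local Notation Im := (@complex.Im R).
Variables (U : set E) (mU : measurable U).
Implicit Types (u v : E -> R[i]) (g h : E -> 'cV[R[i]]_d) (M : E -> 'M[R[i]]_d).

Lemma L2_sqint u : L2 U u <-> sqint mu U (fun x => Re (u x)) /\ sqint mu U (fun x => Im (u x)).
Proof.
have E2 x : ((ComplexField.Normc.normc (u x) ^+ 2)%:E = (Re (u x) ^+ 2)%:E + (Im (u x) ^+ 2)%:E)%E.
  by rewrite normc_sqr EFinD.
split=> [[[mR mI] fin]|[sR sI]].
  have mn : measurable_fun U (fun x => (ComplexField.Normc.normc (u x) ^+ 2)%:E).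
    under eq_fun do rewrite E2.
    by apply: emeasurable_funD; apply/measurable_EFinP; exact: measurable_funX.
  split; split => //; apply: le_lt_trans fin; apply: ge0_le_integral => //.
  - by move=> x _; rewrite lee_fin sqr_ge0.
  - by apply/measurable_EFinP; exact: measurable_funX.
  - by move=> x _; rewrite normc_sqr lee_fin lerDl sqr_ge0.
  - by move=> x _; rewrite lee_fin sqr_ge0.
  - by apply/measurable_EFinP; exact: measurable_funX.
  - by move=> x _; rewrite normc_sqr lee_fin lerDr sqr_ge0.
split; first by split; [exact: sR.1|exact: sI.1].
under eq_integral do rewrite E2.
have := integrable_lty mU (integrableD mU (sqint_sqr_integrable sR) (sqint_sqr_integrable sI)).
by under eq_integral do rewrite /=.
Qed.

Definition vL2 g := forall i, L2 U (fun x => g x i ord0).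

Definition vmeasurable g := forall i, cmeasurable U (fun x => g x i ord0).

Lemma vL2_measurable g : vL2 g -> vmeasurable g.
Proof. by move=> gL i; have [] := gL i. Qed.

Lemma vL2_Re g i : vL2 g -> sqint mu U (fun x => Re (g x i ord0)).
Proof. by move=> gL; have /L2_sqint[] := gL i. Qed.

Lemma vL2_Im g i : vL2 g -> sqint mu U (fun x => Im (g x i ord0)).
Proof. by move=> gL; have /L2_sqint[] := gL i. Qed.

Lemma measurable_sum_ord n (F : 'I_n -> E -> R) : (forall i, measurable_fun U (F i)) ->
  measurable_fun U (fun x => \sum_(i < n) F i x).
Proof. by move=> mF; apply: measurable_sum. Qed.

Lemma cmeasurableM u v : cmeasurable U u -> cmeasurable U v -> cmeasurable U (fun x => u x * v x).
Proof.
move=> [ur ui] [vr vi]; split.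
  under eq_fun do rewrite ReM.
  by apply: measurable_funB; apply: measurable_funM.
under eq_fun do rewrite ImM.
by apply: measurable_funD; apply: measurable_funM.
Qed.

Lemma vmeasurable_mulmx M g : (forall i j, cmeasurable U (fun x => M x i j)) -> vmeasurable g ->
  vmeasurable (fun x => M x *m g x).
Proof.
move=> mM mg i.
have c j := cmeasurableM (mM i j) (mg j).
split.
  under eq_fun do rewrite mxE Re_sum.
  by apply: measurable_sum_ord => j; exact: (c j).1.
under eq_fun do rewrite mxE Im_sum.
by apply: measurable_sum_ord => j; exact: (c j).2.
Qed.

Lemma measurable_rdot g h : vmeasurable g -> vmeasurable h ->
  measurable_fun U (fun x => rdot (g x) (h x)).
Proof.
move=> mg mh; apply: measurable_sum_ord => i.
have [a b] := mg i; have [a' b'] := mh i.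
by apply: measurable_funD; apply: measurable_funM.
Qed.

Lemma integrable_rdot g h : vL2 g -> vL2 h -> mu.-integrable U (EFin \o (fun x => rdot (g x) (h x))).
Proof.
move=> gL hL.
rewrite (_ : EFin \o _ = (fun x => \sum_(i < d)
    (EFin \o (fun x => Re (g x i ord0) * Re (h x i ord0) + Im (g x i ord0) * Im (h x i ord0))%R) x)%E); last first.
  by apply/funext => x; rewrite /= /rdot -sumEFin.
apply: integrable_sum => // i _.
have IR := sqintM_integrable mU (vL2_Re i gL) (vL2_Re i hL).
have II := sqintM_integrable mU (vL2_Im i gL) (vL2_Im i hL).
by have := integrableD mU IR II.
Qed.

Lemma vL2_cnorm g : vL2 g -> sqint mu U (fun x => cnorm (g x)).
Proof.
move=> gL; have I := integrable_rdot gL gL; split.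
  under eq_fun do rewrite cnormE.
  apply: (@measurableT_comp _ _ _ _ _ _ (@Num.sqrt R)).
    by apply: continuous_measurable_fun; exact: sqrt_continuous.
  by apply: measurable_rdot; exact: vL2_measurable.
under eq_integral do rewrite cnorm_sqr.
exact: integrable_lty I.
Qed.

Definition vnorm2 g : R := sqnorm mu U (fun x => cnorm (g x)).

Lemma vnorm2_ge0 g : 0 <= vnorm2 g. Proof. exact: sqnorm_ge0. Qed.

Lemma vnorm2E g : vnorm2 g = (\int[mu]_(x in U) rdot (g x) (g x))%R.
Proof. by apply: eq_Rintegral => x _; rewrite cnorm_sqr. Qed.

Lemma energyE g : vL2 g -> energy U g = (vnorm2 g)%:E.
Proof. by move=> gL; rewrite /energy -EFin_sqnorm//; exact: vL2_cnorm. Qed.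

Lemma ae_le_Rintegral (f k : E -> R) : mu.-integrable U (EFin \o f) -> mu.-integrable U (EFin \o k) ->
  {ae mu, forall x, U x -> f x <= k x} ->
  (\int[mu]_(x in U) f x)%R <= (\int[mu]_(x in U) k x)%R.
Proof.
move=> If Ik fk; rewrite -subr_ge0 -RintegralB//.
have mf : measurable_fun U f by apply/measurable_EFinP; exact: measurable_int If.
have mk : measurable_fun U k by apply/measurable_EFinP; exact: measurable_int Ik.
rewrite /Rintegral (ae_eq_integral (fun x => (`|k x - f x|)%:E))//.
- by apply: fine_ge0; apply: integral_ge0 => x _; rewrite lee_fin.
- by apply/measurable_EFinP; apply: measurable_funB.
- by apply/measurable_EFinP; apply: measurableT_comp => //; apply: measurable_funB.
- by move: fk; apply: filterS => x H Ux; rewrite ger0_norm// subr_ge0; exact: H.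
Qed.

Definition bform M g h : R := (\int[mu]_(x in U) rdot (M x *m g x) (h x))%R.

Definition bounded_coef M (K : R) := (forall i j, cmeasurable U (fun x => M x i j)) /\
  {ae mu, forall x, U x -> opnorm (M x) <= K}.

Lemma integrable_bform M K g h : 0 <= K -> bounded_coef M K -> vL2 g -> vL2 h ->
  mu.-integrable U (EFin \o (fun x => rdot (M x *m g x) (h x))).
Proof.
move=> K0 [mM bM] gL hL.
have Ic := sqintM_integrable mU (vL2_cnorm gL) (vL2_cnorm hL).
have mB : measurable_fun U (fun x => rdot (M x *m g x) (h x)).
  apply: measurable_rdot; last exact: vL2_measurable.
  by apply: vmeasurable_mulmx => //; exact: vL2_measurable.
apply/integrableP; split; first exact/measurable_EFinP.
apply: (@le_lt_trans _ _ (\int[mu]_(x in U) (K%:E * (cnorm (g x) * cnorm (h x))%:E))%E).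
  apply: ae_ge0_le_integral => //.
  - by apply: measurableT_comp => //; exact/measurable_EFinP.
  - by move=> x _; apply: mule_ge0; rewrite lee_fin// mulr_ge0 ?cnorm_ge0.
  - by apply: measurable_funeM; exact: measurable_int Ic.
  - move: bM; apply: filterS => x bx Ux; rewrite /= -EFinM lee_fin.
    apply: (le_trans (rdot_opnorm _ _ _)); rewrite ler_wpM2r ?bx// mulr_ge0 ?cnorm_ge0//.
exact: integrable_lty (integrableZl mU K Ic).
Qed.

Lemma bform_bound M K g h : 0 <= K -> bounded_coef M K -> vL2 g -> vL2 h ->
  `|bform M g h| <= K * (Num.sqrt (vnorm2 g) * Num.sqrt (vnorm2 h)).
Proof.
move=> K0 bM gL hL; have IB := integrable_bform K0 bM gL hL.
have Ic := sqintM_integrable mU (vL2_cnorm gL) (vL2_cnorm hL).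
apply: (le_trans (le_normr_Rintegral mU IB)).
apply: (@le_trans _ _ (\int[mu]_(x in U) (K * (cnorm (g x) * cnorm (h x))))%R).
  apply: ae_le_Rintegral.
  - by have := integrable_abse IB.
  - by have := integrableZl mU K Ic.
  - case: bM => _; apply: filterS => x bx Ux.
    by apply: (le_trans (rdot_opnorm _ _ _)); rewrite ler_wpM2r ?bx// mulr_ge0 ?cnorm_ge0.
rewrite RintegralZl// ler_wpM2l//.
apply: le_trans (integral_cauchy_norm mU (vL2_cnorm gL) (vL2_cnorm hL)).
exact: ler_norm.
Qed.

Lemma bform_linl M K (a : R) g1 g2 h : 0 <= K -> bounded_coef M K -> vL2 g1 -> vL2 g2 -> vL2 h ->
  bform M (fun x => Complex a 0 *: g1 x + g2 x) h = a * bform M g1 h + bform M g2 h.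
Proof.
move=> K0 bM L1 L2 Lh.
have I1 := integrable_bform K0 bM L1 Lh; have I2 := integrable_bform K0 bM L2 Lh.
rewrite /bform -RintegralZl// -RintegralD//; last by have := integrableZl mU a I1.
by apply: eq_Rintegral => x _; rewrite mulmxDr -scalemxAr rdot_linl.
Qed.

Lemma bform_linr M K (a : R) g1 g2 h : 0 <= K -> bounded_coef M K -> vL2 g1 -> vL2 g2 -> vL2 h ->
  bform M h (fun x => Complex a 0 *: g1 x + g2 x) = a * bform M h g1 + bform M h g2.
Proof.
move=> K0 bM L1 L2 Lh.
have I1 := integrable_bform K0 bM Lh L1; have I2 := integrable_bform K0 bM Lh L2.
rewrite /bform -RintegralZl// -RintegralD//; last by have := integrableZl mU a I1.
by apply: eq_Rintegral => x _; rewrite rdot_linr.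
Qed.

Lemma bform_sub M N K K' g h : 0 <= K -> 0 <= K' -> bounded_coef M K -> bounded_coef N K' ->
  vL2 g -> vL2 h -> bform (fun x => M x - N x) g h = bform M g h - bform N g h.
Proof.
move=> K0 K'0 bM bN gL hL; rewrite /bform -RintegralB//; last 2 first.
- exact: (integrable_bform K0 bM gL hL).
- exact: (integrable_bform K'0 bN gL hL).
by apply: eq_Rintegral => x _; rewrite mulmxBl rdotDl rdotNl.
Qed.

Lemma bformBl M K g1 g2 h : 0 <= K -> bounded_coef M K -> vL2 g1 -> vL2 g2 -> vL2 h ->
  bform M (fun x => g1 x - g2 x) h = bform M g1 h - bform M g2 h.
Proof.
move=> K0 bM L1 L2 Lh; rewrite /bform -RintegralB//; last 2 first.
- exact: (integrable_bform K0 bM L1 Lh).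
- exact: (integrable_bform K0 bM L2 Lh).
by apply: eq_Rintegral => x _; rewrite mulmxBr rdotDl rdotNl.
Qed.

Lemma bform_coercive M K (lambda : R) g : 0 <= K -> bounded_coef M K -> vL2 g ->
  {ae mu, forall x, U x -> forall xi : 'cV[R[i]]_d, lambda * cnorm xi ^+ 2 <= Re (cdot (M x *m xi) xi)} ->
  lambda * vnorm2 g <= bform M g g.
Proof.
move=> K0 bM gL el.
have Ic := sqint_sqr_integrable (vL2_cnorm gL).
rewrite /vnorm2 /sqnorm -RintegralZl//; apply: ae_le_Rintegral.
- by have := integrableZl mU lambda Ic.
- exact: (integrable_bform K0 bM gL gL).
- by move: el; apply: filterS => x H Ux; rewrite -Re_cdot; exact: H.
Qed.

(** For a space of test functions stable under multiplication by i, the complex form vanishes as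
    soon as the real one does. *)
Lemma form_bform M g h :
  Defs.form U M g h = Complex (bform M g h) (bform M g (fun x => Complex 0 1 *: h x)).
Proof.
rewrite /Defs.form /cintegral; congr Complex; apply: eq_Rintegral => x _.
  by rewrite Re_cdot.
by rewrite Im_cdot.
Qed.

Lemma vL2_lin (a b : R) g1 g2 : vL2 g1 -> vL2 g2 -> vL2 (fun x => Complex a b *: g1 x + g2 x).
Proof.
move=> L1 L2 i; apply/L2_sqint.
have r1 := vL2_Re i L1; have i1 := vL2_Im i L1; have r2 := vL2_Re i L2; have i2 := vL2_Im i L2.
split.
  rewrite (_ : (fun x => _) = (fun x => (a * Re (g1 x i ord0) + (- b) * Im (g1 x i ord0)) + Re (g2 x i ord0))).
    by apply: sqintD => //; apply: sqintD => //; apply: sqintZ.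
  by apply/funext => x; rewrite !mxE ReD ReM/= mulNr.
rewrite (_ : (fun x => _) = (fun x => (a * Im (g1 x i ord0) + b * Re (g1 x i ord0)) + Im (g2 x i ord0))).
  by apply: sqintD => //; apply: sqintD => //; apply: sqintZ.
by apply/funext => x; rewrite !mxE ImD ImM/=.
Qed.

Lemma vL2_0 : vL2 (fun _ => 0).
Proof.
move=> i; apply/L2_sqint.
have z : sqint mu U (fun _ => 0 : R).
  split; first exact: measurable_cst.
  by under eq_integral do rewrite expr0n/=; rewrite integral0.
by split; [under eq_fun do rewrite mxE|under eq_fun do rewrite mxE].
Qed.

Lemma vL2B g h : vL2 g -> vL2 h -> vL2 (fun x => g x - h x).
Proof.
move=> gL hL; have := vL2_lin (-1) 0 hL gL.
rewrite (_ : (fun x => _) = (fun x => g x - h x))//; apply/funext => x.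
have -> : Complex (-1) 0 = -1 :> R[i] by rewrite -[RHS]/(Complex _ _) oppr0.
by rewrite scaleN1r addrC.
Qed.

Lemma vnorm2D_le g h : vL2 g -> vL2 h ->
  vnorm2 (fun x => g x + h x) <= 2 * vnorm2 g + 2 * vnorm2 h.
Proof.
move=> gL hL.
have gh : vL2 (fun x => g x + h x).
  have := vL2_lin 1 0 gL hL; rewrite (_ : (fun x => _) = (fun x => g x + h x))//.
  by apply/funext => x; rewrite (_ : Complex 1 0 = 1)// scale1r.
have Ig := sqint_sqr_integrable (vL2_cnorm gL).
have Ih := sqint_sqr_integrable (vL2_cnorm hL).
have I1 : mu.-integrable U (EFin \o (fun x => 2 * cnorm (g x) ^+ 2)) by have := integrableZl mU 2 Ig.
have I2 : mu.-integrable U (EFin \o (fun x => 2 * cnorm (h x) ^+ 2)) by have := integrableZl mU 2 Ih.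
rewrite /vnorm2 /sqnorm -!RintegralZl// -RintegralD//.
apply: le_Rintegral => //.
- exact: sqint_sqr_integrable (vL2_cnorm gh).
- by have := integrableD mU I1 I2.
- by move=> x _; exact: cnormD_sqr_le.
Qed.

End vector_fields.

Lemma Linf_bound (R : realType) (d : nat) (O : set 'rV[R]_d) (A : 'rV[R]_d -> 'M[R[i]]_d) (e : R) :
  (Linf_norm O A < e%:E)%E -> {ae lebesgue_rV R d, forall x, O x -> opnorm (A x) <= e}.
Proof.
move=> Ae; have := ess_sup_ge (lebesgue_rV R d) (fun x => (\1_O x * opnorm (A x))%:E).
apply: filterS => x H Ox; rewrite -lee_fin; apply: le_trans (ltW Ae); apply: le_trans H.
by rewrite indicE mem_set// mul1r.
Qed.

Lemma Linf_bounded_coef (R : realType) (d : nat) (O U : set 'rV[R]_d) (A : 'rV[R]_d -> 'M[R[i]]_d) :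
  measurable O -> measurable U -> U `<=` O ->
  Linf O A -> exists2 K : R, 0 <= K & bounded_coef U A K.
Proof.
move=> mO mU UO [mA Aoo].
have [K K0 AK] : exists2 K : R, 0 <= K & (Linf_norm O A < K%:E)%E.
  case : (Linf_norm O A) Aoo => [r||]// _; last by exists 0; rewrite ?ltNyr.
  by exists (`|r| + 1); rewrite ?addr_ge0// lte_fin ltr_pwDr// ler_norm.
exists K => //; split.
  move=> i j; have [mr mi] := mA i j.
  by split; [exact: measurable_funS mr|exact: measurable_funS mi].
by move: (Linf_bound AK); apply: filterS => x H Ux; apply: H; exact: UO.
Qed.

(** * Sobolev functions *)

Section sobolev_test_functions.
Context (R : realType) (d : nat).
Local Notation E := 'rV[R]_d.
Local Notation mu := (lebesgue_rV R d).
Local Notation Re := (@complex.Re R).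
Local Notation Im := (@complex.Im R).
Implicit Types (U W F O D : set E) (f : E -> R) (phi : (E -> R) * (E -> R)).

Lemma Rintegral_support U V (f : E -> R) : U `<=` V -> (forall x, V x -> ~ U x -> f x = 0) ->
  (\int[mu]_(x in V) f x = \int[mu]_(x in U) f x)%R.
Proof.
move=> UV f0; rewrite /Rintegral; congr fine; rewrite integral_mkcond [RHS]integral_mkcond.
apply: eq_integral => x _; rewrite !patchE.
case: (boolP (x \in U)) => xU; first by rewrite mem_set//; apply: UV; rewrite -inE.
case: ifPn => // xV; rewrite f0//; first by rewrite -inE.
by move=> /mem_set; rewrite (negbTE xU).
Qed.

Lemma ccfun_sqint U f : measurable U -> ccfun f -> sqint mu U f.
Proof.
move=> mU cf; split; first exact: ccfun_measurable.
have := integrable_lty mU (ccfun_integrable mU (ccfunM cf cf.1)).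
by under eq_integral do rewrite /= -expr2.
Qed.

Lemma integral_by_parts U W f g (i : 'I_d) : measurable U -> test_fun U f -> test_fun W g ->
  (\int[mu]_(x in U) (g x * partial f i x) = - \int[mu]_(x in U) (partial g i x * f x))%R.
Proof.
move=> mU tf tg; have cf := ccfun_test tf; have cg := ccfun_test tg.
have cf' := ccfun_partial i tf; have cg' := ccfun_partial i tg.
have outU h x : [set: E] x -> ~ U x -> h x * f x = 0.
  by move=> _ nUx; rewrite (@supp_out _ _ f) ?mulr0// => /(test_fun_supp tf).
have outU' h x : [set: E] x -> ~ U x -> h x * partial f i x = 0.
  by move=> _ nUx; rewrite (@partial_out _ _ f) ?mulr0// => /(test_fun_supp tf).
rewrite -(Rintegral_support (@subsetT _ U) (outU' g)) -(Rintegral_support (@subsetT _ U) (outU (partial g i))).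
apply/eqP; rewrite -addr_eq0 -RintegralD//; last 2 first.
- exact: (ccfun_integrable measurableT (ccfunM cg cf'.1)).
- exact: (ccfun_integrable measurableT (ccfunM cg' cf.1)).
rewrite -(integral_partial_eq0 i (test_funM tf (test_fun_smooth tg))); apply/eqP.
apply: eq_Rintegral => x _.
rewrite partialM; [|exact: test_fun_smooth tf 1|exact: test_fun_smooth tg 1].
by rewrite addrC [_ * f x]mulrC.
Qed.

(** Local test functions become functions on the whole space supported in the ball off [D]. The part
    of the support in the closure of [U] is compact and inside the open ball, so a cut-off equal to
    1 there changes nothing on that closure. *)
Lemma cutoff_test_fun O D x (s : R) f : D `<=` bd O ->
  let U := loc O x s in
  test_fun (~` (bd U `\` loc (neumann O D) x s)) f ->
  exists2 f', test_fun (eball x s `\` D) f' & forall y, closure U y -> f' y = f y.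
Proof.
move=> DO /= tf; set U := loc O x s in tf *; set F := _ `\` _ in tf.
have cn := @continuous_enormB R d x.
have oB := @open_eball _ _ x s.
(* [F] contains [D] inside the ball, and all of [closure U] outside of it *)
have bdB y : closure O y -> eball x s y -> closure U y.
  move=> cO By V nV; have [z [Oz [Vz Bz]]] := cO _ (filterI nV (open_nbhs_nbhs (conj oB By))).
  by exists z.
have DF y : D y -> eball x s y -> F y.
  move=> Dy By; have [cO nO] := DO _ Dy; split; last by move=> [[_]].
  split; first exact: bdB.
  by apply: contra_not nO; apply: interiorS => z [].
pose K := supp f `&` closure U.
have cK : compact K.
  apply: (subclosed_compact _ (test_fun_compact tf)); last by move=> y [].
  by apply: closedI; exact: closed_closure.
have KB : K `<=` eball x s.
  move=> y [sy cUy]; apply: contrapT => nBy; apply: (test_fun_supp tf sy); split.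
    by split => // /interior_subset[].
  by move=> [].
have [r [r0 rs Kr]] : exists r : R, [/\ 0 <= r, r < s \/ K = set0 & forall y, K y -> enorm (y - x) <= r].
  have [K0|/set0P[y0 Ky0]] := eqVneq K set0.
    by exists 0; split => //; [right|rewrite K0].
  have [y Ky yK] := @EVT_max_rV _ _ (fun y => enorm (y - x)) K (ex_intro _ y0 Ky0) cK (continuous_subspaceT cn).
  exists (enorm (y - x)); split; [exact: enorm_ge0|left; apply: KB; exact: set_mem|move=> z Kz].
  by apply: yK; exact: mem_set.
case: rs => [rs|K0]; last first.
  exists 0; first exact: test_fun0.
  by move=> y cUy; rewrite [RHS]supp_out// => sy; have : K y by []; rewrite K0.
have [r1 rs1] := midf_lt rs; set r' := (r + s) / 2 in r1 rs1.
have [chi [schi chi1 chi0]] := smooth_cutoff x r0 r1.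
have outchi y : r' <= enorm (y - x) -> chi y = 0.
  by move=> H; apply: chi0; rewrite -enorm_sqr ler_sqr ?nnegrE ?enorm_ge0// (le_trans r0 (ltW r1)).
exists (f * chi); last first.
  move=> y cUy; rewrite fctE; have [sy|/supp_out ->] := pselect (supp f y); last by rewrite mul0r.
  by rewrite chi1 ?mulr1// -enorm_sqr ler_sqr ?nnegrE ?enorm_ge0//; exact: Kr.
have [sf cf _] := test_funM tf schi; split => // y sy.
have sfy : supp f y.
  by move: y sy; apply: closureS => y /=; apply: contraNneq => H; rewrite fctE H mul0r.
have By : eball x s y.
  suff : enorm (y - x) <= r' by move=> H; exact: le_lt_trans H rs1.
  have cl : closed [set y | enorm (y - x) <= r'].
    rewrite (_ : [set _ | _] = (fun y => enorm (y - x)) @^-1` [set t | t <= r'])//.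
    by apply: closed_comp; [move=> z _; exact: cn|exact: closed_le].
  rewrite -/([set y | enorm (y - x) <= r'] y) ((closure_id _).1 cl).
  move: sy; apply: closureS => z /=; rewrite fctE; apply: contraNT; rewrite -ltNge => H.
  by rewrite outchi ?mulr0// ltW.
by split => // Dy; exact: (test_fun_supp tf sfy (DF _ Dy By)).
Qed.

End sobolev_test_functions.

(** Approximation errors are given as squared norms, hence the square root. *)
Lemma eq0_of_le_sqrt (R : realType) (x K : R) : 0 <= K -> (forall e, 0 < e -> `|x| <= K * Num.sqrt e) -> x = 0.
Proof.
move=> K0 H; apply/eqP; apply: contraT => x0.
have xp : 0 < `|x| by rewrite normr_gt0.
have K1 : 0 < 2 * (K + 1) by rewrite mulr_gt0// ltr_pwDr.
pose t := `|x| / (2 * (K + 1)); have t0 : 0 < t by rewrite divr_gt0.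
have := H _ (exprn_gt0 2 t0); rewrite sqrtr_sqr (ger0_norm (ltW t0)).
have -> : `|x| = 2 * (K + 1) * t by rewrite /t mulrC divfK// gt_eqF.
by rewrite ler_pM2r//; lra.
Qed.

Section sobolev_spaces.
Context (R : realType) (d : nat).
Local Notation E := 'rV[R]_d.
Local Notation mu := (lebesgue_rV R d).
Local Notation Re := (@complex.Re R).
Local Notation Im := (@complex.Im R).
Implicit Types (U W F O D : set E) (f : E -> R) (p q : (E -> R) * (E -> R))
  (u v : E -> R[i]) (g h : E -> 'cV[R[i]]_d).

(** Pairs of real functions form a module over [R], as [approx_lax_milgram] requires. *)
Definition toC (p : (E -> R) * (E -> R)) : E -> R[i] := fun x => Complex (p.1 x) (p.2 x).

Lemma ctest_L2 U W v : measurable U -> ctest_fun W v -> L2 U v.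
Proof.
move=> mU [tr ti]; apply/L2_sqint => //.
by split; apply: ccfun_sqint => //; [exact: ccfun_test tr|exact: ccfun_test ti].
Qed.

Lemma ctest_vL2 U W v : measurable U -> ctest_fun W v -> vL2 U (cgrad v).
Proof.
move=> mU [tr ti] i; apply/L2_sqint => //; split.
  under eq_fun do rewrite mxE/=.
  by apply: ccfun_sqint => //; exact: ccfun_partial tr.
under eq_fun do rewrite mxE/=.
by apply: ccfun_sqint => //; exact: ccfun_partial ti.
Qed.

Lemma cgrad_lin W1 W2 (a : R) p q x : ctest_fun W1 (toC p) -> ctest_fun W2 (toC q) ->
  cgrad (toC (a *: p + q)) x = Complex a 0 *: cgrad (toC p) x + cgrad (toC q) x.
Proof.
move=> [p1 p2] [q1 q2]; apply/matrixP => i j; rewrite !mxE /=.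
have E1 := partialD i x (CkZ a (test_fun_smooth p1 1)) (test_fun_smooth q1 1).
have E2 := partialD i x (CkZ a (test_fun_smooth p2 1)) (test_fun_smooth q2 1).
rewrite -[partial (fun y => (a *: p + q).1 y) i x]/(partial (a *: p.1 + q.1) i x) E1.
rewrite -[partial (fun y => (a *: p + q).2 y) i x]/(partial (a *: p.2 + q.2) i x) E2.
rewrite (partialZ a i x (test_fun_smooth p1 1)) (partialZ a i x (test_fun_smooth p2 1)).
rewrite -[RHS]/(Complex (_ + _) (_ + _)) /=; congr Complex; ring.
Qed.

Definition mul_i (p : (E -> R) * (E -> R)) : (E -> R) * (E -> R) := (- p.2, p.1).

Lemma ctest_mul_i W p : ctest_fun W (toC p) -> ctest_fun W (toC (mul_i p)).
Proof.
move=> [p1 p2]; split => //=.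
have := test_fun_lin (-1) p2 (test_fun0 W); rewrite addr0 scaleN1r; exact.
Qed.

Lemma cgrad_mul_i W p x : ctest_fun W (toC p) ->
  cgrad (toC (mul_i p)) x = Complex 0 1 *: cgrad (toC p) x.
Proof.
move=> [p1 p2]; apply/matrixP => i j; rewrite !mxE /=.
have E2 := partialZ (-1) i x (test_fun_smooth p2 1); rewrite scaleN1r in E2.
rewrite -[partial (fun y => (- p.2) y) i x]/(partial (- p.2) i x) E2.
rewrite -[RHS]/(Complex (_ - _) (_ + _)) /=; congr Complex; ring.
Qed.

Lemma L2B U u v : measurable U -> L2 U u -> L2 U v -> L2 U (fun x => u x - v x).
Proof.
move=> mU /(L2_sqint mU)[u1 u2] /(L2_sqint mU)[v1 v2]; apply/L2_sqint => //; split.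
  by under eq_fun do rewrite ReD ReN; exact: sqintB.
by under eq_fun do rewrite ImD ImN; exact: sqintB.
Qed.

Lemma H1_dist2E U u g v h : measurable U -> L2 U u -> vL2 U g -> L2 U v -> vL2 U h ->
  H1_dist2 U u g v h = (sqnorm mu U (fun x => Re (u x) - Re (v x)) +
    sqnorm mu U (fun x => Im (u x) - Im (v x)) + vnorm2 U (fun x => g x - h x)%R)%:E.
Proof.
move=> mU Lu Lg Lv Lh; have [u1 u2] := (L2_sqint mU u).1 Lu; have [v1 v2] := (L2_sqint mU v).1 Lv.
have s1 := sqintB mU u1 v1; have s2 := sqintB mU u2 v2; have s3 := vL2_cnorm mU (vL2B mU Lg Lh).
rewrite !EFinD /vnorm2 -!EFin_sqnorm//.
have msq f : sqint mu U f -> measurable_fun U (fun x => (f x ^+ 2)%:E).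
  by move=> sf; apply/measurable_EFinP; apply: measurable_funX; exact: sf.1.
have sq0 f x : U x -> (0 <= (f x ^+ 2)%:E)%E by rewrite lee_fin sqr_ge0.
rewrite -ge0_integralD//; try (by apply: msq); try exact: sq0.
rewrite -ge0_integralD//; try (by apply: msq); try exact: sq0.
- by apply: eq_integral => x _; rewrite normc_sqr ReD ReN ImD ImN !EFinD.
- by move=> x Ux; apply: adde_ge0; rewrite lee_fin sqr_ge0.
- by apply: emeasurable_funD; apply: msq.
Qed.

(** Integration by parts holds for each approximating test function, and both sides are continuous
    in L^2. *)
Lemma weak_partial_approx U (v g : E -> R) (i : 'I_d) : measurable U ->
  sqint mu U v -> sqint mu U g ->
  (forall e : R, 0 < e -> exists W (f : E -> R), [/\ test_fun W f, sqnorm mu U (fun x => v x - f x) <= e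
    & sqnorm mu U (fun x => g x - partial f i x) <= e]) ->
  forall f, test_fun U f ->
  (\int[mu]_(x in U) (v x * partial f i x) = - \int[mu]_(x in U) (g x * f x))%R.
Proof.
move=> mU sv sg H f tf.
have sf := ccfun_sqint mU (ccfun_test tf); have sf' := ccfun_sqint mU (ccfun_partial i tf).
apply/eqP; rewrite -addr_eq0; apply/eqP.
apply: (@eq0_of_le_sqrt _ _ (Num.sqrt (sqnorm mu U (partial f i)) + Num.sqrt (sqnorm mu U f))).
  by rewrite addr_ge0// sqrtr_ge0.
move=> e e0; have [W [k [tk k1 k2]]] := H e e0.
have sk := ccfun_sqint mU (ccfun_test tk); have sk' := ccfun_sqint mU (ccfun_partial i tk).
have -> : (\int[mu]_(x in U) (v x * partial f i x))%R =
    (\int[mu]_(x in U) ((v x - k x) * partial f i x))%R + (\int[mu]_(x in U) (k x * partial f i x))%R.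
  rewrite -RintegralD//; [|exact: (sqintM_integrable mU (sqintB mU sv sk) sf')|exact: (sqintM_integrable mU sk sf')].
  by apply: eq_Rintegral => x _; rewrite -mulrDl subrK.
have -> : (\int[mu]_(x in U) (g x * f x))%R =
    (\int[mu]_(x in U) ((g x - partial k i x) * f x))%R + (\int[mu]_(x in U) (partial k i x * f x))%R.
  rewrite -RintegralD//; [|exact: (sqintM_integrable mU (sqintB mU sg sk') sf)|exact: (sqintM_integrable mU sk' sf)].
  by apply: eq_Rintegral => x _; rewrite -mulrDl subrK.
rewrite (integral_by_parts i mU tf tk) addrACA addNr addr0.
rewrite mulrDl; apply: (le_trans (ler_normD _ _)); apply: lerD.
  apply: (le_trans (integral_cauchy_norm mU (sqintB mU sv sk) sf')).
  by rewrite mulrC ler_wpM2l ?sqrtr_ge0// ler_wsqrtr.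
apply: (le_trans (integral_cauchy_norm mU (sqintB mU sg sk') sf)).
by rewrite mulrC ler_wpM2l ?sqrtr_ge0// ler_wsqrtr.
Qed.

Lemma sqnorm_le_vnorm2 U g (i : 'I_d) : measurable U -> vL2 U g ->
  sqnorm mu U (fun x => Re (g x i ord0)) <= vnorm2 U g /\
  sqnorm mu U (fun x => Im (g x i ord0)) <= vnorm2 U g.
Proof.
move=> mU Lg; have Ic := sqint_sqr_integrable (vL2_cnorm mU Lg).
have c x : Re (g x i ord0) ^+ 2 + Im (g x i ord0) ^+ 2 <= cnorm (g x) ^+ 2.
  rewrite cnorm_sqr /rdot (bigD1 i)//= -!expr2 lerDl.
  by apply: sumr_ge0 => j _; rewrite -!expr2 addr_ge0 ?sqr_ge0.
split; apply: le_Rintegral => //.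
- exact: sqint_sqr_integrable (vL2_Re mU i Lg).
- by move=> x _; apply: le_trans (c x); rewrite lerDl sqr_ge0.
- exact: sqint_sqr_integrable (vL2_Im mU i Lg).
- by move=> x _; apply: le_trans (c x); rewrite lerDr sqr_ge0.
Qed.

(** In the converse direction [g] is not assumed to be a gradient of [u]: this is inherited from the
    approximating test functions. *)
Lemma H1_vanishingP U F u g : measurable U -> L2 U u -> vL2 U g ->
  (H1_vanishing U F u g <-> forall e : R, 0 < e -> exists2 v, ctest_fun (~` F) v &
    (H1_dist2 U u g v (cgrad v) <= e%:E)%E).
Proof.
move=> mU Lu Lg; split=> [[_ [v_ [tv cv]]] e e0|H].
  have : \forall y \near (0 : \bar R), (y < e%:E)%E by exact: nbhs_open_ereal_lt.
  move=> /cv[N _ /(_ N (leqnn N))/= HN].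
  by exists (v_ N) => //; exact: ltW.
have wg : weak_grad U u g.
  move=> f i tf; have [u1 u2] := (L2_sqint mU u).1 Lu.
  have app e : 0 < e -> exists v, [/\ ctest_fun (~` F) v,
      sqnorm mu U (fun x => Re (u x) - Re (v x)) <= e,
      sqnorm mu U (fun x => Im (u x) - Im (v x)) <= e &
      vnorm2 U (fun x => g x - cgrad v x) <= e].
    move=> e0; have [v tv] := H e e0; have Lv := ctest_L2 mU tv; have Lv' := ctest_vL2 mU tv.
    rewrite H1_dist2E// lee_fin => le; exists v.
    have n1 := sqnorm_ge0 mu U (fun x => Re (u x) - Re (v x)).
    have n2 := sqnorm_ge0 mu U (fun x => Im (u x) - Im (v x)).
    have n3 := vnorm2_ge0 U (fun x => g x - cgrad v x).
    by split => //; move: le n1 n2 n3; clear; lra.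
  have eRe : (\int[mu]_(x in U) (Re (u x) * partial f i x) = - \int[mu]_(x in U) (Re (g x i ord0) * f x))%R.
    apply: weak_partial_approx => //; first exact: vL2_Re.
    move=> e e0; have [v [tv h1 _ h3]] := app e e0; exists (~` F), (fun x => Re (v x)).
    split => //; first by have [] := tv.
    apply: le_trans h3; have [+ _] := sqnorm_le_vnorm2 i mU (vL2B mU Lg (ctest_vL2 mU tv)).
    by under eq_fun do rewrite !mxE ReD ReN/=.
  have eIm : (\int[mu]_(x in U) (Im (u x) * partial f i x) = - \int[mu]_(x in U) (Im (g x i ord0) * f x))%R.
    apply: weak_partial_approx => //; first exact: vL2_Im.
    move=> e e0; have [v [tv _ h2 h3]] := app e e0; exists (~` F), (fun x => Im (v x)).
    split => //; first by have [] := tv.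
    apply: le_trans h3; have [_ +] := sqnorm_le_vnorm2 i mU (vL2B mU Lg (ctest_vL2 mU tv)).
    by under eq_fun do rewrite !mxE ImD ImN/=.
  rewrite /cintegral -[RHS]/(Complex (- _) (- _)); congr Complex.
    transitivity (\int[mu]_(x in U) (Re (u x) * partial f i x))%R.
      by apply: eq_Rintegral => x _; rewrite ReM/= mulr0 subr0.
    by rewrite eRe; congr (- _); apply: eq_Rintegral => x _; rewrite ReM/= mulr0 subr0.
  transitivity (\int[mu]_(x in U) (Im (u x) * partial f i x))%R.
    by apply: eq_Rintegral => x _; rewrite ImM/= mulr0 add0r.
  by rewrite eIm; congr (- _); apply: eq_Rintegral => x _; rewrite ImM/= mulr0 add0r.
split; first by [].
have /choice[v_ Hv] : forall n : nat, exists v, ctest_fun (~` F) v /\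
    (H1_dist2 U u g v (cgrad v) <= n.+1%:R^-1%:E)%E.
  by move=> n; have [|v tv vn] := H n.+1%:R^-1; [rewrite invr_gt0|exists v].
exists v_; split; first by move=> n; have [] := Hv n.
apply: (@squeeze_cvge _ _ _ _ (cst 0%E) _ (fun n => n.+1%:R^-1%:E)).
- apply: nearW => n; apply/andP; split; last by have [] := Hv n.
  by apply: integral_ge0 => x _; rewrite lee_fin addr_ge0// sqr_ge0.
- exact: cvg_cst.
- apply: cvg_EFin; first by apply: nearW => n.
  exact: cvg_harmonic.
Qed.

End sobolev_spaces.

(** * Weak solutions *)

Section weak_solutions.
Context (R : realType) (d : nat).
Local Notation E := 'rV[R]_d.
Local Notation mu := (lebesgue_rV R d).
Local Notation Re := (@complex.Re R).
Local Notation Im := (@complex.Im R).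
Implicit Types (U V W F O D : set E) (f : E -> R) (w : (E -> R) * (E -> R)) (u v : E -> R[i])
  (g h : E -> 'cV[R[i]]_d) (A : E -> 'M[R[i]]_d).

Lemma L2S U V u : measurable U -> measurable V -> U `<=` V -> L2 V u -> L2 U u.
Proof.
move=> mU mV UV /(L2_sqint mV)[[m1 f1] [m2 f2]]; apply/L2_sqint => //.
have sub f : measurable_fun V f -> (\int[mu]_(x in V) (f x ^+ 2)%:E < +oo)%E -> sqint mu U f.
  move=> mf lt; split; first exact: measurable_funS mf.
  apply: le_lt_trans lt; apply: ge0_subset_integral => //.
    by apply/measurable_EFinP; exact: measurable_funX.
  by move=> x _; rewrite lee_fin sqr_ge0.
by split; exact: sub.
Qed.

Lemma vL2S U V g : measurable U -> measurable V -> U `<=` V -> vL2 V g -> vL2 U g.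
Proof. by move=> mU mV UV gL i; exact: L2S (gL i). Qed.

Lemma bounded_coefS U V A (K : R) : measurable V -> U `<=` V -> bounded_coef V A K -> bounded_coef U A K.
Proof.
move=> mV UV [mA bA]; split.
  by move=> i j; have [mr mi] := mA i j; split; [exact: measurable_funS mr|exact: measurable_funS mi].
by move: bA; apply: filterS => x H Ux; apply: H; exact: UV.
Qed.

Lemma cgrad_out W v x : ctest_fun W v -> ~ W x -> cgrad v x = 0.
Proof.
move=> [t1 t2] nWx; apply/matrixP => i j; rewrite !mxE !partial_out//.
  by move=> /(test_fun_supp t2).
by move=> /(test_fun_supp t1).
Qed.

Lemma rdot0r (xi : 'cV[R[i]]_d) : rdot xi 0 = 0.
Proof. by apply: big1 => i _; rewrite !mxE/= !mulr0 addr0. Qed.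

Lemma bform_support U V A g h : U `<=` V -> (forall x, V x -> ~ U x -> h x = 0) ->
  bform V A g h = bform U A g h.
Proof. by move=> UV h0; apply: Rintegral_support => // x Vx Ux; rewrite h0// rdot0r. Qed.

Lemma vnorm2_support U V h : U `<=` V -> (forall x, V x -> ~ U x -> h x = 0) ->
  vnorm2 V h = vnorm2 U h.
Proof. by move=> UV h0; apply: Rintegral_support => // x Vx Ux; rewrite h0// cnorm0 expr0n. Qed.

Lemma vnorm2_i U g : vnorm2 U (fun x => Complex 0 1 *: g x) = vnorm2 U g.
Proof.
rewrite !vnorm2E; apply: eq_Rintegral => x _; apply: eq_bigr => i _.
by rewrite mxE ReM ImM/=; ring.
Qed.

Lemma bform_eq0_of_approx U A (K : R) g h : measurable U -> 0 <= K -> bounded_coef U A K ->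
  vL2 U g -> vL2 U h ->
  (forall e : R, 0 < e -> exists h', [/\ vL2 U h', bform U A g h' = 0 & vnorm2 U (fun x => h x - h' x) <= e]) ->
  bform U A g h = 0.
Proof.
move=> mU K0 bA Lg Lh H; apply: (@eq0_of_le_sqrt _ _ (K * Num.sqrt (vnorm2 U g))).
  by rewrite mulr_ge0// sqrtr_ge0.
move=> e e0; have [h' [Lh' z le]] := H e e0; have Lhh' := vL2B mU Lh Lh'.
have -> : bform U A g h = bform U A g (fun x => h x - h' x).
  rewrite -[RHS]addr0 -z -[X in _ = X + _]mul1r -(bform_linr mU 1 K0 bA Lhh' Lh' Lg).
  by congr bform; apply/funext => x; rewrite (_ : Complex 1 0 = 1)// scale1r subrK.
apply: (le_trans (bform_bound mU K0 bA Lg Lhh')).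
by rewrite -mulrA ler_wpM2l// ler_wpM2l ?sqrtr_ge0// ler_wsqrtr.
Qed.

Lemma H1_dist2xx U u g : H1_dist2 U u g u g = 0%E.
Proof.
by apply: integral0_eq => x _; rewrite !subrr cnorm0 normc_sqr/= expr0n !addr0.
Qed.

(** The local equation is tested over all of [O] with functions supported in the ball off [D]. These
    form a vector space that grows with the ball, so restriction to smaller balls is immediate, and
    the Poincaré inequality holds on it for small balls. *)
Lemma weak_solutionP O D A (K : R) x s gu : open O -> D `<=` bd O -> 0 <= K ->
  bounded_coef O A K -> vL2 O gu ->
  (weak_solution O D A x s gu <->
   forall w, ctest_fun (eball x s `\` D) (toC w) -> bform O A gu (cgrad (toC w)) = 0).
Proof.
move=> oO DO K0 bA Lgu; set U := loc O x s.
have mO := open_measurable_rV oO.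
have oU : open U by apply: openI => //; exact: open_eball.
have mU := open_measurable_rV oU.
have UO : U `<=` O by move=> y [].
have bAU := bounded_coefS mO UO bA.
have LU := vL2S mU mO UO Lgu.
have toU w : ctest_fun (eball x s `\` D) (toC w) ->
    bform O A gu (cgrad (toC w)) = bform U A gu (cgrad (toC w)).
  move=> tw; apply: bform_support => // y Oy nUy; apply: cgrad_out tw _ => -[By _].
  by apply: nUy.
rewrite {1}/weak_solution -/U; split=> [sol w tw|H phi gphi].
  rewrite toU//.
  have tF : ctest_fun (~` (bd U `\` loc (neumann O D) x s)) (toC w).
    (* Inside the ball the boundary points of [U] are boundary points of [O]; off [D] they belong to
       N(x, s). *)
    suff sub : eball x s `\` D `<=` ~` (bd U `\` loc (neumann O D) x s).
      by case: tw => t1 t2; split; [exact: test_funS t1|exact: test_funS t2].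
    move=> y [By nDy] [[cU nU] nN]; apply: nN; split => //; split => //; split.
      by move: y cU {By nDy nU}; exact: closureS.
    apply: contra_not nU => iO; rewrite /U /loc interiorI; split => //.
    by rewrite (interior_id _).1//; exact: open_eball.
  have := sol (toC w) (cgrad (toC w)); rewrite form_bform => S.
  have /S[] // : H1_vanishing U (bd U `\` loc (neumann O D) x s) (toC w) (cgrad (toC w)).
  apply: (H1_vanishingP _ mU (ctest_L2 mU tw) (ctest_vL2 mU tw)).2 => e e0.
  by exists (toC w) => //; rewrite H1_dist2xx lee_fin ltW.
move=> Hv; have [[Lphi Lgphi _] _] := Hv.
have app e : 0 < e -> exists2 w, ctest_fun (eball x s `\` D) (toC w) &
    vnorm2 U (fun y => gphi y - cgrad (toC w) y) <= e.
  move=> e0; have [v tv] := (H1_vanishingP _ mU Lphi Lgphi).1 Hv e e0.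
  rewrite H1_dist2E//; [|exact: ctest_L2 tv|exact: ctest_vL2 tv].
  rewrite lee_fin => le.
  (* The approximating function is unchanged near each point of the open set [U], so its gradient
     there is unchanged as well. *)
  have [f1 tf1 e1] := cutoff_test_fun DO tv.1.
  have [f2 tf2 e2] := cutoff_test_fun DO tv.2.
  exists (f1, f2) => //.
  have -> : vnorm2 U (fun y => gphi y - cgrad (toC (f1, f2)) y) = vnorm2 U (fun y => gphi y - cgrad v y).
    rewrite !vnorm2E; apply: eq_Rintegral => y; rewrite inE => Uy.
    have -> // : cgrad (toC (f1, f2)) y = cgrad v y.
    have near_partial f f' i : (forall z, closure U z -> f' z = f z) -> partial f' i y = partial f i y.
      move=> ff; apply: near_eq_derive.
      by apply: filterS (open_nbhs_nbhs (conj oU Uy)) => z Uz; apply: ff; exact: subset_closure.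
    apply/matrixP => i j; rewrite !mxE; congr Complex; exact: near_partial.
  apply: le_trans le; rewrite lerDr addr_ge0//; exact: sqnorm_ge0.
rewrite form_bform.
suff [-> ->] : bform U A gu gphi = 0 /\ bform U A gu (fun y => Complex 0 1 *: gphi y) = 0 by [].
split; apply: (bform_eq0_of_approx mU K0 bAU LU) => //.
- move=> e e0; have [w tw le] := app e e0; exists (cgrad (toC w)).
  by split; [exact: ctest_vL2 tw|rewrite -(toU _ tw); exact: H|exact: le].
- have := vL2_lin mU 0 1 Lgphi (vL2_0 mU).
  by under eq_fun do rewrite addr0.
- move=> e e0; have [w tw le] := app e e0; exists (cgrad (toC (mul_i w))); have tw' := ctest_mul_i tw.
  split; [exact: ctest_vL2 tw'|by rewrite -(toU _ tw'); exact: H|].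
  rewrite (_ : (fun y => _) = (fun y => Complex 0 1 *: (gphi y - cgrad (toC w) y))) ?vnorm2_i//.
  by apply/funext => y; rewrite (cgrad_mul_i _ tw) scalerBr.
Qed.

End weak_solutions.

Section completeness.
Context (R : realType) (d : nat).
Local Notation E := 'rV[R]_d.
Local Notation mu := (lebesgue_rV R d).
Local Notation Re := (@complex.Re R).
Local Notation Im := (@complex.Im R).
Variables (U : set E) (mU : measurable U).
Implicit Types (f : E -> R) (w : (E -> R) * (E -> R)) (g h : E -> 'cV[R[i]]_d).

Lemma vnorm2_sum g : vL2 U g ->
  vnorm2 U g = \sum_(i < d) (sqnorm mu U (fun x => Re (g x i ord0)) + sqnorm mu U (fun x => Im (g x i ord0))).
Proof.
move=> Lg; apply: EFin_inj; rewrite -EFin_sqnorm//; last exact: vL2_cnorm.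
rewrite -sumEFin.
have m i : measurable_fun U (fun x => (Re (g x i ord0) ^+ 2 + Im (g x i ord0) ^+ 2)%:E).
  apply/measurable_EFinP; apply: measurable_funD; apply: measurable_funX.
    exact: (vL2_Re mU i Lg).1.
  exact: (vL2_Im mU i Lg).1.
transitivity (\int[mu]_(x in U) (\sum_(i < d) (Re (g x i ord0) ^+ 2 + Im (g x i ord0) ^+ 2)%:E))%E.
  by apply: eq_integral => x _; rewrite sumEFin cnorm_sqr.
rewrite ge0_integral_sum//; last by move=> i x _; rewrite lee_fin addr_ge0// sqr_ge0.
apply: eq_bigr => i _; rewrite EFinD -!EFin_sqnorm//; [|exact: vL2_Im|exact: vL2_Re].
under eq_integral do rewrite EFinD.
apply: ge0_integralD => //.
- by move=> x _; rewrite lee_fin sqr_ge0.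
- by apply/measurable_EFinP; apply: measurable_funX; exact: (vL2_Re mU i Lg).1.
- by move=> x _; rewrite lee_fin sqr_ge0.
- by apply/measurable_EFinP; apply: measurable_funX; exact: (vL2_Im mU i Lg).1.
Qed.

Lemma vL2_complete (g_ : nat -> E -> 'cV[R[i]]_d) : (forall n, vL2 U (g_ n)) ->
  (forall e : R, 0 < e -> exists N, forall m n, (N <= m)%N -> (N <= n)%N ->
    vnorm2 U (fun x => g_ m x - g_ n x) <= e) ->
  exists g, vL2 U g /\ forall e : R, 0 < e -> exists N, forall n, (N <= n)%N ->
    vnorm2 U (fun x => g_ n x - g x) <= e.
Proof.
move=> Lg Cg.
have Ld m n := vL2B mU (Lg m) (Lg n).
have /choice[a Ha] : forall i : 'I_d, exists a, sqint mu U a /\ forall e : R, 0 < e -> exists N, forall n,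
    (N <= n)%N -> sqnorm mu U (fun x => Re (g_ n x i ord0) - a x) <= e.
  move=> i; apply: sqint_complete => //; first by move=> n; exact: vL2_Re.
  move=> e /Cg[N HN]; exists N => m n Nm Nn; apply: le_trans (HN m n Nm Nn).
  by have [+ _] := sqnorm_le_vnorm2 i mU (Ld m n); under eq_fun do rewrite !mxE ReD ReN.
have /choice[b Hb] : forall i : 'I_d, exists a, sqint mu U a /\ forall e : R, 0 < e -> exists N, forall n,
    (N <= n)%N -> sqnorm mu U (fun x => Im (g_ n x i ord0) - a x) <= e.
  move=> i; apply: sqint_complete => //; first by move=> n; exact: vL2_Im.
  move=> e /Cg[N HN]; exists N => m n Nm Nn; apply: le_trans (HN m n Nm Nn).
  by have [_ +] := sqnorm_le_vnorm2 i mU (Ld m n); under eq_fun do rewrite !mxE ImD ImN.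
pose g x : 'cV[R[i]]_d := \col_i Complex (a i x) (b i x).
have Lg' : vL2 U g.
  move=> i; apply/L2_sqint => //; split.
    by under eq_fun do rewrite mxE/=; exact: (Ha i).1.
  by under eq_fun do rewrite mxE/=; exact: (Hb i).1.
exists g; split => // e e0.
pose e' : R := e / (d.+1%:R * 2).
have e'0 : 0 < e' by rewrite divr_gt0// mulr_gt0.
have /choice[N1 HN1] i := (Ha i).2 e' e'0.
have /choice[N2 HN2] i := (Hb i).2 e' e'0.
exists (\max_(i < d) N1 i + \max_(i < d) N2 i)%N => n Nn.
rewrite vnorm2_sum; last exact: vL2B.
have -> : e = d.+1%:R * (e' + e') by rewrite /e'; move: (d.+1%:R : R) (pnatr_eq0 R d.+1) => D /= /negbT D0; field.
apply: (@le_trans _ _ (\sum_(i < d) (e' + e'))).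
  apply: ler_sum => i _; apply: lerD.
    under eq_fun do rewrite !mxE ReD ReN/=; apply: HN1; apply: leq_trans Nn.
    by apply: leq_trans (leq_addr _ _); exact: leq_bigmax.
  under eq_fun do rewrite !mxE ImD ImN/=; apply: HN2; apply: leq_trans Nn.
  by apply: leq_trans (leq_addl _ _); exact: leq_bigmax.
by rewrite sumr_const card_ord -[leLHS]mulr_natl ler_wpM2r ?addr_ge0 ?(ltW e'0)// ler_nat.
Qed.

Definition vdot g h : R := (\int[mu]_(x in U) rdot (g x) (h x))%R.

Lemma vdotC g h : vdot g h = vdot h g.
Proof. by apply: eq_Rintegral => x _; rewrite rdotC. Qed.

Lemma vdot_linl (a : R) g1 g2 h : vL2 U g1 -> vL2 U g2 -> vL2 U h ->
  vdot (fun x => Complex a 0 *: g1 x + g2 x) h = a * vdot g1 h + vdot g2 h.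
Proof.
move=> L1 L2 Lh; have I1 := integrable_rdot mU L1 Lh; have I2 := integrable_rdot mU L2 Lh.
rewrite /vdot -RintegralZl// -RintegralD//; last by have := integrableZl mU a I1.
by apply: eq_Rintegral => x _; rewrite rdot_linl.
Qed.

End completeness.

(** * Correction to a solution of the unperturbed equation *)

(** An almost solution, or a difference of two, is tested with itself: [n] is the square of its
    norm, [l] the right-hand side, and [b1], [b2] the two forms, the second one being 0 for a single
    almost solution. *)
Lemma le_sqr_of_forms (R : realType) (lambda n l b1 b2 e1 e2 : R) : 0 < lambda -> 0 <= n -> 0 <= e1 -> 0 <= e2 ->
  lambda * n <= b1 - b2 -> `|l - b1| <= e1 * Num.sqrt n -> `|l - b2| <= e2 * Num.sqrt n ->
  n <= ((e1 + e2) / lambda) ^+ 2.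
Proof.
move=> lambda0 n0 e10 e20 co; rewrite !ler_norml => /andP[a1 a2] /andP[c1 c2].
have le : lambda * n <= (e1 + e2) * Num.sqrt n by lra.
have s0 := sqrtr_ge0 n.
have ns : Num.sqrt n ^+ 2 = n by rewrite sqr_sqrtr.
have : lambda * Num.sqrt n <= e1 + e2.
  have [->|sn] := eqVneq (Num.sqrt n) 0; first by rewrite mulr0 addr_ge0.
  have sp : 0 < Num.sqrt n by rewrite lt_neqAle eq_sym sn.
  by rewrite -(ler_pM2r sp) -mulrA -expr2 ns.
rewrite -ler_pdivlMl// mulrC => le'; rewrite -ns ler_sqr ?nnegrE//.
by rewrite divr_ge0 ?addr_ge0 ?(ltW lambda0).
Qed.

(** * Almost solutions and their limit *)

Section galerkin.
Context (R : realType) (d : nat).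
Local Notation E := 'rV[R]_d.
Local Notation mu := (lebesgue_rV R d).
Local Notation Re := (@complex.Re R).
Local Notation Im := (@complex.Im R).
Variables (O W : set E) (A : E -> 'M[R[i]]_d) (K lambda C : R).
Hypotheses (mO : measurable O) (K0 : 0 <= K) (bA : bounded_coef O A K) (lambda0 : 0 < lambda).
Hypothesis ellA : elliptic O A lambda.
Hypothesis C0 : 0 <= C.
Hypothesis poincareW : forall f, test_fun W f ->
  (\int[mu]_(y in O) (f y ^+ 2)%:E <= C%:E * \int[mu]_(y in O) (enorm2 (grad f y))%:E)%E.
Variables (gu : E -> 'cV[R[i]]_d) (Lgu : vL2 O gu).
Implicit Types (w z : (E -> R) * (E -> R)).

Let T w := ctest_fun W (toC w).
Let G w := cgrad (toC w).
Let LG w : T w -> vL2 O (G w). Proof. exact: ctest_vL2. Qed.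

Let T_lin (a : R) w z : T w -> T z -> T (a *: w + z).
Proof. by move=> [w1 w2] [z1 z2]; split; exact: test_fun_lin. Qed.

Let G_lin (a : R) w z : T w -> T z -> G (a *: w + z) = (fun y => Complex a 0 *: G w y + G z y).
Proof. by move=> tw tz; apply/funext => y; exact: (cgrad_lin a y tw tz). Qed.

Let G_sub w z : T w -> T z -> (fun y => G w y - G z y) = G (-1 *: z + w).
Proof.
move=> tw tz; rewrite G_lin//; apply/funext => y.
have -> : Complex (-1) 0 = -1 :> R[i] by rewrite -[RHS]/(Complex _ _) oppr0.
by rewrite scaleN1r addrC.
Qed.

(** The inner product involves gradients only, so coercivity is ellipticity alone and no constant of
    [O] enters. *)
Lemma galerkin (e : R) : 0 < e -> exists2 w, T w & forall z, T z ->
  `|bform O A gu (G z) - bform O A (G w) (G z)| <= e * Num.sqrt (vnorm2 O (G z)).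
Proof.
move=> e0.
have [||||||||||||||w Tw Hw] := @approx_lax_milgram R ((E -> R) * (E -> R))%type [set w | T w]
  (fun w z => vdot O (G w) (G z)) (fun w z => bform O A (G w) (G z))
  (fun z => bform O A gu (G z)) lambda K (K * Num.sqrt (vnorm2 O gu)) _ _ _ _ _ _ _ _ _ _ _ _ _ _ e e0.
- by split; exact: test_fun0.
- by move=> a w z; exact: T_lin.
- by move=> w z _ _; rewrite vdotC.
- by move=> a w z v Tw Tz Tv; rewrite G_lin// vdot_linl//; exact: LG.
- by move=> w _; rewrite /vdot -vnorm2E; exact: vnorm2_ge0.
- by move=> a w z v Tw Tz Tv; rewrite G_lin// (bform_linl mO a K0 bA)//; exact: LG.
- by move=> a w z v Tw Tz Tv; rewrite G_lin// (bform_linr mO a K0 bA)//; exact: LG.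
- by move=> a w z Tw Tz; rewrite G_lin// (bform_linr mO a K0 bA)//; exact: LG.
- exact: lambda0.
- by move=> w Tw; rewrite /vdot -vnorm2E; exact: (bform_coercive mO K0 bA (LG Tw) ellA).
- exact: K0.
- by move=> w z Tw Tz; rewrite /vdot -!vnorm2E; exact: (bform_bound mO K0 bA (LG Tw) (LG Tz)).
- by rewrite mulr_ge0// sqrtr_ge0.
- by move=> w Tw; rewrite /vdot -!vnorm2E -mulrA; exact: (bform_bound mO K0 bA Lgu (LG Tw)).
by exists w => // z Tz; have := Hw z Tz; rewrite /vdot -vnorm2E.
Qed.

Lemma galerkin_cauchy (e1 e2 : R) w1 w2 : 0 < e1 -> 0 < e2 -> T w1 -> T w2 ->
  (forall z, T z -> `|bform O A gu (G z) - bform O A (G w1) (G z)| <= e1 * Num.sqrt (vnorm2 O (G z))) ->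
  (forall z, T z -> `|bform O A gu (G z) - bform O A (G w2) (G z)| <= e2 * Num.sqrt (vnorm2 O (G z))) ->
  vnorm2 O (G (-1 *: w2 + w1)) <= ((e1 + e2) / lambda) ^+ 2.
Proof.
move=> e10 e20 T1 T2 H1 H2; have Tz := T_lin (-1) T2 T1.
have lin h : vL2 O h ->
    bform O A (G (-1 *: w2 + w1)) h = bform O A (G w1) h - bform O A (G w2) h.
  by move=> Lh; rewrite -G_sub//; exact: (bformBl mO K0 bA (LG T1) (LG T2) Lh).
apply: (le_sqr_of_forms lambda0 (vnorm2_ge0 _ _) (ltW e10) (ltW e20) _ (H1 _ Tz) (H2 _ Tz)).
apply: (le_trans (bform_coercive mO K0 bA (LG Tz) ellA)).
by rewrite (lin _ (LG Tz)).
Qed.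

Lemma poincare_pair w : T w ->
  sqnorm mu O w.1 <= C * vnorm2 O (G w) /\ sqnorm mu O w.2 <= C * vnorm2 O (G w).
Proof.
move=> Tw; have Ln := vL2_cnorm mO (LG Tw); have [t1 t2] := Tw.
have mc : measurable_fun O (fun y => (cnorm (G w y) ^+ 2)%:E).
  by apply/measurable_EFinP; apply: measurable_funX; exact: Ln.1.
have base (f : E -> R) : test_fun W f -> (forall y, enorm2 (grad f y) <= cnorm (G w y) ^+ 2) ->
    sqnorm mu O f <= C * vnorm2 O (G w).
  move=> tf le; rewrite -lee_fin EFinM -EFin_sqnorm//; last exact: ccfun_sqint (ccfun_test tf).
  apply: (le_trans (poincareW tf)); rewrite -EFin_sqnorm//.
  apply: lee_wpmul2l; first by rewrite lee_fin.
  apply: ge0_le_integral => //.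
  - by move=> y _; rewrite lee_fin enorm2_ge0.
  - apply/measurable_EFinP; apply: measurable_sum_ord => i.
    apply: measurable_funX; under eq_fun do rewrite mxE.
    exact: ccfun_measurable (ccfun_partial i tf).
  - by move=> y _; rewrite lee_fin.
split; (apply: base => // y; rewrite cnorm_sqr; apply: ler_sum => i _; rewrite !mxE/= expr2).
  by rewrite lerDl -expr2 sqr_ge0.
by rewrite lerDr -expr2 sqr_ge0.
Qed.

(** Coercivity makes the gradients of almost solutions a Cauchy sequence, and the Poincaré
    inequality does the same for the functions. Each [e] comes with one [w] having all the
    properties at once; its residual is bounded by the root of [e] because the other errors are
    squared norms. *)
Lemma galerkin_limit : exists (f1 f2 : E -> R) (gw : E -> 'cV[R[i]]_d),
  [/\ sqint mu O f1, sqint mu O f2, vL2 O gw & forall e, 0 < e -> exists w,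
    [/\ T w, forall z, T z -> `|bform O A gu (G z) - bform O A (G w) (G z)| <=
               Num.sqrt e * Num.sqrt (vnorm2 O (G z)),
        sqnorm mu O (fun y => w.1 y - f1 y) <= e, sqnorm mu O (fun y => w.2 y - f2 y) <= e
      & vnorm2 O (fun y => G w y - gw y) <= e]].
Proof.
have inv0 (n : nat) : 0 < (n.+1%:R : R)^-1 by rewrite invr_gt0.
have /choice[w_ Hw] : forall n : nat, exists w, T w /\ forall z, T z ->
    `|bform O A gu (G z) - bform O A (G w) (G z)| <= (n.+1%:R)^-1 * Num.sqrt (vnorm2 O (G z)).
  by move=> n; have [w] := galerkin (inv0 n); exists w.
have T_ n := (Hw n).1.
have cau e : 0 < e -> exists N, forall m n, (N <= m)%N -> (N <= n)%N ->
    vnorm2 O (G (-1 *: w_ n + w_ m)) <= e.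
  move=> e0.
  have t0 : 0 < lambda * Num.sqrt e / 2 by rewrite divr_gt0// mulr_gt0// sqrtr_gt0.
  have [N _ HN] := near_infty_natSinv_lt (PosNum t0).
  exists N => m n Nm Nn.
  apply: (le_trans (galerkin_cauchy (inv0 m) (inv0 n) (T_ m) (T_ n) (Hw m).2 (Hw n).2)).
  have := HN m Nm; have := HN n Nn => /= h1 h2.
  rewrite -[leRHS]sqr_sqrtr ?(ltW e0)//.
  rewrite ler_sqr ?nnegrE ?sqrtr_ge0 ?divr_ge0 ?addr_ge0 ?(ltW lambda0) ?(ltW (inv0 _))//.
  by rewrite ler_pdivrMr// mulrC [leRHS]splitr ltW// ltrD.
have cau0 e : 0 < e -> exists N, forall m n, (N <= m)%N -> (N <= n)%N ->
    sqnorm mu O (-1 *: w_ n + w_ m).1 <= e /\ sqnorm mu O (-1 *: w_ n + w_ m).2 <= e.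
  move=> e0; have C1 : 0 < C + 1 by rewrite ltr_pwDr.
  have [N HN] := cau (e / (C + 1)) (divr_gt0 e0 C1); exists N => m n Nm Nn.
  have le : C * vnorm2 O (G (-1 *: w_ n + w_ m)) <= e.
    apply: (@le_trans _ _ ((C + 1) * (e / (C + 1)))); last by rewrite mulrC divfK// gt_eqF.
    apply: ler_pM => //; [exact: vnorm2_ge0|by rewrite lerDl|exact: HN].
  have [p1 p2] := poincare_pair (T_lin (-1) (T_ n) (T_ m)).
  by split; [exact: le_trans p1 le|exact: le_trans p2 le].
have sub (f g : E -> R) : (fun y => f y - g y) = -1 *: g + f.
  by apply/funext => y; rewrite !fctE scaleN1r addrC.
have [|e /cau0[N HN]|w1 [s1 l1]] := @sqint_complete _ _ _ mu O mO (fun n => (w_ n).1).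
- by move=> n; exact: ccfun_sqint (ccfun_test (T_ n).1).
- by exists N => m n Nm Nn; rewrite sub; exact: (HN m n Nm Nn).1.
have [|e /cau0[N HN]|w2 [s2 l2]] := @sqint_complete _ _ _ mu O mO (fun n => (w_ n).2).
- by move=> n; exact: ccfun_sqint (ccfun_test (T_ n).2).
- by exists N => m n Nm Nn; rewrite sub; exact: (HN m n Nm Nn).2.
have [|e /cau[N HN]|gw [s3 l3]] := @vL2_complete _ _ O mO (fun n => G (w_ n)).
- by move=> n; exact: LG.
- by exists N => m n Nm Nn; rewrite G_sub//; exact: HN.
exists w1, w2, gw; split => // e e0.
have [N1 H1] := l1 e e0; have [N2 H2] := l2 e e0; have [N3 H3] := l3 e e0.
have t0 : 0 < Num.sqrt e by rewrite sqrtr_gt0.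
have [N4 _ H4] := near_infty_natSinv_lt (PosNum t0).
pose n := maxn (maxn N1 N2) (maxn N3 N4).
exists (w_ n); split.
- exact: T_.
- move=> z Tz; apply: (le_trans ((Hw n).2 z Tz)); rewrite ler_wpM2r ?sqrtr_ge0// ltW//.
  by apply: H4; rewrite /n /= !leq_max leqnn !orbT.
- by apply: H1; rewrite /n !leq_max leqnn.
- by apply: H2; rewrite /n !leq_max leqnn !orbT.
- by apply: H3; rewrite /n !leq_max leqnn !orbT.
Qed.

End galerkin.

Lemma le_of_double_sums (R : realType) (a1 a2 a3 b1 b2 b3 c1 c2 c3 e : R) :
  a1 + a2 + a3 <= e / 4 -> b1 <= e / 12 -> b2 <= e / 12 -> b3 <= e / 12 ->
  c1 <= 2 * a1 + 2 * b1 -> c2 <= 2 * a2 + 2 * b2 -> c3 <= 2 * a3 + 2 * b3 -> c1 + c2 + c3 <= e.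
Proof. by lra. Qed.

Lemma le_of_triangle (R : realType) (G n W Z e L q P t : R) : G <= 2 * n + 2 * W -> n <= Z ->
  Z <= 2 * e / L + 2 * q * P -> W <= e -> t = (4 / L + 2) * e -> G <= 4 * q * P + t.
Proof. by move=> h1 h2 h3 h4 ->; lra. Qed.

(** * Perturbation of the coefficients *)

Section comparison.
Context (R : realType) (d : nat).
Local Notation E := 'rV[R]_d.
Local Notation mu := (lebesgue_rV R d).
Local Notation Re := (@complex.Re R).
Local Notation Im := (@complex.Im R).
Implicit Types (O D U V : set E) (A : E -> 'M[R[i]]_d) (u v : E -> R[i]) (g h gu : E -> 'cV[R[i]]_d).

Lemma vnorm2_subset U V g : measurable U -> measurable V -> U `<=` V -> vL2 V g ->
  vnorm2 U g <= vnorm2 V g.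
Proof.
move=> mU mV UV Lg; have sV := vL2_cnorm mV Lg; have sU := vL2_cnorm mU (vL2S mU mV UV Lg).
rewrite -lee_fin -!EFin_sqnorm//; apply: ge0_subset_integral => //.
  by apply/measurable_EFinP; apply: measurable_funX; exact: sV.1.
by move=> x _; rewrite lee_fin sqr_ge0.
Qed.

Lemma vnorm2_sym U g h : vnorm2 U (fun x => g x - h x) = vnorm2 U (fun x => h x - g x).
Proof. by apply: eq_Rintegral => x _; rewrite -cnormN opprB. Qed.

Lemma weak_solutionS O D A (K : R) x (r s : R) gu : open O -> D `<=` bd O -> 0 <= K ->
  bounded_coef O A K -> vL2 O gu -> r <= s ->
  weak_solution O D A x s gu -> weak_solution O D A x r gu.
Proof.
move=> oO DO K0 bA Lgu rs /(weak_solutionP x s oO DO K0 bA Lgu) H.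
apply/(weak_solutionP x r oO DO K0 bA Lgu) => w [t1 t2]; apply: H.
have sub : eball x r `\` D `<=` eball x s `\` D.
  by move=> y [yr nDy]; split => //; exact: lt_le_trans yr rs.
by split; [exact: test_funS t1|exact: test_funS t2].
Qed.

Variables (O D : set E) (A A0 : E -> 'M[R[i]]_d) (K K' lambda eps C : R) (x : E) (s : R).
Hypotheses (oO : open O) (DO : D `<=` bd O) (K0 : 0 <= K) (K'0 : 0 <= K') (lambda0 : 0 < lambda) (eps0 : 0 <= eps).
Hypotheses (bA : bounded_coef O A K) (bA0 : bounded_coef O A0 K').
Hypothesis ellA0 : elliptic O A0 lambda.
Hypothesis close : {ae mu, forall y, O y -> opnorm (A y - A0 y) <= eps}.
Hypothesis C0 : 0 <= C.
Hypothesis poinc : forall f, test_fun (eball x s `\` D) f ->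
  (\int[mu]_(y in O) (f y ^+ 2)%:E <= C%:E * \int[mu]_(y in O) (enorm2 (grad f y))%:E)%E.
Variables (u : E -> R[i]) (gu : E -> 'cV[R[i]]_d).
Hypotheses (Hu : H1_vanishing O D u gu) (su : weak_solution O D A x s gu).

Let U := loc O x s.
Let mO : measurable O := open_measurable_rV oO.
Let UO : U `<=` O. Proof. by move=> y []. Qed.
Let mU : measurable U.
Proof. by apply: open_measurable_rV; apply: openI => //; exact: open_eball. Qed.
Let Lu : L2 O u. Proof. by have [[]] := Hu. Qed.
Let Lgu : vL2 O gu. Proof. by have [[]] := Hu. Qed.

Let bAA0 : bounded_coef U (fun y => A y - A0 y) eps.
Proof.
split; last by move: close; apply: filterS => y H [Oy _]; exact: H.
move=> i j; have [a1 a2] := bA.1 i j; have [b1 b2] := bA0.1 i j.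
split.
  under eq_fun do rewrite !mxE ReD ReN.
  by apply: measurable_funB; [exact: measurable_funS a1|exact: measurable_funS b1].
under eq_fun do rewrite !mxE ImD ImN.
by apply: measurable_funB; [exact: measurable_funS a2|exact: measurable_funS b2].
Qed.

(** The form of [A] vanishes on [gu] and the test gradient, so that of [A0] may be replaced by that
    of the difference of the coefficients. The test gradient vanishes outside [U], which leaves only
    the energy of [u] on [U]. *)
Lemma residual_bound w : ctest_fun (eball x s `\` D) (toC w) ->
  `|bform O A0 gu (cgrad (toC w))| <=
  eps * Num.sqrt (vnorm2 U gu) * Num.sqrt (vnorm2 O (cgrad (toC w))).
Proof.
move=> tw; have Lw := ctest_vL2 mO tw.
have z := (weak_solutionP x s oO DO K0 bA Lgu).1 su w tw.
have out y : O y -> ~ U y -> cgrad (toC w) y = 0.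
  by move=> Oy nUy; apply: cgrad_out tw _ => -[By _]; apply: nUy.
rewrite -normrN -sub0r -z -(bform_sub mO K0 K'0 bA bA0 Lgu Lw).
rewrite (bform_support _ _ UO out) (vnorm2_support UO out) -mulrA.
exact: (bform_bound mU eps0 bAA0 (vL2S mU mO UO Lgu) (vL2S mU mO UO Lw)).
Qed.

(** The limit [gw] inherits the equation of the almost solutions, so [gu - gw] annihilates all test
    gradients. In the factor 4, one 2 comes from passing from [gw] to an almost solution [w], the
    other from squaring the sum of the two residual bounds. *)
Lemma nearby_solution : exists v gv, [/\ H1_vanishing O D v gv, weak_solution O D A0 x s gv
  & vnorm2 O (fun y => gu y - gv y) <= 4 * (eps / lambda) ^+ 2 * vnorm2 U gu].
Proof.
have [f1 [f2 [gw [s1 s2 Lgw app]]]] := galerkin_limit mO K'0 bA0 lambda0 ellA0 C0 poinc Lgu.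
pose v y := u y - Complex (f1 y) (f2 y); pose gv y := gu y - gw y.
have Lv : L2 O v by apply: L2B => //; apply/L2_sqint.
have Lgv : vL2 O gv := vL2B mO Lgu Lgw.
exists v, gv; split.
- apply: (H1_vanishingP _ mO Lv Lgv).2 => e e0.
  (* Each squared norm of a sum costs a factor 2: the approximation of [u] then contributes e / 2,
     and the three parts of the correction contribute e / 6 each. *)
  have e4 : 0 < e / 4 by rewrite divr_gt0.
  have e12 : 0 < e / 12 by rewrite divr_gt0.
  have [phi tphi] := (H1_vanishingP _ mO Lu Lgu).1 Hu _ e4.
  rewrite (H1_dist2E mO Lu Lgu (ctest_L2 mO tphi) (ctest_vL2 mO tphi)) lee_fin => dphi.
  have [w [tw _ w1 w2 w3]] := app _ e12.
  have Lw := ctest_vL2 mO tw; have Lw0 := ctest_L2 mO tw.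
  pose p : (E -> R) * (E -> R) := (fun y => Re (phi y), fun y => Im (phi y)).
  have tp : ctest_fun (~` D) (toC p) by [].
  have tz : ctest_fun (~` D) (toC (-1 *: w + p)).
    have sub : eball x s `\` D `<=` ~` D by move=> y [].
    have [t1 t2] := tw; have [p1 p2] := tphi.
    by split; apply: test_fun_lin => //; [exact: test_funS t1|exact: test_funS t2].
  exists (toC (-1 *: w + p)); first exact: tz.
  rewrite (H1_dist2E mO Lv Lgv (ctest_L2 mO tz) (ctest_vL2 mO tz)) lee_fin.
  have [u1 u2] := (L2_sqint mO u).1 Lu; have [p1 p2] := (L2_sqint mO _).1 (ctest_L2 mO tphi).
  have [q1 q2] := (L2_sqint mO _).1 Lw0.
  have b1 := sqnormD_le mO (sqintB mO u1 p1) (sqintB mO q1 s1).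
  have b2 := sqnormD_le mO (sqintB mO u2 p2) (sqintB mO q2 s2).
  have b3 := vnorm2D_le mO (vL2B mO Lgu (ctest_vL2 mO tphi)) (vL2B mO Lw Lgw).
  have -> : (fun y => Re (v y) - Re (toC (-1 *: w + p) y)) =
      (fun y => (Re (u y) - Re (phi y)) + (Re (toC w y) - f1 y)).
    by apply/funext => y; rewrite /v ReD ReN/= !fctE /GRing.scale/=; ring.
  have -> : (fun y => Im (v y) - Im (toC (-1 *: w + p) y)) =
      (fun y => (Im (u y) - Im (phi y)) + (Im (toC w y) - f2 y)).
    by apply/funext => y; rewrite /v ImD ImN/= !fctE /GRing.scale/=; ring.
  have -> : (fun y => gv y - cgrad (toC (-1 *: w + p)) y) =
      (fun y => (gu y - cgrad phi y) + (cgrad (toC w) y - gw y)).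
    apply/funext => y; rewrite (cgrad_lin (-1) y tw tp).
    have -> : Complex (-1) 0 = -1 :> R[i] by rewrite -[RHS]/(Complex _ _) oppr0.
    rewrite scaleN1r opprD opprK /gv -[cgrad (toC p) y]/(cgrad phi y).
    by rewrite [LHS]addrACA [RHS]addrACA; congr (_ + _); rewrite addrC.
  exact: (le_of_double_sums dphi w1 w2 w3 b1 b2 b3).
- apply/(weak_solutionP x s oO DO K'0 bA0 Lgv) => z tz.
  have Lz := ctest_vL2 mO tz.
  apply: (@eq0_of_le_sqrt _ _ ((1 + K') * Num.sqrt (vnorm2 O (cgrad (toC z))))).
    by rewrite mulr_ge0 ?addr_ge0 ?sqrtr_ge0.
  move=> e e0; have [w [tw Hw _ _ w3]] := app e e0.
  have Lw := ctest_vL2 mO tw.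
  have -> : bform O A0 gv (cgrad (toC z)) =
      (bform O A0 gu (cgrad (toC z)) - bform O A0 (cgrad (toC w)) (cgrad (toC z))) +
      bform O A0 (fun y => cgrad (toC w) y - gw y) (cgrad (toC z)).
    rewrite /gv (bformBl mO K'0 bA0 Lgu Lgw Lz) (bformBl mO K'0 bA0 Lw Lgw Lz).
    by rewrite addrA subrK.
  apply: (le_trans (ler_normD _ _)); rewrite -mulrA mulrDl mul1r; apply: lerD.
    by rewrite mulrC; exact: Hw.
  apply: (le_trans (bform_bound mO K'0 bA0 (vL2B mO Lw Lgw) Lz)).
  rewrite ler_wpM2l// mulrC ler_wpM2l ?sqrtr_ge0// ler_wsqrtr//.
- have -> : (fun y => gu y - gv y) = gw by apply/funext => y; rewrite /gv subKr.
  set P := vnorm2 U gu; have P0 : 0 <= P := vnorm2_ge0 U gu.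
  apply/ler_addgt0Pr => t t0.
  have L2 : 0 < lambda ^+ 2 by rewrite exprn_gt0.
  have c0 : 0 < 4 / lambda ^+ 2 + 2 by rewrite addr_gt0// divr_gt0.
  (* The residual of [w] contributes 4 e / lambda^2 and its distance to [gw] contributes 2 e, in
     total [t]. *)
  set e := t / (4 / lambda ^+ 2 + 2); have e0 : 0 < e by rewrite divr_gt0.
  have [w [tw Hw _ _ w3]] := app e e0; have Lw := ctest_vL2 mO tw.
  have nw : vnorm2 O (cgrad (toC w)) <= ((Num.sqrt e + eps * Num.sqrt P) / lambda) ^+ 2.
    apply: (@le_sqr_of_forms _ _ _ (bform O A0 gu (cgrad (toC w)))
      (bform O A0 (cgrad (toC w)) (cgrad (toC w))) 0 _ _ lambda0 (vnorm2_ge0 _ _)).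
    - exact: sqrtr_ge0.
    - by rewrite mulr_ge0// sqrtr_ge0.
    - rewrite subr0; exact: (bform_coercive mO K'0 bA0 Lw ellA0).
    - exact: Hw.
    - rewrite subr0; exact: residual_bound.
  have tri := vnorm2D_le mO Lw (vL2B mO Lgw Lw).
  have E : (fun y => cgrad (toC w) y + (gw y - cgrad (toC w) y)) = gw.
    by apply/funext => y; rewrite addrC subrK.
  rewrite E vnorm2_sym in tri.
  have te : t = (4 / lambda ^+ 2 + 2) * e by rewrite /e mulrC divfK// gt_eqF.
  have sq : ((Num.sqrt e + eps * Num.sqrt P) / lambda) ^+ 2 <=
      2 * e / lambda ^+ 2 + 2 * (eps / lambda) ^+ 2 * P.
    have E1 : Num.sqrt e ^+ 2 = e by rewrite sqr_sqrtr// ltW.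
    have E2 : Num.sqrt P ^+ 2 = P by rewrite sqr_sqrtr.
    rewrite -{2}E1 -{2}E2 !expr_div_n.
    have -> : 2 * Num.sqrt e ^+ 2 / lambda ^+ 2 + 2 * (eps ^+ 2 / lambda ^+ 2) * Num.sqrt P ^+ 2 =
      (2 * Num.sqrt e ^+ 2 + 2 * (eps * Num.sqrt P) ^+ 2) / lambda ^+ 2 by field; rewrite gt_eqF.
    rewrite ler_pM2r ?invr_gt0//.
    by have := sqr_ge0 (Num.sqrt e - eps * Num.sqrt P); rewrite sqrrB sqrrD; lra.
  exact: (le_of_triangle tri nw sq w3 te).
Qed.

End comparison.

(** * Energy decay *)

(** Induction on the number of multiplications by [tau] that bring the radius below [r]. The
    intermediate radii cost a single factor tau^(-b), because the prefactor is not affected by the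
    steps. *)
Lemma power_decay (R : realType) (F : R -> R) (tau b s : R) : 0 < tau <= 2^-1 -> 0 <= b ->
  (forall r, 0 <= F r) -> (forall r r', r <= r' -> r' <= s -> F r <= F r') ->
  (forall r, 0 < r <= s -> F (tau * r) <= tau `^ b * F r) ->
  forall r, 0 < r <= s -> F r <= tau `^ (- b) * (r / s) `^ b * F s.
Proof.
move=> /andP[tau0 tau2] b0 F0 Fmono step r /andP[r0 rs].
have tb0 : 0 < tau `^ b by rewrite powR_gt0.
have main : forall k t, r <= t -> t <= s -> tau ^+ k * t < r ->
    F r <= tau `^ (- b) * (r / t) `^ b * F t.
  elim=> [|k IH] t rt ts; first by rewrite expr0 mul1r ltNge rt.
  move=> kr; have t0 : 0 < t := lt_le_trans r0 rt.
  have [tr|tr] := ltP (tau * t) r.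
    (* Between tau t and t only monotonicity is available, and the prefactor makes up for the
       missing decay. *)
    have one : 1 <= tau `^ (- b) * (r / t) `^ b.
      rewrite powRN mulrC ler_pdivlMr// mul1r ge0_ler_powR ?nnegrE ?divr_ge0 ?(ltW tau0) ?(ltW r0) ?(ltW t0)//.
      by rewrite ler_pdivlMr// ltW.
    by apply: (le_trans (Fmono _ _ rt ts)); rewrite ler_peMl.
  have tt : tau * t <= t by rewrite ler_piMl ?(ltW t0)//; lra.
  apply: (le_trans (IH (tau * t) tr (le_trans tt ts) _)); first by rewrite mulrA -exprSr.
  have -> : r / t = tau * (r / (tau * t)) by field; rewrite !gt_eqF.
  rewrite (powRM _ (ltW tau0)); last by rewrite divr_ge0 ?(ltW r0)// mulr_ge0 ?ltW.
  rewrite -!mulrA ler_wpM2l ?powR_ge0// mulrCA ler_wpM2l ?powR_ge0//.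
  by apply: step; rewrite t0.
have s0 : 0 < s := lt_le_trans r0 rs.
apply: (main (Num.trunc (s / r)).+1 s rs (lexx s)).
(* This many steps suffice: since tau <= 1/2 and 2^n >= n > s / r, one has tau^n s < r. *)
set n := (Num.trunc _).+1.
have sr : s / r < n%:R by exact: truncnS_gt.
have tn : tau ^+ n * 2 ^+ n <= 1.
  by rewrite -exprMn expr_le1// ?mulr_ge0 ?(ltW tau0)// -ler_pdivlMr// mul1r.
have n2 : (n%:R : R) <= 2 ^+ n by rewrite -natrX ler_nat ltnW// ltn_expl.
have sr2 : s < 2 ^+ n * r by rewrite -ltr_pdivrMr//; exact: lt_le_trans n2.
apply: (@lt_le_trans _ _ (tau ^+ n * (2 ^+ n * r))); first by rewrite ltr_pM2l// exprn_gt0.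
by rewrite mulrA ler_piMl// ltW.
Qed.

Section decay_step.
Context (R : realType) (d : nat).
Local Notation E := 'rV[R]_d.
Local Notation mes := (lebesgue_rV R d).
Variables (O D : set E) (A A0 : E -> 'M[R[i]]_d) (K K' c lambda mu eps C : R) (x : E) (r s : R).
Hypotheses (oO : open O) (DO : D `<=` bd O) (K0 : 0 <= K) (K'0 : 0 <= K') (lambda0 : 0 < lambda)
  (eps0 : 0 <= eps) (eps2 : eps <= lambda / 2).
Hypotheses (bA : bounded_coef O A K) (bA0 : bounded_coef O A0 K').
Hypothesis ellA0 : elliptic O A0 lambda.
Hypothesis close : {ae mes, forall y, O y -> opnorm (A y - A0 y) <= eps}.
Hypothesis C0 : 0 <= C.
Hypothesis poinc : forall f, test_fun (eball x s `\` D) f ->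
  (\int[mes]_(y in O) (f y ^+ 2)%:E <= C%:E * \int[mes]_(y in O) (enorm2 (grad f y))%:E)%E.
Variables (u : E -> R[i]) (gu : E -> 'cV[R[i]]_d).
Hypotheses (Hu : H1_vanishing O D u gu) (su : weak_solution O D A x s gu).
Hypotheses (c0 : 0 < c) (DA0 : property_D O D A0 mu c).
Hypotheses (r0 : 0 < r) (rs : r <= s) (s1 : s <= 1) (Ox : closure O x).

(** From [u] to [v] on the small ball, decay of [v], and back from [v] to [u] on the large ball.
    Each passage costs a factor 2 and the error of [nearby_solution]. *)
Lemma decay_step : vnorm2 (loc O x r) gu <=
  (8 * c * (r / s) `^ (d%:R - 2 + 2 * mu) + 8 * (eps / lambda) ^+ 2) * vnorm2 (loc O x s) gu.
Proof.
have [v [gv [Hv sv close_uv]]] := nearby_solution oO DO K0 K'0 lambda0 eps0 bA bA0 ellA0 close C0 poinc Hu su.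
have mO := open_measurable_rV oO.
have mL t : measurable (loc O x t).
  by apply: open_measurable_rV; apply: openI => //; exact: open_eball.
have LO t : loc O x t `<=` O by move=> y [].
have Lgu : vL2 O gu by have [[]] := Hu.
have Lgv : vL2 O gv by have [[]] := Hv.
have Lu t : vL2 (loc O x t) gu := vL2S (mL t) mO (@LO t) Lgu.
have Lv t : vL2 (loc O x t) gv := vL2S (mL t) mO (@LO t) Lgv.
have := DA0 r0 rs s1 Ox Hv sv; rewrite !energyE//.
rewrite -EFinM lee_fin => decay_v.
set q := (r / s) `^ _ in decay_v *; have q0 : 0 <= q by exact: powR_ge0.
set k := (eps / lambda) ^+ 2 in close_uv *.
(* This is where [eps <= lambda / 2] enters: on the large ball the energy of [v] is then at most 4
   times that of [u], which yields the factor 8 c. *)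
have k4 : 4 * k <= 1.
  have : eps / lambda <= 2^-1 by rewrite ler_pdivrMr// mulrC.
  have : 0 <= eps / lambda by rewrite divr_ge0// ltW.
  by rewrite /k; move: (eps / lambda) => t t0 t1; nra.
have dist t : vnorm2 (loc O x t) (fun y => gu y - gv y) <= 4 * k * vnorm2 (loc O x s) gu.
  by apply: le_trans close_uv; apply: vnorm2_subset => //; exact: vL2B.
have tri1 : vnorm2 (loc O x r) gu <= 2 * vnorm2 (loc O x r) gv + 2 * (4 * k * vnorm2 (loc O x s) gu).
  have := vnorm2D_le (mL r) (Lv r) (vL2B (mL r) (Lu r) (Lv r)).
  rewrite (_ : (fun y => gv y + (gu y - gv y)) = gu); last by apply/funext => y; rewrite addrC subrK.
  by move=> H; apply: (le_trans H); exact: (lerD (lexx _) (ler_wpM2l (ler0n _ 2) (dist r))).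
have tri2 : vnorm2 (loc O x s) gv <= 2 * vnorm2 (loc O x s) gu + 2 * (4 * k * vnorm2 (loc O x s) gu).
  have := vnorm2D_le (mL s) (Lu s) (vL2B (mL s) (Lv s) (Lu s)).
  rewrite (_ : (fun y => gu y + (gv y - gu y)) = gv); last by apply/funext => y; rewrite addrC subrK.
  by move=> H; apply: (le_trans H); rewrite vnorm2_sym; exact: (lerD (lexx _) (ler_wpM2l (ler0n _ 2) (dist s))).
have n0 := vnorm2_ge0 (loc O x s) gu.
move: (vnorm2 (loc O x s) gu) (vnorm2 (loc O x r) gu) (vnorm2 (loc O x s) gv) (vnorm2 (loc O x r) gv)
  decay_v tri1 tri2 n0 => n1 n2 n3 n4 h1 h2 h3 n0.
have h4 : n3 <= 4 * n1.
  apply: (le_trans h3); have : 4 * k * n1 <= 1 * n1 by rewrite ler_wpM2r.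
  lra.
have h5 : c * q * n3 <= c * q * (4 * n1) by rewrite ler_wpM2l// mulr_ge0// ltW.
lra.
Qed.

End decay_step.

Theorem theorem9p1 (R : realType) (d : nat) (c lambda mu : R) :
  (2 <= d)%N -> 0 < c -> 0 < lambda -> 0 < mu <= 1 ->
  forall nu : R, 0 < nu < mu ->
  exists2 eps : R, 0 < eps &
    forall O D : set 'rV[R]_d,
      open O -> closed D -> D `<=` bd O ->
      fat_away_from_neumann O D -> uniform_near_neumann O D ->
    forall A A0 : 'rV[R]_d -> 'M[R[i]]_d,
      Linf O A -> Linf O A0 ->
      (exists2 lambdaA : R, 0 < lambdaA & elliptic O A lambdaA) ->
      elliptic O A0 lambda ->
      property_D O D A0 mu c ->
      (Linf_norm O (fun x => A x - A0 x)%R < eps%:E)%E ->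
      exists2 c' : R, 0 < c' & property_D O D A nu c'.
Proof.
move=> d2 c0 lambda0 _ nu /andP[nu0 numu].
pose a : R := d%:R - 2 + 2 * mu; pose b : R := d%:R - 2 + 2 * nu; pose del : R := 2 * (mu - nu).
have d2' : (2 : R) <= d%:R by rewrite ler_nat.
have b0 : 0 <= b by rewrite /b; lra.
have del0 : 0 < del by rewrite /del; lra.
have c16 : 0 < (16 * c)^-1 by rewrite invr_gt0 mulr_gt0.
(* Since a - b = [del], this makes 8 c tau^a at most half of tau^b; the bound 1/2 is required by
   [power_decay]. *)
pose tau : R := Num.min 2^-1 ((16 * c)^-1 `^ del^-1).
have tau0 : 0 < tau by rewrite lt_min invr_gt0 ltr0n powR_gt0.
have tau2 : tau <= 2^-1 by rewrite ge_min lexx.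
have tauD : tau `^ del <= (16 * c)^-1.
  apply: (@le_trans _ _ (((16 * c)^-1 `^ del^-1) `^ del)).
    by rewrite ge0_ler_powR ?nnegrE ?(ltW tau0) ?powR_ge0 ?(ltW del0)// ge_min lexx orbT.
  by rewrite -powRrM mulVf ?gt_eqF// powRr1 ?(ltW c16).
have tb0 : 0 < tau `^ b by rewrite powR_gt0.
have tauA : 8 * c * tau `^ a <= tau `^ b / 2.
  have -> : a = b + del by rewrite /a /b /del; ring.
  rewrite powRD; last by rewrite (gt_eqF tau0) implybT.
  rewrite mulrCA ler_pM2l// -ler_pdivlMl ?mulr_gt0//; apply: le_trans tauD _.
  by rewrite -invfM le_eqVlt; apply/orP; left; apply/eqP; congr _^-1; ring.
(* The second bound makes 8 (eps / lambda)^2 at most the other half of tau^b. Nothing here depends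
   on [O] or [D]. *)
pose eps : R := Num.min (lambda / 2) (lambda * Num.sqrt (tau `^ b / 16)).
have eps0 : 0 < eps by rewrite lt_min divr_gt0//= mulr_gt0// sqrtr_gt0 divr_gt0.
have epsl : eps <= lambda / 2 by rewrite ge_min lexx.
have epsk : 8 * (eps / lambda) ^+ 2 <= tau `^ b / 2.
  have e1 : eps / lambda <= Num.sqrt (tau `^ b / 16) by rewrite ler_pdivrMr// mulrC ge_min lexx orbT.
  have e0 : 0 <= eps / lambda by rewrite divr_ge0// ltW.
  have : (eps / lambda) ^+ 2 <= tau `^ b / 16.
    by rewrite -[leRHS]sqr_sqrtr ?ler_sqr ?nnegrE ?sqrtr_ge0// divr_ge0// ltW.
  by move: (eps / lambda) (tau `^ b) => p q; clear; lra.
exists eps => // O D oO _ DO _ unifO A A0 LA LA0 _ ell DA0 AA0.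
have mO := open_measurable_rV oO.
have [K K0 bA] := Linf_bounded_coef mO mO (@subset_refl _ O) LA.
have [K' K'0 bA0] := Linf_bounded_coef mO mO (@subset_refl _ O) LA0.
have [R0 R00 poinc] := poincare (ltnW d2) oO unifO.
pose R1 := Num.min R0 1.
have R10 : 0 < R1 by rewrite lt_min R00 ltr01.
have R1R0 : R1 <= R0 by rewrite ge_min lexx.
have R11 : R1 <= 1 by rewrite ge_min lexx orbT.
have ge1 t : 0 < t <= 1 -> 1 <= t `^ (- b).
  by move=> t01; rewrite -(powRr0 t); apply: ger_powR => //; rewrite oppr_le0.
have t1 : 1 <= tau `^ (- b) by apply: ge1; rewrite tau0 (le_trans tau2)// invf_le1 ?ler1n.
have T1 : 1 <= R1 `^ (- b) by apply: ge1; rewrite R10.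
(* The decay is obtained for radii up to [R1]. Between [R1] and 1 the energy is only known to be
   monotone, and the factor R1^(-b) compensates for this. *)
exists (tau `^ (- b) * R1 `^ (- b)); first by rewrite mulr_gt0// powR_gt0.
move=> r s x u gu r0 rs s1 Ox Hu sol.
have mL t : measurable (loc O x t).
  by apply: open_measurable_rV; apply: openI => //; exact: open_eball.
have LO t : loc O x t `<=` O by move=> y [].
have Lgu : vL2 O gu by have [[]] := Hu.
have Lu t : vL2 (loc O x t) gu := vL2S (mL t) mO (@LO t) Lgu.
rewrite !energyE// -EFinM lee_fin -/b.
pose F t := vnorm2 (loc O x t) gu.
have F0 t : 0 <= F t by exact: vnorm2_ge0.
have mono p q : p <= q -> F p <= F q.
  by move=> pq; apply: vnorm2_subset => // y [Oy yp]; split => //; exact: lt_le_trans yp pq.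
have s0 := lt_le_trans r0 rs.
have small t : t <= R1 -> t <= s -> forall p, 0 < p <= t -> F p <= tau `^ (- b) * (p / t) `^ b * F t.
  move=> tR1 ts; apply: power_decay => //; [by rewrite tau0|by move=> p q pq _; exact: mono|].
  move=> p /andP[p0 pt].
  have pR : 0 < p <= R0 by rewrite p0 (le_trans pt)// (le_trans tR1).
  have [C C0 po] := poinc x p pR.
  have ps : p <= s := le_trans pt ts.
  apply: (@le_trans _ _ ((8 * c * (tau * p / p) `^ a + 8 * (eps / lambda) ^+ 2) * F p)).
    apply: (@decay_step _ _ O D A A0 K K' c lambda mu eps C x (tau * p) p oO DO K0 K'0 lambda0
      (ltW eps0) epsl bA bA0 ell (Linf_bound AA0) C0 po u gu Hu) => //.
    - exact: weak_solutionS oO DO K0 bA Lgu ps sol.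
    - exact: mulr_gt0.
    - by rewrite ler_piMl ?(ltW p0)// (le_trans tau2)// invf_le1 ?ler1n.
    - exact: le_trans ps s1.
  rewrite mulfK ?gt_eqF// ler_wpM2r//; move: tauA epsk; clear; lra.
have RE : R1 `^ (- b) = (R1^-1) `^ b by rewrite -powR_inv1 ?(ltW R10)// -powRrM mulN1r.
have rs0 : 0 <= r / s by rewrite divr_ge0 ?ltW.
have q0 : 0 <= (r / s) `^ b by exact: powR_ge0.
have RM : R1 `^ (- b) * (r / s) `^ b = (R1^-1 * (r / s)) `^ b by rewrite RE -powRM// invr_ge0 ltW.
have rrs : r <= r / s by rewrite ler_pdivlMr// ler_piMr ?(ltW r0).
have Ri : 0 <= R1^-1 by rewrite invr_ge0 ltW.
have [sR|Rs] := leP s R1.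
  apply: (le_trans (small s sR (lexx s) r _)); first by rewrite r0.
  by rewrite ler_wpM2r// ler_wpM2r// ler_peMr// powR_ge0.
rewrite -[tau `^ _ * _ * _]mulrA RM.
(* For r <= R1 < s the decay is started from [R1] in place of [s]; as s <= 1, the quotient r / R1 is
   at most (r / s) / R1. For r > R1 the constant alone suffices. *)
have [rR|Rr] := leP r R1.
  apply: (le_trans (small R1 (lexx R1) (ltW Rs) r _)); first by rewrite r0.
  apply: ler_pM => //; [by rewrite mulr_ge0 ?powR_ge0| |by apply: mono; exact: ltW].
  rewrite ler_wpM2l ?powR_ge0//.
  have le : r / R1 <= R1^-1 * (r / s) by rewrite mulrC ler_wpM2l.
  by apply: (ge0_ler_powR b0) => //; rewrite nnegrE; [rewrite divr_ge0 ?ltW|exact: mulr_ge0].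
apply: (le_trans (mono _ _ rs)); rewrite ler_peMl// -[leLHS]mul1r; apply: ler_pM => //.
rewrite -[leLHS](powRr0 1).
apply: (@le_trans _ _ (1 `^ b)); first by rewrite !powR1.
have le : 1 <= R1^-1 * (r / s) by rewrite mulrC ler_pdivlMr// mul1r (le_trans (ltW Rr)).
by apply: (ge0_ler_powR b0) => //; rewrite nnegrE; [exact: ler01|exact: mulr_ge0].
Qed.
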